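(* Let $n\in\mathbb{N}$ and let $E_1,\ldots,E_n,F$ be Banach spaces. If $\mathcal{L}(E_1,\ldots,E_n)$ or $F^*$ has the approximation property, then the hyper-Borel transform $$\mathcal{B}_n\colon(\mathcal{L}_{\mathcal{K}}(E_1,\ldots,E_n;F),\|\cdot\|)^*\longrightarrow(\mathcal{J}(\mathcal{L}(E_1,\ldots,E_n);F^* ),\|\cdot\|_{\mathcal{J}}),\quad \mathcal{B}_n(\phi)(A)(y)=\phi(A\otimes y),$$ is an isometric isomorphism (onto).
   Context: Banach spaces are over $\mathbb{K}=\mathbb{R}$ or $\mathbb{C}$. $\mathcal{L}(E_1,\ldots,E_n;F)$ is the Banach space of continuous $n$-linear operators with the usual operator norm $\|\cdot\|$; $\mathcal{L}(E_1,\ldots,E_n)$ is the case $F=\mathbb{K}$. For $A\in\mathcal{L}(E_1,\ldots,E_n)$, $y\in F$, $(A\otimes y)(x_1,\ldots,x_n)=A(x_1,\ldots,x_n)y$. $\mathcal{L}_{\mathcal{K}}(E_1,\ldots,E_n;F)$ is the space of compact $n$-linear operators, i.e. those mapping $B_{E_1}\times\cdots\times B_{E_n}$ onto a relatively compact subset of $F$, endowed with the usual operator norm. $(\mathcal{J},\|\cdot\|_{\mathcal{J}})$ is the Banach ideal of integral linear operators (in Grothendieck's sense): $u\in\mathcal{L}(X;Y)$ is integral if there is a regular Borel measure $\mu$ on the weak$^*$-compact space $B_{X^*}\times B_{Y^{**}}$ with $y^*(u(x))=\int x^*(x)\,y^{**}(y^* )\,d\mu(x^*,y^{**})$ for all $x\in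 X$, $y^*\in Y^*$, and $\|u\|_{\mathcal{J}}$ is the infimum of the total variations of such $\mu$. Here $B_X$ denotes the closed unit ball of $X$. *)

(* Defs.v *)
From HB Require Import structures.
From mathcomp Require Import all_boot all_order all_algebra.
From mathcomp Require Import complex.
From mathcomp Require Import all_classical all_reals all_analysis.

Set Implicit Arguments.
Unset Strict Implicit.
Unset Printing Implicit Defensive.

Import Order.TTheory GRing.Theory Num.Theory.
Import numFieldNormedType.Exports.

Local Open Scope classical_set_scope.
Local Open Scope ring_scope.

Variant scalar_kind := RealScalars | ComplexScalars.


Definition scalar_field (R : realType) (k : scalar_kind) : numFieldType :=
  match k with
  | RealScalars => R
  | ComplexScalars => R[i]%C
  end.

Definition ofreal (R : realType) (k : scalar_kind) : R -> scalar_field R k :=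
  match k return R -> scalar_field R k with
  | RealScalars => fun r => r
  | ComplexScalars => fun r => r%:C%C
  end.

Definition rpart (R : realType) (k : scalar_kind) : scalar_field R k -> R :=
  match k return scalar_field R k -> R with
  | RealScalars => fun z => z
  | ComplexScalars => fun z => complex.Re z
  end.

Definition ipart (R : realType) (k : scalar_kind) : scalar_field R k -> R :=
  match k return scalar_field R k -> R with
  | RealScalars => fun=> 0
  | ComplexScalars => fun z => complex.Im z
  end.

(* The imaginary part b is dropped over the reals, where it is always 0. *)
Definition mkscalar (R : realType) (k : scalar_kind) (a b : R) : scalar_field R k :=
  match k return scalar_field R k with
  | RealScalars => a
  | ComplexScalars => (a +i* b)%C
  end.
Arguments mkscalar {R} k a b.
Arguments ofreal {R} k r.

Section ScalarTheory.
Variables (R : realType) (k : scalar_kind).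
Implicit Types (r s : R) (z w : scalar_field R k).

Lemma ofrealK : cancel (@ofreal R k) (@rpart R k).
Proof. by case: k. Qed.

Lemma ofreal0 : ofreal k 0 = 0 :> scalar_field R k.
Proof. by case: k. Qed.

Lemma ofreal1 : ofreal k 1 = 1 :> scalar_field R k.
Proof. by case: k. Qed.

Lemma ofrealD r s : ofreal k (r + s) = ofreal k r + ofreal k s.
Proof. by case: k => //=; rewrite rmorphD. Qed.

Lemma ofrealM r s : ofreal k (r * s) = ofreal k r * ofreal k s.
Proof. by case: k => //=; rewrite rmorphM. Qed.

Lemma ofreal_le r s : (ofreal k r <= ofreal k s) = (r <= s).
Proof. by case: k => //=; rewrite lecR. Qed.

Lemma ofreal_lt r s : (ofreal k r < ofreal k s) = (r < s).
Proof. by case: k => //=; rewrite ltcR. Qed.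

Lemma rpartD z w : rpart (z + w) = rpart z + rpart w.
Proof. by case: k z w => //= -[a b] [c d]. Qed.

Lemma ipartD z w : ipart (z + w) = ipart z + ipart w.
Proof. by case: k z w => /=[_ _|[a b] [c d]] //; rewrite addr0. Qed.

Lemma rpart0 : rpart (0 : scalar_field R k) = 0.
Proof. by case: k. Qed.

Lemma ipart0 : ipart (0 : scalar_field R k) = 0.
Proof. by case: k. Qed.

Lemma rpartK z : 0 <= z -> ofreal k (rpart z) = z.
Proof.
by case: k z => //= -[a b]; rewrite lecE /= => /andP[/eqP -> _].
Qed.

Lemma mkscalarE z : mkscalar k (rpart z) (ipart z) = z.
Proof. by case: k z => //= -[]. Qed.

Lemma rpart_norm_le z : `|rpart z| <= rpart `|z|.
Proof.
case: k z => /= [z|[a b]]; first by rewrite ler_norml lerNl ler_norm -normrN ler_norm.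
rewrite -sqrtr_sqr ler_wsqrtr// lerDl sqr_ge0//.
Qed.

Lemma ipart_norm_le z : `|ipart z| <= rpart `|z|.
Proof.
case: k z => /= [z|[a b]]; first by rewrite normr0.
by rewrite -sqrtr_sqr ler_wsqrtr// lerDr sqr_ge0.
Qed.

Lemma mkscalar_norm_le (a b : R) : `|mkscalar k a b| <= ofreal k (`|a| + `|b|).
Proof.
case: k => /=; first by rewrite lerDl.
rewrite lecR -ler_sqr ?nnegrE ?sqrtr_ge0 ?addr_ge0// sqr_sqrtr ?addr_ge0 ?sqr_ge0//.
rewrite sqrrD !real_normK ?num_real// -addrA lerD2l lerDr.
by rewrite mulrn_wge0// mulr_ge0.
Qed.

Lemma mkscalarB (a b c d : R) :
  mkscalar k a b - mkscalar k c d = mkscalar k (a - c) (b - d).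
Proof. by case: k. Qed.

End ScalarTheory.

(* The library norm of a normed module over K takes values in K; rnorm is its
   value in R. *)
Definition rnorm (R : realType) (k : scalar_kind)
  (V : normedZmodType (scalar_field R k)) (v : V) : R := rpart `|v|.

Section RealNorm.
Variables (R : realType) (k : scalar_kind).
Local Notation K := (scalar_field R k).

Lemma rnormE (V : normedZmodType K) (v : V) : ofreal k (rnorm v) = `|v|.
Proof. by rewrite rpartK. Qed.

Lemma rnorm_ge0 (V : normedZmodType K) (v : V) : 0 <= rnorm v.
Proof. by rewrite -(ofreal_le k) rnormE ofreal0. Qed.

Lemma rnorm0 (V : normedZmodType K) : rnorm (0 : V) = 0.
Proof. by rewrite /rnorm normr0 rpart0. Qed.

Lemma rnorm_eq0 (V : normedZmodType K) (v : V) : rnorm v = 0 -> v = 0.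
Proof. by move=> v0; apply/normr0_eq0; rewrite -rnormE v0 ofreal0. Qed.

Lemma rnormD (V : normedZmodType K) (v w : V) :
  rnorm (v + w) <= rnorm v + rnorm w.
Proof. by rewrite -(ofreal_le k) ofrealD !rnormE ler_normD. Qed.

Lemma rnormN (V : normedZmodType K) (v : V) : rnorm (- v) = rnorm v.
Proof. by rewrite /rnorm normrN. Qed.

Lemma rnormZ (V : normedModType K) (a : K) (v : V) :
  rnorm (a *: v) = rnorm a * rnorm v.
Proof.
by apply: (can_inj (@ofrealK R k)); rewrite ofrealM !rnormE normrZ.
Qed.

Lemma rnorm_ofreal (r : R) : 0 <= r -> rnorm (ofreal k r : K) = r.
Proof.
move=> r0; apply: (can_inj (@ofrealK R k)).
by rewrite rnormE ger0_norm// -(ofreal0 R k) ofreal_le.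
Qed.

Lemma rnorm_distC (V : normedZmodType K) (v w : V) :
  rnorm (v - w) = rnorm (w - v).
Proof. by rewrite -rnormN opprB. Qed.

Lemma ofreal_gt0P (e : K) : 0 < e -> exists2 r : R, 0 < r & e = ofreal k r.
Proof.
move=> e0; exists (rpart e); last by rewrite rpartK// ltW.
by rewrite -(ofreal_lt k) rpartK ?ofreal0// ltW.
Qed.

Lemma rnorm_cvg (V : normedModType K) (F : set_system V) (y : V) :
  Filter F ->
  (forall e : R, 0 < e -> F [set z | rnorm (y - z) < e]) -> F --> y.
Proof.
move=> FF H; apply/cvgrPdist_lt => e /ofreal_gt0P[r r0 ->].
by apply: filterS (H _ r0) => z /=; rewrite -rnormE ofreal_lt.
Qed.

Lemma rnorm_nbhs (V : normedModType K) (y : V) (e : R) : 0 < e ->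
  nbhs y [set z | rnorm (y - z) < e].
Proof.
move=> e0; apply/nbhs_normP; exists (ofreal k e) => /=.
  by rewrite -(ofreal0 R k) ofreal_lt.
by move=> z /=; rewrite -rnormE ofreal_lt.
Qed.

End RealNorm.

(* Continuous linear, continuous n-linear and compact n-linear operators are all
   given the sup norm over a unit ball by one construction: opclass C gathers a
   linear space opmem C of functions T -> F that are bounded on the set opball C
   and determined by their values there, and opspace C is that space with the
   norm opnorm f = sup { |f t| : t in opball C }. *)
Record opclass (R : realType) (k : scalar_kind) (T : Type)
    (F : normedModType (scalar_field R k)) := OpClass {
  opball : set T ;
  opmem : set (T -> F) ;
  opball_neq0 : opball !=set0 ;
  opmem0 : opmem (fun=> 0) ;
  opmemD : forall f g, opmem f -> opmem g -> opmem (fun t => f t + g t) ;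
  opmemZ : forall a f, opmem f -> opmem (fun t => a *: f t) ;
  opmem_bounded : forall f, opmem f ->
    exists M : R, forall t, opball t -> rnorm (f t) <= M ;
  opmem_sep : forall f, opmem f -> (forall t, opball t -> f t = 0) ->
    forall t, f t = 0 }.

Record opspace (R : realType) (k : scalar_kind) (T : Type)
    (F : normedModType (scalar_field R k)) (C : opclass T F) := Op {
  op_fun :> T -> F ;
  op_memP : opmem C op_fun }.

Definition opnorm (R : realType) (k : scalar_kind) (T : Type)
    (F : normedModType (scalar_field R k)) (C : opclass T F) (f : opspace C) : R :=
  sup [set rnorm (f t) | t in opball C].

Section OpSpace.
Variables (R : realType) (k : scalar_kind) (T : Type).
Local Notation K := (scalar_field R k).
Variables (F : normedModType K) (C : opclass T F).
Local Notation L := (opspace C).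

Lemma op_eq (f g : L) : (forall t, f t = g t) -> f = g.
Proof.
case: f g => f fP [g gP] /= /funext fg; subst g.
by congr Op; exact: Prop_irrelevance.
Qed.

HB.instance Definition _ := gen_eqMixin L.
HB.instance Definition _ := gen_choiceMixin L.

Let opN (f : L) : opmem C (fun t => - f t).
Proof.
rewrite (_ : (fun t => - f t) = (fun t => -1 *: f t)).
  exact: opmemZ (op_memP f).
by apply/funext => t; rewrite scaleN1r.
Qed.

Let zero_op : L := Op (opmem0 C).
Let opp_op (f : L) : L := Op (opN f).
Let add_op (f g : L) : L := Op (opmemD (op_memP f) (op_memP g)).
Let scale_op (a : K) (f : L) : L := Op (opmemZ a (op_memP f)).

Let add_opA : associative add_op.
Proof. by move=> f g h; apply: op_eq => t /=; rewrite addrA. Qed.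
Let add_opC : commutative add_op.
Proof. by move=> f g; apply: op_eq => t /=; rewrite addrC. Qed.
Let add_op0 : left_id zero_op add_op.
Proof. by move=> f; apply: op_eq => t /=; rewrite add0r. Qed.
Let add_opN : left_inverse zero_op opp_op add_op.
Proof. by move=> f; apply: op_eq => t /=; rewrite addNr. Qed.

HB.instance Definition _ :=
  GRing.isZmodule.Build L add_opA add_opC add_op0 add_opN.

Let scale_opA a b (f : L) : scale_op a (scale_op b f) = scale_op (a * b) f.
Proof. by apply: op_eq => t /=; rewrite scalerA. Qed.
Let scale_op1 : left_id 1 scale_op.
Proof. by move=> f; apply: op_eq => t /=; rewrite scale1r. Qed.
Let scale_opDr : right_distributive scale_op +%R.
Proof. by move=> a f g; apply: op_eq => t /=; rewrite scalerDr. Qed.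
Let scale_opDl (f : L) : {morph scale_op^~ f : a b / a + b}.
Proof. by move=> a b; apply: op_eq => t /=; rewrite scalerDl. Qed.

HB.instance Definition _ :=
  GRing.Zmodule_isLmodule.Build K L scale_opA scale_op1 scale_opDr scale_opDl.

Lemma opnorm_has_sup (f : L) : has_sup [set rnorm (f t) | t in opball C].
Proof.
split; first by have [t Bt] := opball_neq0 C; exists (rnorm (f t)), t.
have [M fM] := opmem_bounded (op_memP f).
by exists M => _ [t Bt <-]; exact: fM.
Qed.

Lemma opnorm_ub (f : L) t : opball C t -> rnorm (f t) <= opnorm f.
Proof. by move=> Bt; apply: (sup_upper_bound (opnorm_has_sup f)); exists t. Qed.

Lemma opnorm_le (f : L) (M : R) :
  (forall t, opball C t -> rnorm (f t) <= M) -> opnorm f <= M.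
Proof.
move=> fM; apply: ge_sup; first by have [] := opnorm_has_sup f.
by move=> _ [t Bt <-]; exact: fM.
Qed.

Lemma opnorm_ge0 (f : L) : 0 <= opnorm f.
Proof.
by have [t Bt] := opball_neq0 C; apply: le_trans (opnorm_ub f Bt); exact: rnorm_ge0.
Qed.

Let normL (f : L) : K := ofreal k (opnorm f).

Let normLD (f g : L) : normL (f + g) <= normL f + normL g.
Proof.
rewrite /normL -ofrealD ofreal_le; apply: opnorm_le => t Bt /=.
by rewrite (le_trans (rnormD _ _))// lerD// opnorm_ub.
Qed.

Let opnormZ_le (a : K) (f : L) : opnorm (a *: f) <= rnorm a * opnorm f.
Proof.
apply: opnorm_le => t Bt /=.
by rewrite rnormZ ler_wpM2l ?rnorm_ge0// opnorm_ub.
Qed.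

Let normLZ (a : K) (f : L) : normL (a *: f) = `|a| * normL f.
Proof.
rewrite /normL -rnormE -ofrealM; congr ofreal; apply/eqP.
rewrite eq_le opnormZ_le /=; have [->|a0] := eqVneq a 0.
  by rewrite rnorm0 mul0r opnorm_ge0.
have ra0 : 0 < rnorm a.
  rewrite lt_neqAle rnorm_ge0 andbT eq_sym.
  by apply: contra a0 => /eqP/rnorm_eq0 ->.
rewrite -ler_pdivlMl//.
have {1}-> : f = a^-1 *: (a *: f) by rewrite scalerA mulVf// scale1r.
rewrite (le_trans (opnormZ_le _ _))// ler_wpM2r ?opnorm_ge0//.
rewrite -(ofreal_le k) rnormE normfV -rnormE.
rewrite (_ : ofreal k _^-1 = (ofreal k (rnorm a))^-1)//.
apply: (mulfI (x := ofreal k (rnorm a))).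
  by rewrite -(ofreal0 R k) (can_eq (@ofrealK R k)) gt_eqF.
by rewrite -ofrealM mulfV ?gt_eqF// mulfV ?ofreal1// -(ofreal0 R k) (can_eq (@ofrealK R k)) gt_eqF.
Qed.

Let normL_eq0 (f : L) : normL f = 0 -> f = 0.
Proof.
rewrite -(ofreal0 R k) => /(can_inj (@ofrealK R k)) f0.
apply: op_eq => t; apply: (opmem_sep (op_memP f)) => s Bs.
apply: rnorm_eq0; apply/eqP; rewrite eq_le rnorm_ge0 andbT -f0.
exact: opnorm_ub.
Qed.

HB.instance Definition _ :=
  Lmodule_isNormed.Build K L normLD normLZ normL_eq0.

Lemma rnorm_opE (f : L) : rnorm f = opnorm f.
Proof. exact: ofrealK. Qed.

End OpSpace.
Definition unit_ball (R : realType) (k : scalar_kind)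
  (V : normedModType (scalar_field R k)) : set V := [set x | rnorm x <= 1].
Arguments unit_ball {R k} V _.

Section LinearClass.
Variables (R : realType) (k : scalar_kind).
Local Notation K := (scalar_field R k).
Variables (X Y : normedModType K).

Definition continuous_linear : set (X -> Y) :=
  [set f | linear f /\ continuous f].

Let pack_linear (f : X -> Y) (lf : linear f) : {linear X -> Y} :=
  HB.pack f (GRing.isLinear.Build _ _ _ _ _ lf).

Lemma linear_rnorm_continuous (f : X -> Y) (M : R) : linear f ->
  (forall x, rnorm (f x) <= M * rnorm x) -> continuous f.
Proof.
move=> lf fM.
have := @bounded_linear_continuous K X Y (pack_linear lf); apply.
apply/bounded_funP => r; exists (ofreal k `|M| * `|r|) => x xr.
rewrite -rnormE -[X in _ <= _ * X]rnormE -ofrealM ofreal_le.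
apply: le_trans (fM x) _; apply: le_trans (ler_wpM2r (rnorm_ge0 _) (ler_norm M)) _.
apply: ler_wpM2l => //; rewrite -(ofreal_le k) !rnormE.
by rewrite (ger0_norm (le_trans (normr_ge0 x) xr)).
Qed.

Lemma continuous_linear_rnorm (f : X -> Y) : linear f -> continuous f ->
  exists M : R, forall x, unit_ball X x -> rnorm (f x) <= M.
Proof.
move=> lf cf.
have /bounded_funP/(_ 1)[M fM] := continuous_linear_bounded 0 (f := pack_linear lf) (cf 0).
exists (rpart M) => x x1; rewrite -(ofreal_le k) rnormE rpartK.
  by apply: fM; rewrite -rnormE -(ofreal1 R k) ofreal_le.
have := fM 0; rewrite normr0 ler01 => /(_ isT); exact: le_trans.
Qed.

Lemma linear_ball_sep (f : X -> Y) : linear f ->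
  (forall x, unit_ball X x -> f x = 0) -> forall x, f x = 0.
Proof.
move=> lf f0 x; pose g := pack_linear lf.
have c0 : 0 < 1 + rnorm x by rewrite ltr_wpDr ?rnorm_ge0.
have cK : ofreal k (1 + rnorm x) != 0.
  by rewrite -(ofreal0 R k) (can_eq (@ofrealK R k)) gt_eqF.
rewrite -[x]scale1r -(mulfV cK) -scalerA.
rewrite -[f _]/(g _) linearZ /= f0 ?scaler0//=.
have -> : (ofreal k (1 + rnorm x))^-1 = ofreal k (1 + rnorm x)^-1.
  apply: (mulfI cK); rewrite mulfV// -ofrealM mulfV ?ofreal1//.
  by rewrite gt_eqF.
rewrite /unit_ball/= rnormZ rnorm_ofreal; last by rewrite invr_ge0 ltW.
by rewrite ler_pdivrMl// mulr1 lerDr.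
Qed.

Let cl0 : continuous_linear (fun=> 0).
Proof. by split; [move=> a x y; rewrite scaler0 addr0|move=> x; exact: cvg_cst]. Qed.

Let clD f g : continuous_linear f -> continuous_linear g ->
  continuous_linear (fun t => f t + g t).
Proof.
move=> [lf cf] [lg cg]; split; last by move=> x; apply: cvgD; [exact: cf|exact: cg].
by move=> a x y; rewrite lf lg scalerDr addrACA.
Qed.

Let clZ (a : K) f : continuous_linear f -> continuous_linear (fun t => a *: f t).
Proof.
move=> [lf cf]; split; last by move=> x; apply: cvgZr; exact: cf.
by move=> b x y; rewrite lf scalerDr !scalerA mulrC.
Qed.

Let ball_neq0 : unit_ball X !=set0.
Proof. by exists 0; rewrite /unit_ball/= rnorm0 ler01. Qed.

Definition linear_class : opclass X Y :=
  OpClass ball_neq0 cl0 clD clZ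
    (fun f fP => continuous_linear_rnorm fP.1 fP.2)
    (fun f fP => linear_ball_sep fP.1).

End LinearClass.

Notation lin_op X Y := (opspace (linear_class X Y)).
Notation dual X := (lin_op X (scalar_field _ _)).
Section MultilinearClass.
Variables (R : realType) (k : scalar_kind) (n : nat).
Local Notation K := (scalar_field R k).
Variables (E : 'I_n -> normedModType K) (F : normedModType K).

Definition multilinear (A : (forall i, E i) -> F) :=
  forall (i : 'I_n) (x : forall i, E i), linear (fun t : E i => A (dfwith x i t)).

(* Continuity is for the product topology on the product of the E i. *)
Definition continuous_multilinear : set ((forall i, E i) -> F) :=
  [set A | multilinear A /\ continuous (A : prod_topology E -> F)].

Definition prod_ball : set (forall i, E i) :=
  [set x | forall i, unit_ball (E i) (x i)].

Lemma multilinear_scale (A : (forall i, E i) -> F) (c : K) x :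
  multilinear A -> A (fun i => c *: x i) = c ^+ n *: A x.
Proof.
move=> mA.
pose y m : forall i, E i := fun i => if (i < m)%N then c *: x i else x i.
suff H m : (m <= n)%N -> A (y m) = c ^+ m *: A x.
  rewrite -H//; congr A; apply: functional_extensionality_dep => i.
  by rewrite /y ltn_ord.
elim: m => [_|m IH mn].
  by rewrite expr0 scale1r; congr A; apply: functional_extensionality_dep.
pose i := Ordinal mn.
have -> : y m.+1 = dfwith (y m) i (c *: x i).
  apply: functional_extensionality_dep => j; case: dfwithP => [|{}j ij].
    by rewrite /y /= leqnn.
  rewrite /y ltnS leq_eqVlt; suff /negbTE -> : val j != m by [].
  by apply: contra ij => /eqP jm; apply/eqP/val_inj; rewrite /= jm.
have := mA i (y m) c (x i) 0; rewrite addr0 => ->.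
have -> : A (dfwith (y m) i (0 : E i)) = 0.
  have := mA i (y m) 1 0 0; rewrite scaler0 addr0 scale1r.
  by move/(congr1 (fun w => w - A (dfwith (y m) i 0))); rewrite subrr addrK.
rewrite addr0 exprS -scalerA -(IH (ltnW mn)); congr (_ *: A _).
apply: functional_extensionality_dep => j; case: dfwithP => [|//].
by rewrite /y /= ltnn.
Qed.

Lemma ofreal_neq0 (r : R) : 0 < r -> ofreal k r != 0.
Proof. by move=> r0; rewrite -(ofreal0 R k) (can_eq (@ofrealK R k)) gt_eqF. Qed.

Lemma ofrealV (r : R) : 0 < r -> (ofreal k r)^-1 = ofreal k r^-1.
Proof.
move=> r0; apply: (mulfI (ofreal_neq0 r0)).
by rewrite mulfV ?ofreal_neq0// -ofrealM mulfV ?gt_eqF// ofreal1.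
Qed.

Lemma multilinear_ball_sep (A : (forall i, E i) -> F) : multilinear A ->
  (forall x, prod_ball x -> A x = 0) -> forall x, A x = 0.
Proof.
move=> mA A0 x; pose r := 1 + \sum_(i < n) rnorm (x i).
have r0 : 0 < r by rewrite ltr_wpDr// sumr_ge0// => i _; exact: rnorm_ge0.
have := multilinear_scale (ofreal k r)^-1 x mA.
rewrite A0 => [/esym/eqP|i].
  by rewrite scaler_eq0 expf_eq0 invr_eq0 (negbTE (ofreal_neq0 r0)) andbF /= => /eqP.
rewrite /unit_ball/= rnormZ ofrealV// rnorm_ofreal; last by rewrite invr_ge0 ltW.
rewrite ler_pdivrMl// mulr1 /r (bigD1 i)//= addrCA lerDl addr_ge0//.
by rewrite sumr_ge0// => j _; exact: rnorm_ge0.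
Qed.

Lemma continuous_multilinear_bounded (A : (forall i, E i) -> F) :
  continuous_multilinear A ->
  exists M : R, forall x, prod_ball x -> rnorm (A x) <= M.
Proof.
move=> [mA cA].
pose B (d : R) : set (prod_topology E) := [set x | forall i, rnorm (x i) <= d].
pose G := filter_from [set d : R | 0 < d] B.
have FG : Filter G.
  apply: filter_from_filter; first by exists 1 => /=.
  move=> d e d0 e0; exists (Num.min d e); first by rewrite /= lt_min d0 e0.
  by move=> x xde; split=> i; have := xde i; rewrite le_min => /andP[].
pose z : prod_topology E := fun i => 0.
have Gz : G --> z.
  apply/cvg_sup => i U /= [V [[W oW WV] Vz] VU].
  move: Vz; rewrite -WV /= => Wz.
  have : nbhs (0 : E i) W by apply: open_nbhs_nbhs; split.
  move=> /nbhs_normP[e /ofreal_gt0P[r r0 ->]] eW.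
  exists (r / 2) => /=; first by rewrite divr_gt0.
  move=> x xr; apply: VU; rewrite -WV; apply: eW => /=.
  rewrite sub0r normrN -rnormE ofreal_lt (le_lt_trans (xr i))//.
  by rewrite ltr_pdivrMr// ltr_pMr// ltr1n.
have [d d0 dA] := Gz _ (cA z _ (rnorm_nbhs (A z) ltr01)).
exists ((rnorm (A z) + 1) / d ^+ n) => x xB.
rewrite ler_pdivlMr ?exprn_gt0// mulrC.
have -> : d ^+ n * rnorm (A x) = rnorm (A (fun i => ofreal k d *: x i)).
  rewrite multilinear_scale// rnormZ; congr (_ * _).
  have -> : ofreal k d ^+ n = ofreal k (d ^+ n).
    elim: {+}n => [|m IH]; first by rewrite !expr0 ofreal1.
    by rewrite !exprS ofrealM IH.
  by rewrite rnorm_ofreal// exprn_ge0// ltW.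
set y := (fun i => _); have /dA /ltW yz : B d y.
  move=> i; rewrite /y rnormZ rnorm_ofreal ?(ltW d0)//.
  by rewrite -[leRHS]mulr1 ler_wpM2l// ?(ltW d0)//; exact: xB.
rewrite -[A y](subKr (A z)) (le_trans (rnormD _ _))// lerD2l.
by rewrite rnormN.
Qed.

Let prod_ball_neq0 : prod_ball !=set0.
Proof. by exists (fun=> 0) => i; rewrite /unit_ball/= rnorm0. Qed.

Lemma continuous_multilinear0 : continuous_multilinear (fun=> 0).
Proof.
split; last by move=> x; apply: (@cst_continuous (prod_topology E) F 0).
by move=> i x a s t; rewrite scaler0 addr0.
Qed.

Lemma continuous_multilinearD A B :
  continuous_multilinear A -> continuous_multilinear B ->
  continuous_multilinear (fun x => A x + B x).
Proof.
move=> [mA cA] [mB cB]; split.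
  by move=> i x a s t; rewrite mA mB scalerDr addrACA.
by move=> x; exact: (cvgD (cA x) (cB x)).
Qed.

Lemma continuous_multilinearZ (a : K) A :
  continuous_multilinear A -> continuous_multilinear (fun x => a *: A x).
Proof.
move=> [mA cA]; split; last by move=> x; exact: (cvgZr (cA x)).
by move=> i x b s t; rewrite mA scalerDr !scalerA mulrC.
Qed.

Definition multilinear_class : opclass (forall i, E i) F :=
  OpClass prod_ball_neq0 continuous_multilinear0 continuous_multilinearD
    continuous_multilinearZ continuous_multilinear_bounded
    (fun A AP => multilinear_ball_sep AP.1).

Definition compact_multilinear : set ((forall i, E i) -> F) :=
  [set A | continuous_multilinear A /\ precompact (A @` prod_ball)].

Let hausdorffF : hausdorff_space F.
Proof. exact: norm_hausdorff. Qed.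

Let compact0M : compact_multilinear (fun=> 0).
Proof.
split; first exact: continuous_multilinear0.
apply: (@precompact_subset _ _ [set 0]); first by move=> _ [x _ <-].
by apply: compact_precompact => //; exact: compact_set1.
Qed.

Let compactDM A B : compact_multilinear A -> compact_multilinear B ->
  compact_multilinear (fun x => A x + B x).
Proof.
move=> [cA [C CA [cC _]]] [cB [D DB [cD _]]].
split; first exact: continuous_multilinearD.
apply: (@precompact_subset _ _ ((fun p => p.1 + p.2) @` (C `*` D))).
  move=> _ [x xB <-]; exists (A x, B x) => //.
  by split; [apply: CA; exists x|apply: DB; exists x].
apply: compact_precompact => //; apply: continuous_compact.
  by apply: continuous_subspaceT => p; exact: add_continuous.
exact: compact_setX.
Qed.

Let compactZM (a : K) A : compact_multilinear A ->
  compact_multilinear (fun x => a *: A x).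
Proof.
move=> [cA [C CA [cC _]]]; split; first exact: continuous_multilinearZ.
apply: (@precompact_subset _ _ ( *:%R a @` C)).
  by move=> _ [x xB <-]; exists (A x) => //; apply: CA; exists x.
apply: compact_precompact => //; apply: continuous_compact => //.
by apply: continuous_subspaceT => p; exact: scaler_continuous.
Qed.

Definition compact_multilinear_class : opclass (forall i, E i) F :=
  OpClass prod_ball_neq0 compact0M compactDM compactZM
    (fun A AP => continuous_multilinear_bounded AP.1)
    (fun A AP => multilinear_ball_sep AP.1.1).

End MultilinearClass.

Notation mult_op E F := (opspace (multilinear_class E F)).
Notation mult_form E := (mult_op E (scalar_field _ _)).
Notation compact_op E F := (opspace (compact_multilinear_class E F)).
Section ScalarMeasure.
Local Open Scope ereal_scope.
Variables (R : realType) (k : scalar_kind).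
Local Notation K := (scalar_field R k).
Variables (d : measure_display) (T : measurableType d).
Variable mu : {charge set T -> \bar K}.

(* A K-valued measure is a countably additive, finite-valued charge with values
   in the extension of K (a signed measure over R, a complex measure over C). *)
Definition total_variation (A : set T) : \bar R :=
  ereal_sup [set v | exists (m : nat) (B : 'I_m -> set T),
    [/\ (forall i, measurable (B i)), trivIset setT B, \bigcup_i B i = A &
        v = (\sum_(i < m) rnorm (fine (mu (B i))))%R%:E]].

Section part.
Variable p : K -> R.
Hypotheses (p0 : (p 0 = 0)%R) (pD : forall z w, (p (z + w) = p z + p w)%R)
  (p_le : forall z, (`|p z| <= rpart `|z|)%R).

Lemma charge_part_semi_sigma_additive :
  semi_sigma_additive (fun A => (p (fine (mu A)))%:E).
Proof.
move=> F mF tF mUF.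
have cmu := @charge_semi_sigma_additive _ _ _ mu F mF tF mUF.
have muF A : measurable A -> mu A = (fine (mu A))%:E.
  by move=> mA; rewrite fineK// fin_num_measure.
rewrite (muF _ mUF) in cmu.
have sumE n : \sum_(0 <= i < n) mu (F i) = (\sum_(0 <= i < n) fine (mu (F i)))%R%:E.
  by rewrite -sumEFin; apply: eq_bigr => i _; rewrite -muF.
have psumE n : \sum_(0 <= i < n) (p (fine (mu (F i))))%:E =
    (p (\sum_(0 <= i < n) fine (mu (F i)))%R)%:E.
  rewrite sumEFin; congr EFin; elim: n => [|n IH]; first by rewrite !big_geq.
  by rewrite !big_nat_recr//= pD IH.
move=> U /= [e /= e0 eU]; set z := fine _ in cmu eU.
have H : nbhs (z%:E : \bar K) [set y | (`|fine y - z| < ofreal k e)%R].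
  rewrite /nbhs /= /ereal_nbhs /=.
  have := @rnorm_nbhs R k K z e e0.
  by apply: filterS => y /=; rewrite -(ofreal_lt k) rnormE distrC.
have [N _ NP] := cmu _ H; exists N => // m /NP /=.
rewrite sumE /= psumE; set S := (\sum_(_ <= _ < _) _)%R => Sz.
apply: eU => /=.
have <- : (p (z - S) = p z - p S)%R.
  by apply/eqP; rewrite eq_sym subr_eq -pD subrK.
rewrite (le_lt_trans (p_le _))// -(ofreal_lt k).
by rewrite -/(rnorm (z - S)%R) rnormE distrC.
Qed.
End part.

Definition re_charge (A : set T) : \bar R := (rpart (fine (mu A)))%:E.
Definition im_charge (A : set T) : \bar R := (ipart (fine (mu A)))%:E.

Let re_charge0 : re_charge set0 = 0.
Proof. by rewrite /re_charge charge0 /= rpart0. Qed.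

Let re_charge_fin A : d.-measurable A -> re_charge A \is a fin_num.
Proof. by []. Qed.

HB.instance Definition _ := @isCharge.Build d T R re_charge
  re_charge0 re_charge_fin
  (charge_part_semi_sigma_additive (@rpart0 R k) (@rpartD R k) (@rpart_norm_le R k)).

Let im_charge0 : im_charge set0 = 0.
Proof. by rewrite /im_charge charge0 /= ipart0. Qed.

Let im_charge_fin A : d.-measurable A -> im_charge A \is a fin_num.
Proof. by []. Qed.

HB.instance Definition _ := @isCharge.Build d T R im_charge
  im_charge0 im_charge_fin
  (charge_part_semi_sigma_additive (@ipart0 R k) (@ipartD R k) (@ipart_norm_le R k)).

End ScalarMeasure.

Section ScalarIntegral.
Variables (R : realType) (d : measure_display) (T : measurableType d).

(* Does not depend on the chosen Hahn decomposition (Hahn_decomposition_uniq). *)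
Definition charge_Rintegral (nu : {charge set T -> \bar R}) (f : T -> R) : R :=
  let P := projT1 (cid (Hahn_decomposition nu)) in
  let N := projT1 (cid (projT2 (cid (Hahn_decomposition nu)))) in
  let nuPN : hahn_decomposition nu P N :=
    projT2 (cid (projT2 (cid (Hahn_decomposition nu)))) in
  Rintegral (jordan_pos nuPN) setT f - Rintegral (jordan_neg nuPN) setT f.

(* With f = f1 + i f2 and mu = mu1 + i mu2, the real part is
   int f1 dmu1 - int f2 dmu2 and the imaginary part int f2 dmu1 + int f1 dmu2. *)
Definition scalar_integral (k : scalar_kind)
    (mu : {charge set T -> \bar (scalar_field R k)}) (f : T -> scalar_field R k) :
    scalar_field R k :=
  mkscalar k
    (charge_Rintegral (re_charge mu) (fun t => rpart (f t)) -
     charge_Rintegral (im_charge mu) (fun t => ipart (f t)))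
    (charge_Rintegral (re_charge mu) (fun t => ipart (f t)) +
     charge_Rintegral (im_charge mu) (fun t => rpart (f t))).

End ScalarIntegral.

Definition borel (T : ptopologicalType) := g_sigma_algebraType (@open T).

(* Regularity of mu means regularity of its variation measure. *)
Definition regular (R : realType) (k : scalar_kind) (T : ptopologicalType)
    (mu : {charge set (borel T) -> \bar (scalar_field R k)}) :=
  forall A : set (borel T), measurable A -> forall e : R, 0 < e ->
    exists C U : set T, [/\ compact C, open U, C `<=` A, A `<=` U &
      (total_variation mu (U `\` C) < e%:E)%E].
Section Integral.
Variables (R : realType) (k : scalar_kind).
Local Notation K := (scalar_field R k).

(* The dual of X with the topology of pointwise convergence on X. *)
Definition weak_star (X : normedModType K) : topologicalType :=
  initial_topology (fun f : dual X => (f : {ptws X -> K})).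

Definition weak_star_ball (X : normedModType K) : Type :=
  set_type [set f : weak_star X | opnorm (f : dual X) <= 1].

HB.instance Definition _ (X : normedModType K) :=
  Topological.on (weak_star_ball X).

Definition weak_star_val (X : normedModType K) (f : weak_star_ball X) : dual X :=
  \val f.

Let weak_star_ball0 (X : normedModType K) :
  (0 : dual X) \in [set f : weak_star X | opnorm (f : dual X) <= 1].
Proof. by rewrite inE /= -rnorm_opE rnorm0. Qed.

HB.instance Definition _ (X : normedModType K) :=
  isPointed.Build (weak_star_ball X)
    (exist _ (0 : dual X) (weak_star_ball0 X) : weak_star_ball X).

Section IntegralOperator.
Variables X Y : normedModType K.

(* The Borel sets used below are generated by the open sets of the product of
   the two weak* topologies, not by products of Borel sets. *)
Definition ball_product : Type :=
  (weak_star_ball X * weak_star_ball (dual Y))%type.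

HB.instance Definition _ := Topological.on ball_product.
HB.instance Definition _ := Pointed.on ball_product.

Definition represents (mu : {charge set (borel ball_product) -> \bar K})
    (u : lin_op X Y) :=
  forall (x : X) (y' : dual Y), y' (u x) =
    scalar_integral mu (fun p : borel ball_product =>
      weak_star_val p.1 x * weak_star_val p.2 y').

Definition representing_measures (u : lin_op X Y) :
    set (charge (borel ball_product) K) :=
  [set mu | regular mu /\ represents mu u].

Definition integral_op : set (lin_op X Y) :=
  [set u | representing_measures u !=set0].

Definition integral_norm (u : lin_op X Y) : \bar R :=
  ereal_inf [set total_variation mu setT | mu in representing_measures u].

End IntegralOperator.

Definition finite_rank (V W : normedModType K) (T : V -> W) :=
  exists (m : nat) (b : 'I_m -> W),
    forall x, exists c : 'I_m -> K, T x = \sum_(i < m) c i *: b i.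

Definition approximation_property (X : normedModType K) :=
  forall C : set X, compact C -> forall e : R, 0 < e ->
    exists T : lin_op X X, finite_rank T /\
      forall x, C x -> rnorm (T x - x) <= e.

End Integral.
Section HyperBorel.
Variables (R : realType) (k : scalar_kind) (n : nat).
Local Notation K := (scalar_field R k).
Variables (E : 'I_n -> normedModType K) (F : normedModType K).

Lemma mkscalar_continuous :
  continuous (fun p : R * R => mkscalar k p.1 p.2 : K).
Proof.
move=> p; apply: rnorm_cvg => e e0.
have e2 : 0 < e / 2 by rewrite divr_gt0.
exists (ball p.1 (e / 2), ball p.2 (e / 2)).
  by split; exact: nbhsx_ballx.
move=> [a b] [/= pa pb]; rewrite /= mkscalarB -(ofreal_lt k) rnormE.
rewrite (le_lt_trans (mkscalar_norm_le _ _ _))// ofreal_lt.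
by rewrite (splitr e) ltrD.
Qed.

Lemma scalar_bounded_compact (M : R) :
  exists2 C : set K, compact C & forall z, rnorm z <= M -> C z.
Proof.
exists ((fun p : R * R => mkscalar k p.1 p.2 : K) @`
    (`[- M, M]%classic `*` `[- M, M]%classic)).
  apply: continuous_compact; last by apply: compact_setX; exact: segment_compact.
  by apply: continuous_subspaceT => p; exact: mkscalar_continuous.
move=> z zM; exists (rpart z, ipart z); last exact: mkscalarE.
split; rewrite /= in_itv/= -ler_norml; apply: le_trans zM.
  exact: rpart_norm_le.
exact: ipart_norm_le.
Qed.

Lemma tensor_compact (A : mult_form E) (y : F) :
  compact_multilinear (fun x => (A x : K) *: y).
Proof.
have [mA cA] := op_memP A; split; first split.
- by move=> i x a s t; rewrite mA scalerDl scalerA.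
- move=> x; apply: (continuous_comp (f := (A : prod_topology E -> K)) (g := fun c : K => c *: y)).
    exact: cA.
  exact: scalel_continuous.
have [C cC AC] := scalar_bounded_compact (opnorm A).
apply: (@precompact_subset _ _ ((fun c : K => c *: y) @` C)).
  by move=> _ [x xB <-]; exists (A x) => //; apply: AC; exact: opnorm_ub.
apply: compact_precompact; first exact: norm_hausdorff.
apply: continuous_compact => //.
by apply: continuous_subspaceT => c; exact: scalel_continuous.
Qed.

Definition tensor (A : mult_form E) (y : F) : compact_op E F :=
  Op (tensor_compact A y : opmem (compact_multilinear_class E F) _).

Lemma tensor_norm (A : mult_form E) (y : F) :
  opnorm (tensor A y) <= opnorm A * rnorm y.
Proof.
apply: opnorm_le => x xB /=.
by rewrite rnormZ ler_wpM2r ?rnorm_ge0//; exact: opnorm_ub.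
Qed.

Lemma lin_op_rnorm_le (X Y : normedModType K) (f : lin_op X Y) x :
  rnorm (f x) <= opnorm f * rnorm x.
Proof.
have [lf _] := op_memP f.
pose g : {linear X -> Y} := HB.pack (f : X -> Y) (GRing.isLinear.Build _ _ _ _ _ lf).
have [->|x0] := eqVneq x 0.
  by rewrite -[f 0]/(g 0) linear0 !rnorm0 mulr0.
have r0 : 0 < rnorm x.
  by rewrite lt_neqAle rnorm_ge0 andbT eq_sym; apply: contra x0 => /eqP/rnorm_eq0 ->.
rewrite -ler_pdivrMr// mulrC -[(rnorm x)^-1](@rnorm_ofreal R k) ?invr_ge0 ?rnorm_ge0//.
rewrite -rnormZ -[f x]/(g x) -linearZ/=; apply: opnorm_ub.
rewrite /= /unit_ball /= rnormZ rnorm_ofreal ?invr_ge0 ?rnorm_ge0//.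
by rewrite mulVf// gt_eqF.
Qed.

Variable phi : dual (compact_op E F).

Lemma hyper_borel_form_cl (A : mult_form E) :
  continuous_linear (fun y : F => phi (tensor A y) : K).
Proof.
have [lp _] := op_memP phi.
have lt : linear (fun y : F => phi (tensor A y) : K).
  move=> a y z; rewrite -lp; congr (phi _); apply: op_eq => x /=.
  by rewrite scalerDr !scalerA mulrC.
split => //; apply: (@linear_rnorm_continuous R k F K _ (opnorm phi * opnorm A) lt).
move=> y; rewrite (le_trans (lin_op_rnorm_le _ _))// -mulrA ler_wpM2l ?opnorm_ge0//.
by rewrite rnorm_opE tensor_norm.
Qed.

Definition hyper_borel_form (A : mult_form E) : dual F :=
  Op (hyper_borel_form_cl A : opmem (linear_class F K) _).

Lemma hyper_borel_cl : continuous_linear hyper_borel_form.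
Proof.
have [lp _] := op_memP phi.
have lt : linear hyper_borel_form.
  move=> a A B; apply: op_eq => y /=; rewrite -lp; congr (phi _).
  by apply: op_eq => x /=; rewrite scalerDl scalerA.
split => //; apply: (linear_rnorm_continuous (M := opnorm phi) lt).
move=> A; rewrite !rnorm_opE; apply: opnorm_le => y y1 /=.
rewrite (le_trans (lin_op_rnorm_le _ _))// ler_wpM2l ?opnorm_ge0//.
rewrite rnorm_opE (le_trans (tensor_norm _ _))//.
by rewrite -[leRHS]mulr1 ler_wpM2l ?opnorm_ge0.
Qed.

Definition hyper_borel : lin_op (mult_form E) (dual F) :=
  Op (hyper_borel_cl : opmem (linear_class (mult_form E) (dual F)) _).

End HyperBorel.

Arguments integral_op {R k} X Y.
Arguments hyper_borel {R k n} E F phi.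

(* Main.v *)
(* Proof idea. Write G for the space of n-linear forms and P for the product of the unit balls.
   The space of compact operators sits isometrically in l_oo(P; F), so Hahn-Banach extends
   phi to a functional Psi on l_oo(P; F), that is, to a finitely additive F*-valued measure m on
   P of variation at most |phi|, and B(phi)(A) = int A dm. Discretizing P shows that, on
   finitely many forms, B(phi) is uniformly close to A |-> sum_i A(x_i) m_i with
   sum_i |m_i| <= |phi|; hence the functional sum A_i (x) y_i'' |-> sum y_i''(B(phi)(A_i)) is
   dominated by |phi| times the sup over B_{G*} x B_{F***}. Taking real parts (the balls are
   balanced) and extending under the sublinear functional |phi| sup gives a positive functional,
   and Riesz representation gives a positive measure of mass at most |phi|. Conversely, a measure
   representing u bounds sum u(A_i)(y_i) by its variation times |sum A_i (x) y_i|, and Hahn-Banach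
   gives phi with B(phi) = u and |phi| at most the variation. The approximation property is
   needed for injectivity only: if G has it, the tensors are dense; if F* has it, phi(f) is
   the trace of a nuclear operator on F* which vanishes. *)

(* The extended functional [Psi] acts on all bounded functions, measurable or not, so it can be
   evaluated on any finite partition of the product of balls; its vector measure appears only
   through the functionals [vmeasure] on the cells of such a partition. Partitions arise in two
   ways: from the values of finitely many forms, when a representing measure is sought, and from a
   finite net of the relatively compact range of f, which is how compactness of f enters. That
   vector measure is in general only finitely additive, so phi(f) is not directly the trace of a
   nuclear operator: f is replaced by step functions converging to it geometrically, and each
   difference contributes a finite tensor of [dual F] and [F]. Injectivity also carries the
   isometry: a measure representing B(phi) yields some psi with B(psi) = B(phi) and a good bound on
   its norm, and the bound passes to phi only because psi = phi. Real and complex scalars are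
   handled together by extending real-linearly and restoring K-linearity at the end. *)
Require Import Defs.
From HB Require Import structures.
From mathcomp Require Import all_boot all_order all_algebra.
From mathcomp Require Import finmap complex ring lra.
From mathcomp Require Import all_classical all_reals all_analysis measurable_realfun.

Set Implicit Arguments.
Unset Strict Implicit.
Unset Printing Implicit Defensive.

Import Order.TTheory GRing.Theory Num.Theory.
Import numFieldNormedType.Exports.

Local Open Scope classical_set_scope.
Local Open Scope ring_scope.

(** * Hahn-Banach theorems *)

Section Scalars.
Variables (R : realType) (k : scalar_kind).
Local Notation K := (scalar_field R k).

Lemma rpartZ (r : R) (z : K) : rpart (ofreal k r * z) = r * rpart z.
Proof. by case: k z => //= -[a b] /=; rewrite mul0r subr0. Qed.

Lemma rpart_sum (I : Type) (s : seq I) (f : I -> K) :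
  rpart (\sum_(i <- s) f i) = \sum_(i <- s) rpart (f i).
Proof.
elim: s => [|i s IH]; first by rewrite !big_nil rpart0.
by rewrite !big_cons rpartD IH.
Qed.

Lemma rpart_le_rnorm (z : K) : rpart z <= rnorm z.
Proof. by apply: le_trans (rpart_norm_le z); exact: ler_norm. Qed.

Lemma rnormM (x y : K) : rnorm (x * y) = rnorm x * rnorm y.
Proof. by apply: (can_inj (@ofrealK R k)); rewrite ofrealM !rnormE normrM. Qed.

Lemma unimodular (z : K) : exists2 a : K, rnorm a = 1 & a * z = `|z|.
Proof.
have rn1 : rnorm (1 : K) = 1 by rewrite /rnorm normr1 -(ofreal1 R k) ofrealK.
have [->|z0] := eqVneq z 0; first by exists 1 => //; rewrite mulr0 normr0.
exists (`|z| / z); last by rewrite mulfVK.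
by rewrite /rnorm normf_div normr_id divff ?normr_eq0// -(ofreal1 R k) ofrealK.
Qed.

End Scalars.

Section Sublinear.
Variables (R : realType) (k : scalar_kind).
Local Notation K := (scalar_field R k).
Variable V : lmodType K.
Implicit Types (p q g : V -> R) (u v w : V) (r t : R).

(** Homogeneity is asked as an inequality and for r > 0 only; scaling back by 1/r gives equality
    ([sublinearZ]). *)
Definition sublinear p :=
  (forall u v, p (u + v) <= p u + p v) /\
  (forall r v, 0 < r -> p (ofreal k r *: v) <= r * p v).

(** Scaling is by real numbers even when K is complex, so one extension argument serves both fields;
    [complexify] restores K-linearity. *)
Definition real_linear g :=
  (forall u v, g (u + v) = g u + g v) /\
  (forall r v, g (ofreal k r *: v) = r * g v).

Lemma sublinearZ p r v : sublinear p -> 0 < r -> p (ofreal k r *: v) = r * p v.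
Proof.
move=> [_ pZ] r0; apply/eqP; rewrite eq_le pZ//=.
rewrite -ler_pdivlMl//; apply: le_trans (pZ _ _ _); last by rewrite invr_gt0.
by rewrite scalerA -ofrealM mulVf ?gt_eqF// ofreal1 scale1r.
Qed.

Lemma sublinear0 p : sublinear p -> p 0 = 0.
Proof.
move=> ps; have := @sublinearZ p 2 0 ps (ltr0Sn _ _).
by rewrite scaler0; lra.
Qed.

Lemma sublinear_opp_le p v : sublinear p -> - p (- v) <= p v.
Proof.
by move=> ps; have := ps.1 v (- v); rewrite subrr sublinear0//; lra.
Qed.

(** Supplies the bounds of chains for Zorn's lemma. Totality of the chain makes the infimum
    subadditive: of two functionals nearly optimal at u and at v, the smaller one serves at both.
    The infimum is finite because q(v) >= -q(-v) >= -p(-v). *)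
Lemma sublinear_inf (I : set (V -> R)) p : I !=set0 ->
  (forall q, I q -> sublinear q) ->
  (forall q q', I q -> I q' -> (forall v, q v <= q' v) \/ (forall v, q' v <= q v)) ->
  (forall q, I q -> forall v, q v <= p v) -> sublinear p ->
  exists2 q, sublinear q & (forall q', I q' -> forall v, q v <= q' v) /\ (forall v, q v <= p v).
Proof.
move=> [q0 Iq0] Is It Ip ps.
pose S v := [set q v | q in I].
have lbS v : lbound (S v) (- p (- v)).
  move=> _ [q Iq <-]; apply: le_trans (sublinear_opp_le v (Is _ Iq)).
  by rewrite lerN2; exact: Ip.
have iS v : has_inf (S v) by split; [exists (q0 v), q0|exists (- p (- v)); exact: lbS].
have leS q v : I q -> inf (S v) <= q v.
  by move=> Iq; apply: ge_inf; [exact: (iS v).2|exists q].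
exists (fun v => inf (S v)); last split.
- split.
  + move=> u v; apply/ler_addgt0Pr => e e0.
    have e2 : 0 < e / 2 by rewrite divr_gt0.
    have [_ [q Iq <-] qu] := inf_adherent e2 (iS u).
    have [_ [q' Iq' <-] qv] := inf_adherent e2 (iS v).
    rewrite [e]splitr addrACA.
    have [le|le] := It _ _ Iq Iq'.
    * apply: le_trans (leS _ _ Iq) _; apply: le_trans ((Is _ Iq).1 _ _) _.
      by apply: lerD; apply: ltW => //; apply: le_lt_trans qv.
    * apply: le_trans (leS _ _ Iq') _; apply: le_trans ((Is _ Iq').1 _ _) _.
      by apply: lerD; apply: ltW => //; apply: le_lt_trans qu.
  + move=> r v r0; rewrite -ler_pdivrMl//; apply: lb_le_inf; first exact: (iS v).1.
    move=> _ [q Iq <-]; rewrite ler_pdivrMl//.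
    by rewrite -(sublinearZ v (Is _ Iq) r0); exact: leS.
- by move=> q' Iq' v; exact: leS.
- by move=> v; apply: le_trans (leS _ v Iq0) _; exact: Ip.
Qed.

Lemma minimal_sublinear p : sublinear p ->
  exists2 q, sublinear q & (forall v, q v <= p v) /\
    (forall q', sublinear q' -> (forall v, q' v <= q v) -> q' = q).
Proof.
move=> ps.
pose T := {q | sublinear q /\ forall v, q v <= p v}.
(* The order is reversed, so a maximal element is a pointwise minimal functional. *)
pose le (s t : T) := `[< forall v, sval t v <= sval s v >].
have [||||[q [qs qp]] qmin] := @Zorn T le.
- by move=> t; apply/asboolP.
- move=> r s t /asboolP rs /asboolP st; apply/asboolP => v.
  exact: le_trans (st v) (rs v).
- move=> [s sP] [t tP] /asboolP st /asboolP ts; apply: eq_exist => /=.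
  by apply/funext => v; apply/eqP; rewrite eq_le ts st.
- move=> A At.
  have [[a Aa]|A0] := pselect (A !=set0); last first.
    (* The empty chain is bounded by p itself. *)
    by exists (exist _ p (conj ps (fun v => lexx _))) => s As; exfalso; apply: A0; exists s.
  have [||||| q qs [qA qp]] := @sublinear_inf [set sval t | t in A] p.
  + by exists (sval a), a.
  + by move=> _ [t _ <-]; exact: (svalP t).1.
  + move=> _ _ [s As <-] [t At' <-].
    by have [/asboolP|/asboolP] := At _ _ As At'; [right|left].
  + by move=> _ [t _ <-]; exact: (svalP t).2.
  + exact: ps.
  + exists (exist _ q (conj qs qp)) => s As; apply/asboolP => v /=.
    by apply: qA; exists s.
exists q => //; split => // q' qs' q'q.
have q'p v : q' v <= p v by exact: le_trans (q'q v) (qp v).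
have := qmin (exist _ q' (conj qs' q'p)).
by move=> /(_ _)/(congr1 sval); apply; apply/asboolP => v; exact: q'q.
Qed.

(* Minimality is tested against q_w(v) = inf over t >= 0 of q(v + t w) - t q(w),
   which gives q(v) + q(w) <= q(v + w). *)
Lemma minimal_sublinear_superadditive q : sublinear q ->
  (forall q', sublinear q' -> (forall v, q' v <= q v) -> q' = q) ->
  forall v w, q v + q w <= q (v + w).
Proof.
move=> qs qmin v w.
pose S v := [set q (v + ofreal k t *: w) - t * q w | t in [set t : R | 0 <= t]].
have qZ t x : 0 <= t -> q (ofreal k t *: x) = t * q x.
  rewrite le_eqVlt => /orP[/eqP<-|t0]; last exact: sublinearZ.
  by rewrite ofreal0 scale0r mul0r sublinear0.
have lbS u : lbound (S u) (- q (- u)).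
  move=> _ [t /= t0 <-]; rewrite lerBrDl lerBlDr -qZ//.
  by apply: le_trans (qs.1 _ _); rewrite addrC addrA addNr add0r.
have iS u : has_inf (S u).
  split; last by exists (- q (- u)); exact: lbS.
  by exists (q (u + ofreal k 0 *: w) - 0 * q w); exists 0 => //=.
have leS t u : 0 <= t -> inf (S u) <= q (u + ofreal k t *: w) - t * q w.
  by move=> t0; apply: ge_inf; [exact: (iS u).2|exists t].
have Sq : (fun v => inf (S v)) = q.
  apply: qmin; first split.
  - move=> x y; apply/ler_addgt0Pr => e e0.
    have e2 : 0 < e / 2 by rewrite divr_gt0.
    have [_ [s /= s0 <-] sx] := inf_adherent e2 (iS x).
    have [_ [t /= t0 <-] ty] := inf_adherent e2 (iS y).
    rewrite [e]splitr addrACA; apply: le_trans (lerD (ltW sx) (ltW ty)).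
    apply: le_trans (leS _ _ (addr_ge0 s0 t0)) _.
    rewrite mulrDl opprD addrACA lerD2r ofrealD scalerDl addrACA.
    exact: qs.1.
  - move=> r x r0; rewrite -ler_pdivrMl//; apply: lb_le_inf; first exact: (iS x).1.
    move=> _ [t /= t0 <-]; rewrite ler_pdivrMl//.
    apply: le_trans (leS (r * t) _ _) _; first by rewrite mulr_ge0// ltW.
    by rewrite mulrBr -(sublinearZ (x + _) qs r0) scalerDr scalerA -ofrealM mulrA.
  - move=> x; apply: le_trans (leS _ x (lexx _)) _.
    by rewrite ofreal0 scale0r addr0 mul0r subr0.
rewrite -lerBrDr -{1}Sq; apply: le_trans (leS _ v ler01) _.
by rewrite ofreal1 scale1r mul1r.
Qed.

(** Instead of extending along one vector at a time, the proof takes a minimal sublinear functional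
    below p: being sub- and superadditive it is additive, and q(-v) = -q(v) carries homogeneity over
    to negative scalars. *)
Lemma hahn_banach_sublinear p : sublinear p ->
  exists2 g, real_linear g & forall v, g v <= p v.
Proof.
move=> /minimal_sublinear[q qs [qp qmin]]; exists q => //.
have qD u v : q (u + v) = q u + q v.
  by apply/eqP; rewrite eq_le qs.1 minimal_sublinear_superadditive.
have qN v : q (- v) = - q v.
  by apply/eqP; rewrite -addr_eq0 -qD addNr sublinear0.
split => // r v; have [r0|r0|->] := ltgtP r 0.
- rewrite -[r]opprK -[in LHS](mulrN1 (- r)) ofrealM -scalerA sublinearZ ?oppr_gt0//.
  have -> : ofreal k (-1 : R) = -1 :> K.
    by apply/eqP; rewrite -subr_eq0 opprK -(ofreal1 R k) -ofrealD addNr ofreal0.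
  by rewrite scaleN1r qN; ring.
- exact: sublinearZ.
- by rewrite ofreal0 scale0r mul0r sublinear0.
Qed.

(* The sandwich functional q(v) = inf over (w, a) in D of p(v + w) - a lies below p
   and makes every linear minorant dominate a at w. *)
Lemma hahn_banach_cone p (D : V -> R -> Prop) : sublinear p ->
  D 0 0 ->
  (forall u a v b, D u a -> D v b -> D (u + v) (a + b)) ->
  (forall r v a, 0 < r -> D v a -> D (ofreal k r *: v) (r * a)) ->
  (forall v a, D v a -> a <= p v) ->
  exists2 g, real_linear g & (forall v, g v <= p v) /\ (forall v a, D v a -> a <= g v).
Proof.
move=> ps D0 DD DZ Dp.
pose S v := [set p (v + z.1) - z.2 | z in [set z : V * R | D z.1 z.2]].
have lbS v : lbound (S v) (- p (- v)).
  move=> _ [[w a] /= Dwa <-]; rewrite lerBrDl lerBlDr.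
  apply: le_trans (Dp _ _ Dwa) _; apply: le_trans (ps.1 _ _).
  by rewrite addrC addrA addNr add0r.
have iS u : has_inf (S u).
  split; last by exists (- p (- u)); exact: lbS.
  by exists (p (u + 0) - 0); exists (0, 0).
have leS w a u : D w a -> inf (S u) <= p (u + w) - a.
  by move=> Dwa; apply: ge_inf; [exact: (iS u).2|exists (w, a)].
have [|g gl gS] := @hahn_banach_sublinear (fun v => inf (S v)).
  split.
  - move=> x y; apply/ler_addgt0Pr => e e0.
    have e2 : 0 < e / 2 by rewrite divr_gt0.
    have [_ [[u a] /= Dua <-] sx] := inf_adherent e2 (iS x).
    have [_ [[v b] /= Dvb <-] ty] := inf_adherent e2 (iS y).
    rewrite [e]splitr addrACA; apply: le_trans (lerD (ltW sx) (ltW ty)).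
    apply: le_trans (leS _ _ _ (DD _ _ _ _ Dua Dvb)) _.
    by rewrite opprD addrACA [leRHS]addrACA lerD2r; exact: ps.1.
  - move=> r x r0; rewrite -ler_pdivrMl//; apply: lb_le_inf; first exact: (iS x).1.
    move=> _ [[w a] /= Dwa <-]; rewrite ler_pdivrMl//.
    apply: le_trans (leS _ _ _ (DZ r _ _ r0 Dwa)) _.
    by rewrite mulrBr -(sublinearZ (x + _) ps r0) scalerDr.
have gN v : g (- v) = - g v.
  apply/eqP; rewrite -addr_eq0 -gl.1 addNr.
  by rewrite -(scale0r (0 : V)) -(ofreal0 R k) gl.2 mul0r.
exists g => //; split=> [v|w a Dwa].
  by apply: le_trans (gS v) _; apply: le_trans (leS _ _ v D0) _; rewrite addr0 subr0.
rewrite -lerN2 -gN; apply: le_trans (gS _) _.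
by apply: le_trans (leS _ _ _ Dwa) _; rewrite addNr sublinear0// sub0r.
Qed.

End Sublinear.

Section HahnBanach.
Variables (R : realType) (k : scalar_kind).
Local Notation K := (scalar_field R k).
Variable V : lmodType K.

Lemma complexify (h : V -> R) : real_linear h ->
  exists2 g : V -> K, (forall c u v, g (c *: u + v) = c * g u + g v) &
    forall v, rpart (g v) = h v.
Proof.
case: k V h => /= W h [hD hZ].
  by exists h => // c u v; rewrite hD -[c in LHS]/(ofreal RealScalars c) hZ.
pose I : R[i]%C := (0 +i* 1)%C.
exists (fun v => (h v +i* - h (I *: v))%C) => // -[a b] u v.
have cE : (a +i* b)%C = ofreal ComplexScalars a + ofreal ComplexScalars b * I :> R[i]%C.
  by apply/eqP; rewrite eq_complex /=; apply/andP; split; apply/eqP; ring.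
have IcE : I * (a +i* b)%C = ofreal ComplexScalars a * I - ofreal ComplexScalars b :> R[i]%C.
  by apply/eqP; rewrite eq_complex /=; apply/andP; split; apply/eqP; ring.
have hN w : h (- w) = - h w.
  by apply/eqP; rewrite -addr_eq0 -hD addNr -(scale0r (0 : W)) -(ofreal0 R ComplexScalars) hZ mul0r.
apply/eqP; rewrite eq_complex /=; apply/andP; split; apply/eqP.
  by rewrite hD {1}cE scalerDl -scalerA hD !hZ; ring.
by rewrite scalerDr scalerA IcE scalerBl -scalerA !hD hN !hZ; ring.
Qed.

(** The functional to extend is given by its graph [D], so it need not be shown well defined
    beforehand: two values at one vector differ by some a with [D 0 a], and then rnorm a <= p 0 = 0.
    The real parts are extended, and rotation by a unimodular scalar turns the bound on real parts
    into one on moduli. *)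
Lemma hahn_banach_seminorm (p : V -> R) (D : V -> K -> Prop) :
  (forall u v, p (u + v) <= p u + p v) ->
  (forall a v, p (a *: v) = rnorm a * p v) ->
  D 0 0 ->
  (forall c u a v b, D u a -> D v b -> D (c *: u + v) (c * a + b)) ->
  (forall v a, D v a -> rnorm a <= p v) ->
  exists2 g : V -> K, (forall c u v, g (c *: u + v) = c * g u + g v) &
    (forall v, rnorm (g v) <= p v) /\ (forall v a, D v a -> g v = a).
Proof.
move=> pD pZ D0 DD Dp.
have DZ c v a : D v a -> D (c *: v) (c * a).
  by move=> Dva; have := DD c _ _ _ _ Dva D0; rewrite !addr0.
pose D' v r := exists2 a, D v a & r = rpart a.
have [|||||h hl [hp hD]] := @hahn_banach_cone R k V p D'.
- by split=> // r v r0; rewrite pZ rnorm_ofreal// ltW.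
- by exists 0; rewrite ?rpart0.
- move=> u _ v _ [a Dua ->] [b Dvb ->]; exists (a + b); last by rewrite rpartD.
  by have := DD 1 _ _ _ _ Dua Dvb; rewrite scale1r mul1r.
- by move=> r v _ r0 [a Dva ->]; exists (ofreal k r * a); [exact: DZ|rewrite rpartZ].
- by move=> v _ [a Dva ->]; apply: le_trans (rpart_le_rnorm a) _; exact: Dp.
have [g gl gh] := complexify hl.
have gZ c v : g (c *: v) = c * g v.
  have g0 : g 0 = 0.
    have := gl 1 0 0; rewrite scale1r addr0 mul1r => /(congr1 (fun z => z - g 0)).
    by rewrite subrr addrK.
  by have := gl c v 0; rewrite !addr0 g0 addr0.
exists g => //; split=> [v|v a Dva].
  have [c c1 cg] := unimodular (g v).
  by rewrite /rnorm -cg -gZ gh; apply: le_trans (hp _) _; rewrite pZ c1 mul1r.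
(* Equality of real parts on the graph is enough: rotating g v - a to its modulus replaces (v, a) by
   (c v, c a), which is again in [D]. *)
have [c _ cg] := unimodular (g v - a).
have eqh w b : D w b -> h w = rpart b.
  move=> Dwb; apply/eqP; rewrite eq_le hD ?andbT; last by exists b.
  have Dn : D' (- w) (- rpart b).
    exists (-1 * b); first by rewrite -scaleN1r; exact: DZ.
    by rewrite mulN1r; apply/eqP; rewrite eq_sym -addr_eq0 -rpartD addNr rpart0.
  have := hD _ _ Dn; have -> : h (- w) = - h w; last by rewrite lerN2.
  by apply/eqP; rewrite -addr_eq0 -hl.1 addNr -(scale0r (0 : V)) -(ofreal0 R k) hl.2 mul0r.
apply/eqP; rewrite -subr_eq0; apply/eqP; apply: rnorm_eq0.
rewrite /rnorm -cg mulrBr -gZ.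
have rpartB (x y : K) : rpart (x - y) = rpart x - rpart y.
  by apply/eqP; rewrite eq_sym subr_eq -rpartD subrK.
by rewrite rpartB gh (eqh _ (c * a)) ?subrr//; exact: DZ.
Qed.

End HahnBanach.

(** * Riesz representation on compact Hausdorff spaces *)

Section Content.
Local Open Scope classical_set_scope.
Variables (R : realType) (X : ptopologicalType).
Hypotheses (hX : hausdorff_space X) (cX : compact [set: X]).
Variable L : set X -> R.
Hypotheses (L_le : forall A B, A `<=` B -> L A <= L B)
  (L_disj : forall A B, A `&` B = set0 -> L (A `|` B) = L A + L B).

Let L0 : L set0 = 0.
Proof. by have := L_disj (setI0 set0); rewrite setU0; lra. Qed.

(** A finitely additive [L] need not be countably additive. Regularizing it from inside by closed
    sets, then from outside by open sets, repairs this, since compactness reduces countable covers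
    to finite ones. *)
Definition open_content (U : set X) : R :=
  sup [set L C | C in [set C | closed C /\ C `<=` U]].

Definition outer_content (A : set X) : R :=
  inf [set open_content U | U in [set U | open U /\ A `<=` U]].

Local Notation nu := open_content.
Local Notation out := outer_content.

Let nu_has_sup U : has_sup [set L C | C in [set C | closed C /\ C `<=` U]].
Proof.
split; first by exists (L set0), set0 => //; split => //; exact: closed0.
by exists (L U) => _ [C [_ CU] <-]; exact: L_le.
Qed.

Let L_le_nu C U : closed C -> C `<=` U -> L C <= nu U.
Proof. by move=> cC CU; apply: (sup_upper_bound (nu_has_sup U)); exists C. Qed.

Let nu_le U M : (forall C, closed C -> C `<=` U -> L C <= M) -> nu U <= M.
Proof.
move=> H; apply: ge_sup; first exact: (nu_has_sup U).1.
by move=> _ [C [cC CU] <-]; exact: H.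
Qed.

Let nu_le_L U : nu U <= L U.
Proof. by apply: nu_le => C _; exact: L_le. Qed.

Let nu_ge0 U : 0 <= nu U.
Proof. by rewrite -L0; apply: L_le_nu => //; exact: closed0. Qed.

Let nu_mono U V : U `<=` V -> nu U <= nu V.
Proof. by move=> UV; apply: nu_le => C cC CU; apply: L_le_nu => //; exact: subset_trans UV. Qed.

Let out_has_inf A : has_inf [set nu U | U in [set U | open U /\ A `<=` U]].
Proof.
split; first by exists (nu setT), setT => //; split => //; exact: openT.
by exists 0 => _ [U _ <-].
Qed.

Let out_le A U : open U -> A `<=` U -> out A <= nu U.
Proof. by move=> oU AU; apply: ge_inf; [exact: (out_has_inf A).2|exists U]. Qed.

Let le_out A M : (forall U, open U -> A `<=` U -> M <= nu U) -> M <= out A.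
Proof.
move=> H; apply: lb_le_inf; first exact: (out_has_inf A).1.
by move=> _ [U [oU AU] <-]; exact: H.
Qed.

Let out_open U : open U -> out U = nu U.
Proof.
move=> oU; apply/eqP; rewrite eq_le out_le//=.
by apply: le_out => V _; exact: nu_mono.
Qed.

Let out_mono A B : A `<=` B -> out A <= out B.
Proof.
by move=> AB; apply: le_out => U oU BU; apply: out_le => //; exact: subset_trans BU.
Qed.

Let out_ge0 A : 0 <= out A.
Proof. by apply: le_out. Qed.

Let out_adherent A e : 0 < e -> exists U, [/\ open U, A `<=` U & nu U < out A + e].
Proof.
move=> e0; have [_ [U [oU AU] <-] lt] := inf_adherent e0 (out_has_inf A).
by exists U.
Qed.

Let normalX := (@normal_openP R X).1 (compact_normal hX cX).

Let LU (A B : set X) : L (A `|` B) <= L A + L B.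
Proof.
have -> : A `|` B = A `|` (B `\` A).
  apply/seteqP; split=> x [|]; [by left| |by left|by case; right].
  by case: (pselect (A x)) => [|nAx Bx]; [left|right].
rewrite L_disj ?lerD2l; first by apply: L_le => x [].
by rewrite -subset0 => x [Ax [_]].
Qed.

(** Normality splits a closed C inside the union: disjoint open W1, W2 around C \ U and C \ V leave
    closed pieces C \ W1 in U and C \ W2 in V that cover C. *)
Let nuU U V : open U -> open V -> nu (U `|` V) <= nu U + nu V.
Proof.
move=> oU oV; apply: nu_le => C cC CUV.
have [| | |W1 [W2 [oW1 oW2 CW1 CW2 W12]]] := normalX (A := C `\` U) (B := C `\` V).
- by apply: closedI => //; exact: open_closedC.
- by apply: closedI => //; exact: open_closedC.
- by rewrite -subset0 => x [[Cx Ux] [_ Vx]]; have [] := CUV x Cx.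
apply: (@le_trans _ _ (L (C `\` W1 `|` C `\` W2))).
  apply: L_le => x Cx; case: (pselect (W1 x)) => W1x; [right|left] => //.
  by split=> // W2x; have : (W1 `&` W2) x by []; rewrite W12.
apply: le_trans (LU _ _) _; apply: lerD; apply: L_le_nu.
- by apply: closedI => //; exact: open_closedC.
- by move=> x [Cx W1x]; apply: contrapT => Ux; apply: W1x; exact: CW1.
- by apply: closedI => //; exact: open_closedC.
- by move=> x [Cx W1x]; apply: contrapT => Ux; apply: W1x; exact: CW2.
Qed.

Let nu_bigU (U : (set X)^nat) N : (forall n, open (U n)) ->
  nu (\big[setU/set0]_(i < N) U i) <= \sum_(i < N) nu (U i).
Proof.
move=> oU; elim: N => [|N IH].
  by rewrite !big_ord0 -L0; apply: nu_le_L.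
rewrite !big_ord_recr /=; apply: le_trans (nuU _ (oU N)) _; last by rewrite lerD2r.
by rewrite -bigcup_mkord; apply: bigcup_open => i _; exact: oU.
Qed.

(** A closed C inside the union is compact, hence already covered by the first N sets; this is where
    countable subadditivity comes from the finite one. *)
Let nu_bigcup (U : (set X)^nat) : (forall n, open (U n)) ->
  ((nu (\bigcup_n U n))%:E <= \sum_(n <oo) (nu (U n))%:E)%E.
Proof.
move=> oU; have [Sfin|] := boolP ((\sum_(n <oo) (nu (U n))%:E)%E \is a fin_num); last first.
  have S0 : (0 <= \sum_(n <oo) (nu (U n))%:E)%E.
    by apply: nneseries_ge0 => n _ _; rewrite lee_fin.
  by rewrite (ge0_fin_numE S0) -leNgt leye_eq => /eqP ->; rewrite leey.
rewrite -(fineK Sfin) lee_fin; apply: nu_le => C cC CU.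
have : compact C by exact: subclosed_compact cX _.
rewrite compact_cover => /(_ nat setT U (fun i _ => oU i))[//|D' _ CD'].
have [N D'N] : exists N, forall i : nat, i \in D' -> (i < N)%N.
  exists (\max_(i <- D') i).+1 => i iD'; rewrite ltnS.
  by apply: (@leq_bigmax_seq _ _ xpredT id).
apply: (@le_trans _ _ (\sum_(i < N) nu (U i))).
  apply: le_trans (nu_bigU N oU); apply: L_le_nu => // x /CD'[i /= iD' Uix].
  by rewrite -bigcup_mkord; exists i => //=; exact: D'N.
rewrite -lee_fin (fineK Sfin) -sumEFin -(big_mkord xpredT (fun i => (nu (U i))%:E)).
by apply: nneseries_lim_ge => n _; rewrite lee_fin.
Qed.

Let outE A : \bar R := (out A)%:E.

Let out_sigma : sigma_subadditive outE.
Proof.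
move=> A; apply/lee_addgt0Pr => e e0.
have pow_gt0 n : 0 < e / (2 ^ n.+1)%:R by rewrite divr_gt0// ltr0n expn_gt0.
have /choice[U UP] n := out_adherent (A n) (pow_gt0 n).
have oU n : open (U n) by have [] := UP n.
apply: (@le_trans _ _ (nu (\bigcup_n U n))%:E).
  rewrite lee_fin; apply: out_le; first exact: bigcup_open.
  by move=> x [n _ Ax]; exists n => //; have [_ AU _] := UP n; exact: AU.
apply: le_trans (nu_bigcup oU) _.
have le2 := @epsilon_trick R (fun n => outE (A n)) e xpredT.
apply: le_trans (le2 _ _); last 2 first.
- by move=> n; rewrite lee_fin.
- exact: ltW.
apply: lee_nneseries => n _; first by rewrite lee_fin.
by rewrite -EFinD lee_fin ltW//; have [] := UP n.
Qed.

Let out0 : outE set0 = 0%E.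
Proof.
congr EFin; apply/eqP; rewrite eq_le out_ge0 andbT.
by rewrite out_open ?(le_trans (nu_le_L _)) ?L0//; exact: open0.
Qed.

Let outE_ge0 A : (0 <= outE A)%E.
Proof. by rewrite lee_fin. Qed.

Let outE_mono : {homo outE : A B / A `<=` B >-> (A <= B)%E}.
Proof. by move=> A B AB; rewrite lee_fin out_mono. Qed.

Let outM : {outer_measure set X -> \bar R} :=
  HB.pack outE (isOuterMeasure.Build R X outE out0 outE_ge0 outE_mono out_sigma).

Let nu_adherent U e : 0 < e -> exists C, [/\ closed C, C `<=` U & nu U < L C + e].
Proof.
move=> e0; have [_ [C [cC CU] <-]] := sup_adherent e0 (nu_has_sup U).
by rewrite ltrBlDr => ?; exists C.
Qed.

Let cara_open U : open U -> caratheodory_measurable outM U.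
Proof.
move=> oU; apply: le_caratheodory_measurable => A /=.
rewrite -EFinD lee_fin; apply: le_out => V oV AV.
apply/ler_addgt0Pr => e e0.
have e2 : 0 < e / 2 by rewrite divr_gt0.
(* D is then chosen inside V \ C, an open set containing A \ U. So C and D are disjoint closed
   subsets of V, and additivity of [L] applies to them. *)
have [C [cC CVU ltC]] := nu_adherent (V `&` U) e2.
have [D [cD DVC ltD]] := nu_adherent (V `\` C) e2.
have oVC : open (V `\` C) by apply: openI => //; exact: closed_openC.
have le1 : out (A `&` U) <= nu (V `&` U).
  by apply: out_le; [exact: openI|exact: setSI].
have le2 : out (A `&` ~` U) <= nu (V `\` C).
  apply: out_le => // x [Ax Ux]; split; first exact: AV.
  by move=> /CVU[].
have : L C + L D <= nu V.
  rewrite -L_disj; last by rewrite -subset0 => x [Cx /DVC[]].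
  apply: L_le_nu; first exact: closedU.
  by move=> x [/CVU[]|/DVC[]].
lra.
Qed.

Let cara_borel (A : set (borel X)) : measurable A -> caratheodory_measurable outM A.
Proof.
have : sigma_algebra setT (caratheodory_measurable outM).
  split; first exact: caratheodory_measurable_set0.
    by move=> B mB; rewrite setTD; exact: caratheodory_measurable_setC.
  by move=> F mF; exact: caratheodory_measurable_bigcup.
move=> sc mA; apply: (smallest_sub sc _ mA) => U; exact: cara_open.
Qed.

Let mub (A : set (borel X)) : \bar R := outM A.

Let mub0 : mub set0 = 0%E. Proof. exact: out0. Qed.

Let mub_ge0 A : (0 <= mub A)%E. Proof. exact: outE_ge0. Qed.

Let mub_sigma : semi_sigma_additive mub.
Proof.
move=> F mF tF mUF.
apply: (@caratheodory_measure_sigma_additive R X outM F) => //.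
- by move=> i; exact: cara_borel.
- exact: cara_borel.
Qed.

Let muM : {measure set (borel X) -> \bar R} :=
  HB.pack mub (isMeasure.Build _ _ _ mub mub0 mub_ge0 mub_sigma).

(** On open sets only an inequality with [L] holds, because closed subsets may fail to exhaust
    [L U]. With equality on the whole space it suffices for the Riesz theorem, which passes to
    complements M - h. *)
Lemma regular_content_measure : exists mu : {measure set (borel X) -> \bar R},
  [/\ mu setT = (L setT)%:E,
     (forall U : set X, open U -> (mu U <= (L U)%:E)%E) &
     forall A : set (borel X), measurable A -> forall e : R, 0 < e ->
       exists C U : set X, [/\ compact C, open U, C `<=` A, A `<=` U &
         (mu (U `\` C) < e%:E)%E]].
Proof.
have finM A : muM A \is a fin_num by [].
exists muM; split.
- rewrite -[LHS]/((out setT)%:E); congr EFin; rewrite out_open; last exact: openT.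
  by apply/eqP; rewrite eq_le nu_le_L L_le_nu//; exact: closedT.
- by move=> U oU; rewrite -[X in (X <= _)%E]/((out U)%:E) lee_fin out_open.
- move=> A mA e e0.
  have e2 : 0 < e / 2 by rewrite divr_gt0.
  have [U [oU AU ltU]] := out_adherent A e2.
  (* Inner regularity of A is outer regularity of its complement: the complement of V is compact and
     inside A, and what U has beyond it splits into U \ A and the part of V lying in A. *)
  have [V [oV AV ltV]] := out_adherent (~` A) e2.
  have mO (W : set X) : open W -> measurable (W : set (borel X)).
    exact: sub_sigma_algebra.
  have CA : ~` V `<=` A by move=> x nVx; apply: contrapT => /AV.
  exists (~` V), U; split => //.
    by apply: (subclosed_compact _ cX) => //; exact: open_closedC.
  have mUA : muM (U `\` A) = (out U - out A)%:E.
    rewrite measureD; [|exact: mO|exact: mA|by rewrite ltey_eq finM].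
    by rewrite setIidr// EFinB.
  have mVA : muM (V `\` ~` A) = (out V - out (~` A))%:E.
    rewrite measureD; [|exact: mO|exact: measurableC|by rewrite ltey_eq finM].
    by rewrite setIidr// EFinB.
  have E : (U `\` ~` V : set (borel X)) = U `\` A `|` (V `\` ~` A).
    apply/seteqP; split=> x /=; rewrite /setD /setC /=.
      move=> [Ux /contrapT Vx]; case: (pselect (A x)) => Ax; [right|left] => //.
      by split.
    move=> [[Ux nAx]|[Vx /contrapT Ax]]; split; [done| |exact: AU|by []].
    by move=> /CA.
  apply: (@le_lt_trans _ _ (muM (U `\` A `|` (V `\` ~` A)))); first by rewrite -E.
  have le2 : (muM (U `\` A `|` (V `\` ~` A)) <= muM (U `\` A) + muM (V `\` ~` A))%E.
    apply: measureU2; apply: measurableD; [exact: mO|exact: mA|exact: mO|].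
    exact: measurableC.
  apply: le_lt_trans le2 _; rewrite mUA mVA -EFinD lte_fin.
  by rewrite (out_open oU) (out_open oV); lra.
Qed.

End Content.

Section BoundedIntegral.
Context d (T : measurableType d) (R : realType).
Variable mu : {measure set T -> \bar R}.
Hypothesis finmu : (mu setT < +oo)%E.

Lemma bounded_integrable (f : T -> R) (M : R) : measurable_fun setT f ->
  (forall x, `|f x| <= M) -> mu.-integrable setT (EFin \o f).
Proof.
move=> mf fM; apply: measurable_bounded_integrable => //.
exists M; split; first exact: num_real.
by move=> r Mr x _; apply: le_trans (fM x) (ltW Mr).
Qed.

Lemma Rintegral_indic (A : set T) : measurable A ->
  \int[mu]_x (\1_A x : R) = fine (mu A).
Proof. by move=> mA; rewrite /Rintegral integral_indic// setIT. Qed.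

Lemma integrable_indicT (A : set T) : measurable A ->
  mu.-integrable setT (EFin \o (\1_A : T -> R)).
Proof.
move=> mA; apply: (@bounded_integrable _ 1); first exact: measurable_indic.
by move=> x; rewrite indicE; case: (_ \in _); rewrite /= ?normr1 ?normr0.
Qed.

End BoundedIntegral.

Section Riesz.
Variables (R : realType) (X : ptopologicalType).
Hypotheses (hX : hausdorff_space X) (cX : compact [set: X]).

Definition fbounded (f : X -> R) := exists M : R, forall x, `|f x| <= M.

Variable Lam : (X -> R) -> R.
Hypotheses
  (LamD : forall f g, fbounded f -> fbounded g ->
     Lam (fun x => f x + g x) = Lam f + Lam g)
  (LamZ : forall r f, fbounded f -> Lam (fun x => r * f x) = r * Lam f)
  (Lam_ge0 : forall f, fbounded f -> (forall x, 0 <= f x) -> 0 <= Lam f).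

Let fboundedD f g : fbounded f -> fbounded g -> fbounded (fun x => f x + g x).
Proof.
move=> [M fM] [N gN]; exists (M + N) => x.
by apply: le_trans (ler_normD _ _) _; apply: lerD.
Qed.

Let fboundedZ r f : fbounded f -> fbounded (fun x => r * f x).
Proof.
by move=> [M fM]; exists (`|r| * M) => x; rewrite normrM ler_wpM2l.
Qed.

Let fbounded_cst c : fbounded (fun=> c).
Proof. by exists `|c|. Qed.

Let fbounded_indic A : fbounded (\1_A).
Proof.
by exists 1 => x; rewrite indicE; case: (_ \in _); rewrite /= ?normr1 ?normr0.
Qed.

Let Lam_le f g : fbounded f -> fbounded g -> (forall x, f x <= g x) -> Lam f <= Lam g.
Proof.
move=> bf bg fg; have bN : fbounded (fun x => -1 * f x) by exact: fboundedZ.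
have := Lam_ge0 (fboundedD bg bN) _; rewrite LamD// LamZ// mulN1r subr_ge0; apply.
by move=> x; rewrite mulN1r subr_ge0.
Qed.

Let Lam_cst c : Lam (fun=> c) = c * Lam (fun=> 1).
Proof. by rewrite -LamZ//; congr Lam; apply/funext => x; rewrite mulr1. Qed.

(** [Lam] is defined on all bounded functions, not only on continuous ones, so it can be evaluated
    at indicators without Urysohn functions. *)
Let L (A : set X) : R := Lam \1_A.

Let L_le A B : A `<=` B -> L A <= L B.
Proof.
move=> AB; apply: Lam_le => // x; rewrite !indicE ler_nat.
by case: (boolP (x \in A)) => // /set_mem/AB xB; rewrite mem_set.
Qed.

Let L_disj A B : A `&` B = set0 -> L (A `|` B) = L A + L B.
Proof.
move=> AB; rewrite /L -LamD//; congr Lam; apply/funext => x.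
rewrite !indicE in_setU; case: (boolP (x \in A)) => xA; case: (boolP (x \in B)) => xB //=.
- have ABx : (A `&` B) x by split; exact: set_mem.
  by rewrite AB in ABx.
- by rewrite addr0.
- by rewrite add0r.
- by rewrite addr0.
Qed.

(** A layer-cake approximation of h from below. Only the sets where h exceeds a level occur, with
    positive coefficients; they are open for continuous h, so the inequality [mu U <= L U] can be
    summed. *)
Let layer (h : X -> R) (e : R) N x : R :=
  \sum_(i < N) e * \1_[set y | i.+1%:R * e < h y] x.

Let layer_le h e N x : 0 < e -> 0 <= h x -> layer h e N x <= h x /\ layer h e N x <= N%:R * e.
Proof.
move=> e0 h0; elim: N => [|N [IH1 IH2]]; first by rewrite /layer big_ord0 mul0r.
rewrite /layer big_ord_recr /= -/(layer h e N x) indicE.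
rewrite [N.+1%:R]mulrSr mulrDl mul1r.
case: (boolP (x \in _)) => [/set_mem /=|_].
  by move=> ltx; rewrite mulr1; split; lra.
by rewrite mulr0; split; lra.
Qed.

Let layer_ge h e N x : 0 < e -> h x <= N.+1%:R * e -> h x <= layer h e N x + e.
Proof.
(* Truncating h at (N+1)e removes the hypothesis [hN], so that the induction on N goes through. *)
move=> e0 hN; suff : Num.min (h x) (N.+1%:R * e) <= layer h e N x + e.
  by rewrite min_l.
elim: N {hN} => [|N IH].
  by rewrite /layer big_ord0 add0r ge_min mul1r lexx orbT.
rewrite /layer big_ord_recr /= -/(layer h e N x) indicE.
case: (boolP (x \in _)) => [/set_mem /=|/negP xN].
  move=> ltx; move: IH; rewrite min_r ?(ltW ltx)// => IH.
  rewrite ge_min; apply/orP; right.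
  by rewrite [N.+2%:R]mulrSr mulrDl mul1r mulr1; lra.
have hle : h x <= N.+1%:R * e.
  by rewrite leNgt; apply/negP => ltx; apply: xN; rewrite inE.
move: IH; rewrite (min_l hle) mulr0 addr0 => IH.
by rewrite ge_min IH.
Qed.

Lemma continuous_fbounded (h : X -> R) : continuous h -> fbounded h.
Proof.
move=> ch; have : compact (h @` setT).
  by apply: continuous_compact => //; exact: continuous_subspaceT.
move=> /compact_bounded[M [_ hM]]; exists (M + 1) => x.
by apply: hM; [rewrite ltrDl|exists x].
Qed.

Lemma continuous_borel_measurable (h : X -> R) :
  continuous h -> measurable_fun [set: borel X] (h : borel X -> R).
Proof.
move=> ch; apply: (measurability _ (RGenOpens.measurableE R)).
move=> _ [_ [a [b ->] <-]]; rewrite setTI; apply: sub_sigma_algebra.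
by move/continuousP : ch; apply; exact: interval_open.
Qed.

Theorem riesz_representation : exists mu : {measure set (borel X) -> \bar R},
  [/\ mu setT = (Lam (fun=> 1))%:E,
     (forall A : set (borel X), measurable A -> forall e : R, 0 < e ->
       exists C U : set X, [/\ compact C, open U, C `<=` A, A `<=` U &
         (mu (U `\` C) < e%:E)%E]) &
     forall h : X -> R, continuous h ->
       \int[mu]_x (h : borel X -> R) x = Lam h].
Proof.
have [mu [muT muU mureg]] := regular_content_measure hX cX L_le L_disj.
have LT : L setT = Lam (fun=> 1) by rewrite /L indicT.
rewrite LT in muT.
have finmu : (mu setT < +oo)%E by rewrite muT ltry.
have icst (c : R) : mu.-integrable setT (EFin \o (fun _ : borel X => c)).
  apply: (@bounded_integrable _ _ _ mu finmu _ `|c|) => //.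
have cint h : continuous h -> mu.-integrable setT (EFin \o (h : borel X -> R)).
  move=> ch; have [M hM] := continuous_fbounded ch.
  by apply: (bounded_integrable finmu _ hM); exact: continuous_borel_measurable.
have mlayer (h : X -> R) e i : continuous h ->
    measurable ([set y | i.+1%:R * e < h y] : set (borel X)).
  move=> ch; apply: sub_sigma_algebra.
  have -> : [set y | i.+1%:R * e < h y] = h @^-1` `]i.+1%:R * e, +oo[%classic.
    by apply/seteqP; split=> y /=; rewrite in_itv /= andbT.
  by move/continuousP : ch; apply; exact: interval_open.
have ilayer (h : X -> R) e N : continuous h ->
    mu.-integrable setT (EFin \o (layer h e N : borel X -> R)) /\
    (0 < e -> fbounded (layer h e N) /\
      \int[mu]_x (layer h e N : borel X -> R) x <= Lam (layer h e N)).
  move=> ch; elim: N => [|N [IH1 IH2]].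
    have -> : layer h e 0 = fun=> 0 by apply/funext => x; rewrite /layer big_ord0.
    split; first exact: icst.
    move=> _; split=> //; rewrite Lam_cst mul0r Rintegral_cst// mul0r//.
  have lE : layer h e N.+1 =
      fun x => layer h e N x + e * \1_[set y | N.+1%:R * e < h y] x.
    by apply/funext => x; rewrite /layer big_ord_recr.
  have ii := integrable_indicT finmu (mlayer h e N ch).
  have iiZ : mu.-integrable setT
      (EFin \o (fun x : borel X => e * \1_[set y | N.+1%:R * e < h y] x)).
    by have := integrableZl measurableT e ii; apply: eq_integrable.
  split.
    by rewrite lE; have := integrableD measurableT IH1 iiZ; apply: eq_integrable.
  move=> e0; have [bl IH] := IH2 e0.
  split; first by rewrite lE; apply: fboundedD => //; exact: fboundedZ.
  rewrite lE LamD//; last exact: fboundedZ.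
  rewrite RintegralD// lerD// RintegralZl// LamZ//.
  apply: ler_wpM2l; first exact: ltW.
  rewrite Rintegral_indic; last exact: mlayer.
  rewrite -lee_fin fineK; last first.
    rewrite ge0_fin_numE//; apply: le_lt_trans finmu.
    by apply: le_measure; rewrite ?inE//; exact: mlayer.
  apply: muU; have -> : [set y | N.+1%:R * e < h y] = h @^-1` `]N.+1%:R * e, +oo[%classic.
    by apply/seteqP; split=> y /=; rewrite in_itv /= andbT.
  by move/continuousP : ch; apply; exact: interval_open.
have int_le (h : X -> R) : continuous h -> (forall x, 0 <= h x) ->
    \int[mu]_x (h : borel X -> R) x <= Lam h.
  move=> ch h0; have [M hM] := continuous_fbounded ch.
  have bh : fbounded h by exists M.
  apply/ler_addgt0Pr => e e0.
  have L1 : 0 <= Lam (fun=> 1) by apply: Lam_ge0.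
  (* The error is e' times [Lam] of 1, hence at most e; adding 1 avoids division by zero. The same
     device recurs in later estimates. *)
  pose e' := e / (Lam (fun=> 1) + 1).
  have e'0 : 0 < e' by rewrite divr_gt0// ltr_wpDl.
  pose N := Num.truncn (M / e').
  have hN x : h x <= N.+1%:R * e'.
    apply: le_trans (ler_norm _) _; apply: le_trans (hM x) _.
    by rewrite -ler_pdivrMr// ltW// truncnS_gt.
  have [il /(_ e'0) [bl lel]] := ilayer h e' N ch.
  have ic : mu.-integrable setT (EFin \o (fun=> e' : R)).
    exact: icst.
  apply: (@le_trans _ _ (\int[mu]_x ((layer h e' N : borel X -> R) x + e'))).
    apply: le_Rintegral => //; first exact: cint.
      by have := integrableD measurableT il ic; apply: eq_integrable.
    by move=> x _; exact: layer_ge.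
  rewrite RintegralD// Rintegral_cst// muT /=.
  apply: lerD.
    apply: le_trans lel _; apply: Lam_le => // x.
    by have [] := layer_le N e'0 (h0 x).
  rewrite /e' -mulrA -[leRHS]mulr1; apply: ler_wpM2l; first exact: ltW.
  by rewrite mulrC ler_pdivrMr ?ltr_wpDl// mul1r lerDl.
(* The reverse inequality is [int_le] for M - h, because [mu] and [Lam] agree on constants. Signed
   functions are then shifted by M. *)
have int_eq (h : X -> R) : continuous h -> (forall x, 0 <= h x) ->
    \int[mu]_x (h : borel X -> R) x = Lam h.
  move=> ch h0; apply/eqP; rewrite eq_le int_le//=.
  have [M hM] := continuous_fbounded ch.
  have bh : fbounded h by exists M.
  have cM : continuous (fun x => M - h x).
    by move=> x; apply: continuousB; [exact: cvg_cst|exact: ch].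
  have := int_le _ cM.
  rewrite RintegralB ?Rintegral_cst ?muT//=; last exact: cint.
  have -> : Lam (fun x => M - h x) = M * Lam (fun=> 1) - Lam h.
    rewrite -[- Lam h]mulN1r -(LamZ (-1) bh) -Lam_cst -LamD//; last exact: fboundedZ.
    by congr Lam; apply/funext => x; rewrite mulN1r.
  rewrite lerD2l lerN2; apply => x.
  by rewrite subr_ge0; apply: le_trans (hM x); exact: ler_norm.
exists mu; split => // h ch.
have [M hM] := continuous_fbounded ch.
have bh : fbounded h by exists M.
have cM : continuous (fun x => h x + M).
  by move=> x; apply: continuousD; [exact: ch|exact: cvg_cst].
have := int_eq _ cM.
rewrite RintegralD//; last exact: cint.
rewrite Rintegral_cst// muT/= LamD// (Lam_cst M) => H.
apply: (addIr (M * Lam (fun=> 1))); apply: H => x.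
by rewrite -lerBlDr sub0r lerNl; apply: le_trans (hM x); rewrite -normrN ler_norm.
Qed.

End Riesz.

(** * Integrals against scalar charges *)

Section ChargeOfMeasure.
Variables (R : realType) (k : scalar_kind).
Local Notation K := (scalar_field R k).
Context d (T : measurableType d).
Variable mu : {measure set T -> \bar R}.
Hypothesis finmu : (mu setT < +oo)%E.

Let fin A : measurable A -> mu A \is a fin_num.
Proof.
move=> mA; rewrite ge0_fin_numE//; apply: le_lt_trans finmu.
by apply: le_measure; rewrite ?inE.
Qed.

Let nu (A : set T) : \bar K := (ofreal k (fine (mu A)) : K)%:E.

Let ofreal_sum n (f : nat -> R) :
  (\sum_(0 <= i < n) (ofreal k (f i) : K)%:E)%E = (ofreal k (\sum_(0 <= i < n) f i) : K)%:E.
Proof.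
rewrite sumEFin; congr EFin; elim: n => [|n IH]; first by rewrite !big_geq// ofreal0.
by rewrite !big_nat_recr//= ofrealD IH.
Qed.

Let nu_fin : fin_num_fun nu.
Proof. by []. Qed.

Let nu_additive : measure_function.semi_additive nu.
Proof.
move=> F n mF tF mUF; rewrite -(big_mkord xpredT (fun i => nu (F i))) ofreal_sum.
rewrite /nu measure_semi_additive// -(big_mkord xpredT (fun i => mu (F i))).
by rewrite sum_fine// => i _; rewrite fin.
Qed.

Let nu_sigma : semi_sigma_additive nu.
Proof.
move=> F mF tF mUF.
have cmu := measure_semi_sigma_additive F mF tF mUF.
have sumE n : (\sum_(0 <= i < n) mu (F i))%E = (\sum_(0 <= i < n) fine (mu (F i)))%:E.
  by rewrite -sumEFin; apply: eq_bigr => i _; rewrite fineK// fin.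
have {}cmu : (fun n => \sum_(0 <= i < n) fine (mu (F i))) @ \oo --> fine (mu (\bigcup_n F n)).
  rewrite -[X in X @ _](_ : fine \o (fun n => (\sum_(0 <= i < n) mu (F i))%E) = _).
    apply: fine_cvg; rewrite fineK ?fin//; exact: cmu.
  by apply/funext => n; rewrite /= sumE.
rewrite (_ : (fun n => _) = fun n => (ofreal k (\sum_(0 <= i < n) fine (mu (F i))) : K)%:E);
  last by apply/funext => n; rewrite ofreal_sum.
move=> U /= [e /= e0 eU].
have [r r0 er] := ofreal_gt0P e0.
have /cvgrPdist_lt/(_ r r0)[N _ NP] := cmu.
exists N => // m /NP /= lt; apply: eU => /=.
have -> : ofreal k (fine (mu (\bigcup_n F n))) - ofreal k (\sum_(0 <= i < m) fine (mu (F i)))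
   = ofreal k (fine (mu (\bigcup_n F n)) - \sum_(0 <= i < m) fine (mu (F i))) :> K.
  by apply/eqP; rewrite subr_eq -ofrealD subrK.
set x := (X in ofreal k X) in lt *.
have -> : `|ofreal k x : K| = ofreal k `|x|; last by rewrite er ofreal_lt.
have [x0|x0] := leP 0 x.
  by rewrite !ger0_norm// -(ofreal0 R k) ofreal_le.
rewrite !ltr0_norm// -?(ofreal0 R k) ?ofreal_lt//.
by apply/eqP; rewrite eq_sym -addr_eq0 -ofrealD addNr ofreal0.
Qed.

Lemma charge_of_measure : exists nu : {charge set T -> \bar K},
  forall A, nu A = (ofreal k (fine (mu A)) : K)%:E.
Proof.
pose nuM : {charge set T -> \bar K} := HB.pack nu (isFinite.Build _ _ _ nu nu_fin)
  (isAdditiveCharge.Build _ _ _ nu nu_additive) (isSemiSigmaAdditive.Build _ _ _ nu nu_sigma).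
by exists nuM.
Qed.

Lemma total_variation_measure (rho : {charge set T -> \bar K}) A : measurable A ->
  (forall A, rho A = (ofreal k (fine (mu A)) : K)%:E) ->
  (Defs.total_variation rho A <= mu A)%E.
Proof.
move=> mA rhoE; apply: ge_ereal_sup => _ [m [B [mB tB BA ->]]].
have -> : A = \big[setU/set0]_(i < m) B i.
  rewrite -BA -(@bigcup_pred _ _ xpredT B).
  by apply: eq_bigcupl; split.
rewrite measure_bigsetU_ord//.
rewrite (eq_bigr (fun i => (fine (mu (B i)))%:E)); last first.
  by move=> i _; rewrite fineK// fin.
rewrite sumEFin lee_fin; apply: ler_sum => i _.
by rewrite rhoE /= rnorm_ofreal// fine_ge0.
Qed.

End ChargeOfMeasure.

Section ChargeIntegral.
Variables (R : realType) (d : measure_display) (T : measurableType d).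
Variable nu : {charge set T -> \bar R}.

(** Hides the chosen Hahn decomposition: from here on the integral is a difference of two integrals
    against finite measures. The third clause holds since the value of [neg] at A is minus that of
    [nu] on the part of A in the negative set; it identifies integrals against positive charges with
    ordinary ones. *)
Lemma charge_RintegralE : exists pos neg : {finite_measure set T -> \bar R},
  [/\ (forall f, charge_Rintegral nu f = \int[pos]_x f x - \int[neg]_x f x),
      (forall A, measurable A -> nu A = (fine (pos A) - fine (neg A))%:E) &
      (forall A, measurable A -> (forall B, measurable B -> B `<=` A -> (0 <= nu B)%E) ->
        neg A = 0%E)].
Proof.
rewrite /charge_Rintegral.
set P := projT1 _; set N := projT1 _; set nuPN := projT2 _.
exists (jordan_pos nuPN), (jordan_neg nuPN); split => // A mA.
  rewrite (jordan_decomp nuPN mA) /cadd /= cscaleN1.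
  by rewrite EFinB !fineK// fin_num_measure.
move=> nu0; rewrite -[LHS]/(jordan_neg nuPN A) jordan_negE cjordan_negE /crestr0 mem_set//= /crestr.
have [_ [mN nuN] _ _] := nuPN.
have mAN : measurable (A `&` N) by exact: measurableI.
apply/eqP; rewrite oppe_eq0 eq_le; apply/andP; split.
  by apply: nuN => // x [].
by apply: nu0 => // x [].
Qed.

Lemma charge_Rintegral_measure (mu : {measure set T -> \bar R}) f :
  (forall A, measurable A -> nu A = mu A) -> charge_Rintegral nu f = \int[mu]_x f x.
Proof.
move=> numu; have [pos [neg [-> nuE negE]]] := charge_RintegralE.
have neg0 A : measurable A -> neg A = 0%E.
  by move=> mA; apply: negE => // B mB _; rewrite numu.
have posE A : measurable A -> pos A = mu A.
  move=> mA; rewrite -numu// nuE// neg0// subr0 fineK// fin_num_measure//.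
rewrite [X in _ - X](_ : _ = 0); last first.
  rewrite /Rintegral (eq_measure_integral mzero); last by move=> A mA _; exact: neg0.
  by rewrite integral_measure_zero.
rewrite subr0; congr fine; apply: eq_measure_integral => A mA _.
exact: posE.
Qed.

Let bmeas (f : T -> R) := measurable_fun setT f /\ exists M : R, forall x, `|f x| <= M.

Let bint (mu : {finite_measure set T -> \bar R}) f : bmeas f -> mu.-integrable setT (EFin \o f).
Proof.
move=> [mf [M fM]]; apply: (bounded_integrable _ mf fM).
by rewrite ltey_eq fin_num_measure.
Qed.

Lemma charge_RintegralD f g : bmeas f -> bmeas g ->
  charge_Rintegral nu (fun x => f x + g x) = charge_Rintegral nu f + charge_Rintegral nu g.
Proof.
have [pos [neg [nE _ _]]] := charge_RintegralE.
by move=> bf bg; rewrite !nE !RintegralD//; do ?exact: bint; ring.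
Qed.

Lemma charge_RintegralZ r f : bmeas f ->
  charge_Rintegral nu (fun x => r * f x) = r * charge_Rintegral nu f.
Proof.
have [pos [neg [nE _ _]]] := charge_RintegralE.
by move=> bf; rewrite !nE !RintegralZl//; do ?exact: bint; ring.
Qed.

Lemma charge_Rintegral_indic A : measurable A ->
  charge_Rintegral nu \1_A = fine (nu A).
Proof.
have [pos [neg [nE nuE _]]] := charge_RintegralE.
by move=> mA; rewrite nE !Rintegral_indic// nuE.
Qed.

Lemma charge_Rintegral_bound : exists2 V : R, 0 <= V &
  forall (f : T -> R) (M : R), measurable_fun setT f ->
  (forall x, `|f x| <= M) -> `|charge_Rintegral nu f| <= V * M.
Proof.
have [pos [neg [nE nuE _]]] := charge_RintegralE.
exists (fine (pos setT) + fine (neg setT)); first by rewrite addr_ge0// fine_ge0.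
move=> f M mf fM; rewrite nE mulrDl.
have H (mu : {finite_measure set T -> \bar R}) : `|\int[mu]_x f x| <= fine (mu setT) * M.
  have bf : bmeas f by split => //; exists M.
  apply: le_trans (le_normr_Rintegral measurableT (bint mu bf)) _.
  rewrite mulrC -Rintegral_cst//; apply: le_Rintegral => //.
  - apply: bint; split; first exact: measurableT_comp.
    by exists M => x; rewrite normr_id.
  - by apply: bint; split => //; exists `|M|.
by apply: le_trans (ler_normB _ _) _; apply: lerD.
Qed.

End ChargeIntegral.

(** * Finite codes: total boundedness of bounded sets of scalars *)

Section FiniteCodes.
Variable R : realType.

(** The code of r records which thresholds i e - M with i < N lie at or below r. Its fibres are
    finite intersections of half-lines, and two points of [-M, M] more than e apart are separated by
    a threshold. *)
Lemma real_code (M e : R) : 0 < e -> exists (N : nat) (c : R -> {ffun 'I_N -> bool}),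
  (forall b, measurable (c @^-1` [set b])) /\
  forall r s, `|r| <= M -> `|s| <= M -> c r = c s -> `|r - s| <= e.
Proof.
move=> e0; pose N := (Num.truncn (2 * M / e)).+1.
exists N, (fun r => [ffun i : 'I_N => i%:R * e - M <= r]); split.
  move=> b.
  rewrite [X in measurable X](_ : _ =
      \bigcap_(i in [set: 'I_N]) [set r : R | (i%:R * e - M <= r) == b i]); last first.
    apply/seteqP; split=> [r /= <- i _|r rb] /=; first by rewrite ffunE.
    by apply/ffunP => i; rewrite ffunE; apply/eqP/rb.
  apply: fin_bigcap_measurable => // i _.
  have -> : [set r : R | (i%:R * e - M <= r) == b i] =
      if b i then `[i%:R * e - M, +oo[%classic else `]-oo, i%:R * e - M[%classic.
    by case: (b i); apply/seteqP; split=> r /=; rewrite in_itv /= ?andbT ?ltNge; case: (_ <= _).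
  by case: (b i); exact: measurable_itv.
move=> r s rM sM crs; wlog rs : r s rM sM crs / r <= s.
  have [rs|/ltW sr] := leP r s; first by apply.
  by move=> H; rewrite distrC; exact: H.
rewrite distrC ger0_norm ?subr_ge0// leNgt; apply/negP => lt.
(* The first threshold strictly above r; it is at most r + e, hence below s. *)
pose i := (Num.truncn ((r + M) / e)).+1.
have r0 : 0 <= (r + M) / e.
  by rewrite divr_ge0 ?(ltW e0)//; move: rM; rewrite ler_norml; lra.
have /andP[ti1 ti2] := truncn_itv r0.
have ler : i%:R * e <= r + M + e.
  rewrite /i mulrSr mulrDl mul1r lerD2r.
  by rewrite -ler_pdivlMr.
have ltr : r + M < i%:R * e by rewrite -ltr_pdivrMr.
have iN : (i < N)%N.
  rewrite /N ltnS truncn_gt_nat -/i ler_pdivlMr//.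
  by move: sM; rewrite ler_norml; lra.
have := congr1 (fun b : {ffun 'I_N -> bool} => b (Ordinal iN)) crs.
rewrite !ffunE /= => ti.
have : i%:R * e - M <= s by lra.
by rewrite -ti; lra.
Qed.

(** Composed with a function h bounded by M, the code cuts the domain into finitely many cells on
    which h varies by at most e, measurable ones if h is measurable. *)
Lemma scalar_code (k : scalar_kind) (M e : R) : 0 < e ->
  exists (I : finType) (c : scalar_field R k -> I),
  (forall z w, rnorm z <= M -> rnorm w <= M -> c z = c w -> rnorm (z - w) <= e) /\
  (forall d (T : measurableType d) (h : T -> scalar_field R k),
    measurable_fun setT (@rpart R k \o h) -> measurable_fun setT (@ipart R k \o h) ->
    forall i, measurable [set x | c (h x) = i]).
Proof.
move=> e0; have e2 : 0 < e / 2 by rewrite divr_gt0.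
have [N [c [mc cP]]] := real_code M e2.
exists ({ffun 'I_N -> bool} * {ffun 'I_N -> bool})%type.
exists (fun z => (c (rpart z), c (ipart z))); split.
  move=> z w zM wM [c1 c2].
  rewrite -[z]mkscalarE -[w]mkscalarE mkscalarB -(ofreal_le k) rnormE.
  apply: le_trans (mkscalar_norm_le _ _ _) _; rewrite ofreal_le [e]splitr.
  apply: lerD; apply: cP => //.
  - exact: le_trans (rpart_norm_le z) zM.
  - exact: le_trans (rpart_norm_le w) wM.
  - exact: le_trans (ipart_norm_le z) zM.
  - exact: le_trans (ipart_norm_le w) wM.
move=> d T h mr mi [b1 b2].
rewrite [X in measurable X](_ : _ =
  (@rpart R k \o h) @^-1` (c @^-1` [set b1]) `&` (@ipart R k \o h) @^-1` (c @^-1` [set b2])).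
  by apply: measurableI; rewrite -[X in measurable X]setTI; [exact: mr|exact: mi].
by apply/seteqP; split=> [x [/= <- <-]|x [/= <- <-]].
Qed.

End FiniteCodes.

Section ScalarIntegralTheory.
Variables (R : realType) (k : scalar_kind).
Local Notation K := (scalar_field R k).
Context d (T : measurableType d).

Definition bounded_measurable (h : T -> K) :=
  [/\ measurable_fun setT (@rpart R k \o h), measurable_fun setT (@ipart R k \o h) &
    exists M : R, forall x, rnorm (h x) <= M].

Lemma scalar_integral_measure (mu : {measure set T -> \bar R})
    (nu : {charge set T -> \bar K}) (h : T -> K) :
  (mu setT < +oo)%E ->
  (forall A, nu A = (ofreal k (fine (mu A)) : K)%:E) ->
  scalar_integral nu h = mkscalar k (\int[mu]_x rpart (h x)) (\int[mu]_x ipart (h x)).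
Proof.
move=> finmu nuE; rewrite /scalar_integral.
have ipart_ofreal (r : R) : ipart (ofreal k r : K) = 0 by case: k.
have im0 f : charge_Rintegral (im_charge nu) f = 0.
  rewrite (@charge_Rintegral_measure _ _ _ _ mzero).
    by rewrite /Rintegral integral_measure_zero.
  by move=> A mA; rewrite /= /im_charge nuE /= ipart_ofreal.
have reE f : charge_Rintegral (re_charge nu) f = \int[mu]_x f x.
  apply: charge_Rintegral_measure => A mA.
  rewrite /= /re_charge nuE /= ofrealK fineK//.
  rewrite ge0_fin_numE//; apply: le_lt_trans finmu.
  by apply: le_measure; rewrite ?inE.
by rewrite !im0 !reE subr0 addr0.
Qed.

Variable nu : {charge set T -> \bar K}.

Let bmR (h : T -> K) : bounded_measurable h ->
  measurable_fun setT (fun t => rpart (h t)) /\ exists M : R, forall x, `|rpart (h x)| <= M.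
Proof.
move=> [mr _ [M hM]]; split; first exact: mr.
by exists M => x; exact: le_trans (rpart_norm_le _) (hM x).
Qed.

Let bmI (h : T -> K) : bounded_measurable h ->
  measurable_fun setT (fun t => ipart (h t)) /\ exists M : R, forall x, `|ipart (h x)| <= M.
Proof.
move=> [_ mr [M hM]]; split; first exact: mr.
by exists M => x; exact: le_trans (ipart_norm_le _) (hM x).
Qed.

Let mkscalarD (a b c e : R) :
  mkscalar k a b + mkscalar k c e = mkscalar k (a + c) (b + e) :> K.
Proof. by case: k. Qed.

Let mkscalarM (c z : K) :
  mkscalar k (rpart c * rpart z - ipart c * ipart z)
    (ipart c * rpart z + rpart c * ipart z) = c * z.
Proof.
case: k c z => /= [c z|[a b] [u v] /=]; first by rewrite mul0r subr0.
by apply/eqP; rewrite eq_complex /=; apply/andP; split; apply/eqP; ring.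
Qed.

Let ipartZ (r : R) (z : K) : ipart (ofreal k r * z) = r * ipart z.
Proof. by case: k z => /= [z|[a b] /=]; rewrite ?mulr0// mul0r addr0. Qed.

Lemma scalar_integralD (h1 h2 : T -> K) :
  bounded_measurable h1 -> bounded_measurable h2 ->
  scalar_integral nu (fun x => h1 x + h2 x) = scalar_integral nu h1 + scalar_integral nu h2.
Proof.
move=> b1 b2; rewrite /scalar_integral.
have rE : (fun t => rpart (h1 t + h2 t)) = fun t => rpart (h1 t) + rpart (h2 t).
  by apply/funext => x; rewrite rpartD.
have iE : (fun t => ipart (h1 t + h2 t)) = fun t => ipart (h1 t) + ipart (h2 t).
  by apply/funext => x; rewrite ipartD.
rewrite mkscalarD rE iE; have r1 := bmR b1; have r2 := bmR b2.
have i1 := bmI b1; have i2 := bmI b2.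
by congr (mkscalar k); rewrite !charge_RintegralD//; ring.
Qed.

Lemma scalar_integral_indic (c : K) (A : set T) : measurable A ->
  scalar_integral nu (fun x => c * (ofreal k (\1_A x))) = c * fine (nu A).
Proof.
move=> mA; rewrite /scalar_integral.
have bA : measurable_fun setT (\1_A : T -> R) /\ exists M : R, forall x, `|\1_A x| <= M.
  split; first exact: measurable_indic.
  by exists 1 => x; rewrite indicE; case: (_ \in _); rewrite /= ?normr1 ?normr0.
have rE : (fun t => rpart (c * (ofreal k (\1_A t)))) = fun t => rpart c * \1_A t.
  by apply/funext => x; rewrite mulrC rpartZ mulrC.
have iE : (fun t => ipart (c * (ofreal k (\1_A t)))) = fun t => ipart c * \1_A t.
  by apply/funext => x; rewrite mulrC ipartZ mulrC.
rewrite rE iE !charge_RintegralZ// !charge_Rintegral_indic// /re_charge /im_charge /=.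
exact: mkscalarM.
Qed.

(** A crude constant, from the masses of the Jordan parts of the real and imaginary charges. It
    serves where only finiteness matters: for the remainder in [scalar_integral_le] and for
    surjectivity. *)
Lemma scalar_integral_cont : exists2 V : R, 0 <= V & forall (h : T -> K) (M : R),
  bounded_measurable h -> (forall x, rnorm (h x) <= M) ->
  rnorm (scalar_integral nu h) <= V * M.
Proof.
have [V1 V10 H1] := charge_Rintegral_bound (re_charge nu).
have [V2 V20 H2] := charge_Rintegral_bound (im_charge nu).
exists (2 * (V1 + V2)); first by rewrite mulr_ge0// addr_ge0.
move=> h M [mr mi _] hM; rewrite -(ofreal_le k) rnormE.
apply: le_trans (mkscalar_norm_le _ _ _) _; rewrite ofreal_le.
have rM x : `|rpart (h x)| <= M by exact: le_trans (rpart_norm_le _) (hM x).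
have iM x : `|ipart (h x)| <= M by exact: le_trans (ipart_norm_le _) (hM x).
have := H1 _ _ mr rM; have := H1 _ _ mi iM; have := H2 _ _ mr rM; have := H2 _ _ mi iM.
move=> a1 a2 a3 a4.
have -> : 2 * (V1 + V2) * M = (V1 * M + V2 * M) + (V1 * M + V2 * M) by ring.
apply: lerD.
  by apply: le_trans (ler_normB _ _) _; apply: lerD.
by apply: le_trans (ler_normD _ _) _; apply: lerD.
Qed.

Lemma bounded_measurableD h1 h2 : bounded_measurable h1 -> bounded_measurable h2 ->
  bounded_measurable (fun x => h1 x + h2 x).
Proof.
move=> [r1 i1 [M1 h1M]] [r2 i2 [M2 h2M]]; split.
- rewrite (_ : _ \o _ = fun x => rpart (h1 x) + rpart (h2 x)); first exact: measurable_funD.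
  by apply/funext => x /=; rewrite rpartD.
- rewrite (_ : _ \o _ = fun x => ipart (h1 x) + ipart (h2 x)); first exact: measurable_funD.
  by apply/funext => x /=; rewrite ipartD.
- by exists (M1 + M2) => x; apply: le_trans (rnormD _ _) _; apply: lerD.
Qed.

Lemma bounded_measurable_indic (c : K) (A : set T) : measurable A ->
  bounded_measurable (fun x => c * (ofreal k (\1_A x))).
Proof.
move=> mA; split.
- rewrite (_ : _ \o _ = fun t => rpart c * \1_A t).
    by apply: measurable_funM => //; exact: measurable_indic.
  by apply/funext => x /=; rewrite mulrC rpartZ mulrC.
- rewrite (_ : _ \o _ = fun t => ipart c * \1_A t).
    by apply: measurable_funM => //; exact: measurable_indic.
  by apply/funext => x /=; rewrite mulrC ipartZ mulrC.
- exists (rnorm c) => x; rewrite indicE; case: (_ \in _) => /=.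
    by rewrite ofreal1 mulr1.
  by rewrite ofreal0 mulr0 rnorm0 rnorm_ge0.
Qed.

Lemma bounded_measurable_sum (I : Type) (s : seq I) (h : I -> T -> K) :
  (forall i, bounded_measurable (h i)) ->
  bounded_measurable (fun x => \sum_(i <- s) h i x) /\
  scalar_integral nu (fun x => \sum_(i <- s) h i x) = \sum_(i <- s) scalar_integral nu (h i).
Proof.
move=> bh; elim: s => [|i s [IH1 IH2]].
  have -> : (fun x => \sum_(i <- [::]) h i x) = fun x => 0 * (ofreal k (\1_set0 x)).
    by apply/funext => x; rewrite big_nil mul0r.
  split; first exact: bounded_measurable_indic.
  by rewrite scalar_integral_indic// mul0r big_nil.
have -> : (fun x => \sum_(i <- i :: s) h i x) = fun x => h i x + \sum_(i <- s) h i x.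
  by apply/funext => x; rewrite big_cons.
split; first exact: bounded_measurableD.
by rewrite scalar_integralD// IH2 big_cons.
Qed.

(** The sharp constant. Up to e', h is a simple function on the fibres of a finite code, and the
    integral of that function is at most M times one of the partition sums defining the total
    variation; the crude constant absorbs the remainder. *)
Lemma scalar_integral_le (h : T -> K) (M V : R) : bounded_measurable h ->
  (forall x, rnorm (h x) <= M) -> (Defs.total_variation nu setT <= V%:E)%E ->
  rnorm (scalar_integral nu h) <= M * V.
Proof.
move=> bh hM TV.
have M0 : 0 <= M by exact: le_trans (rnorm_ge0 _) (hM point).
have [C C0 HC] := scalar_integral_cont.
apply/ler_addgt0Pr => e e0.
pose e' := e / (C + 1).
have e'0 : 0 < e' by rewrite divr_gt0// ltr_wpDl.
have [I [c [cP mc]]] := @scalar_code R k M e' e'0.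
have [mr mi _] := bh.
pose B i : set T := [set x | c (h x) = i].
have mB i : measurable (B i) by exact: mc.
(* A value of h itself is used on each cell, so that the bound M is not enlarged; empty cells get
   0. *)
pose v i : K := if pselect (exists x, B i x) is left ex then h (projT1 (cid ex)) else 0.
have vM i : rnorm (v i) <= M.
  by rewrite /v; case: pselect => // _; rewrite rnorm0.
have vB i x : B i x -> rnorm (h x - v i) <= e'.
  move=> Bx; rewrite /v; case: pselect => [ex|[]]; last by exists x.
  by case: cid => y /= By; apply: cP => //; rewrite Bx By.
(* The sign makes h + s the remainder, of modulus at most e'. *)
pose s x := \sum_(i <- enum I) - v i * ofreal k (\1_(B i) x).
have [bs sE] := @bounded_measurable_sum _ (enum I) (fun i x => - v i * ofreal k (\1_(B i) x))
  (fun i => bounded_measurable_indic (- v i) (mB i)).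
have sx x : s x = - v (c (h x)).
  rewrite /s big_enum (bigD1 (c (h x)))//= indicE mem_set// ofreal1 mulr1.
  rewrite big1 ?addr0// => i ic; rewrite indicE memNset/= ?ofreal0 ?mulr0//.
  by rewrite /B /= => ci; rewrite ci eqxx in ic.
have br := bounded_measurableD bh bs.
have := HC _ e' br; rewrite scalar_integralD//.
set r := scalar_integral nu h; rewrite sE big_enum /= => rC.
have {}rC : rnorm (r - \sum_i v i * fine (nu (B i))) <= e.
  have -> : - (\sum_i v i * fine (nu (B i))) =
      \sum_i scalar_integral nu (fun x => - v i * ofreal k (\1_(B i) x)).
    rewrite -sumrN; apply: eq_bigr => i _.
    by rewrite scalar_integral_indic// mulNr.
  apply: le_trans (rC _) _; last first.
    rewrite /e' mulrCA -[leRHS]mulr1; apply: ler_wpM2l; first exact: ltW.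
    by rewrite ler_pdivrMr ?ltr_wpDl// mul1r lerDl.
  by move=> x; rewrite -/(s x) sx; exact: vB.
rewrite -[r](subrK (\sum_i v i * fine (nu (B i)))) addrC.
apply: le_trans (rnormD _ _) _; rewrite [leRHS]addrC addrC; apply: lerD => //.
have : rnorm (\sum_i v i * fine (nu (B i))) <= \sum_i M * rnorm (fine (nu (B i))).
  elim/big_ind2: _ => [|x1 y1 x2 y2 le1 le2|i _]; first by rewrite rnorm0.
    by apply: le_trans (rnormD _ _) _; exact: lerD.
  by rewrite rnormM; apply: ler_wpM2r => //; exact: rnorm_ge0.
move=> /le_trans; apply; rewrite -mulr_sumr; apply: ler_wpM2l => //.
rewrite -lee_fin; apply: le_trans TV; apply: ereal_sup_ubound => /=.
exists #|I|, (fun j => B (enum_val j)); split => //.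
- by move=> i j _ _ [x [xi xj]]; apply: enum_val_inj; rewrite -xi -xj.
- apply/seteqP; split => // x _; exists (enum_rank (c (h x))) => //.
  by rewrite /B /= enum_rankK.
- by congr EFin; rewrite -(big_enum_val (fun i => rnorm (fine (nu (B i))))).
Qed.

End ScalarIntegralTheory.

(** * The Banach-Alaoglu theorem *)

Lemma initial_topology_cvg (S : choiceType) (T : topologicalType) (f : S -> T)
    (F : set_system S) (s : S) :
  Filter F -> f @ F --> f s -> F --> (s : initial_topology f).
Proof.
move=> FF fF U; rewrite (@nbhsE (initial_topology f)) => -[B [[A oA AB] Bs] BU].
apply: filterS BU _; rewrite -AB; apply: fF.
by apply: open_nbhs_nbhs; split => //; rewrite -AB in Bs.
Qed.

Section BanachAlaoglu.
Variables (R : realType) (k : scalar_kind).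
Local Notation K := (scalar_field R k).
Variable X : normedModType K.

Lemma weak_star_ball_cvg (F : set_system (weak_star_ball X)) (p : weak_star_ball X) :
  Filter F -> (forall x, (fun f => weak_star_val f x) @ F --> weak_star_val p x) ->
  F --> p.
Proof.
move=> FF H; apply: initial_topology_cvg.
apply: (@initial_topology_cvg (dual X) {ptws X -> K} (fun f : dual X => (f : {ptws X -> K}))).
by apply/pointwise_cvgP => x; exact: H.
Qed.

Lemma weak_star_eval_continuous (x : X) :
  continuous (fun f : weak_star_ball X => weak_star_val f x : K).
Proof.
move=> p.
have c1 := @initial_continuous (weak_star_ball X) (weak_star X) set_val p.
have c2 := @initial_continuous (dual X) {ptws X -> K}
  (fun f : dual X => (f : {ptws X -> K})) (\val p).
have := cvg_comp _ _ c1 c2.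
by move=> /pointwise_cvgP/(_ x); apply; do 2 apply: fmap_filter; exact: nbhs_filter.
Qed.

Lemma weak_star_ball_norm (f : weak_star_ball X) : opnorm (weak_star_val f) <= 1.
Proof. by have := valP f; rewrite inE. Qed.

Lemma weak_star_ball_le (f : weak_star_ball X) x :
  rnorm (weak_star_val f x : K) <= rnorm x.
Proof.
have := lin_op_rnorm_le (weak_star_val f) x; move=> /le_trans; apply.
by rewrite ler_piMl ?rnorm_ge0//; exact: weak_star_ball_norm.
Qed.

Lemma weak_star_ball_eq (f g : weak_star_ball X) :
  (forall x, weak_star_val f x = weak_star_val g x) -> f = g.
Proof. by move=> fg; apply: val_inj; exact: op_eq. Qed.

Lemma weak_star_ball_exists (f : dual X) : opnorm f <= 1 ->
  exists g : weak_star_ball X, weak_star_val g = f.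
Proof.
move=> f1.
have fin : f \in [set f : weak_star X | opnorm (f : dual X) <= 1] by rewrite inE.
by exists (exist _ f fin).
Qed.

Lemma weak_star_ball_hausdorff : hausdorff_space (weak_star_ball X).
Proof.
move=> f g fg; apply: weak_star_ball_eq => x.
apply: (@norm_hausdorff K K) => A B nA nB.
have [h [Ah Bh]] := fg _ _ (weak_star_eval_continuous nA) (weak_star_eval_continuous nB).
by exists (weak_star_val h x).
Qed.

(** Along an ultrafilter the values at each x stay in a compact set of scalars and so converge;
    linearity and the norm bound pass to the pointwise limit. *)
Lemma weak_star_ball_compact : compact [set: weak_star_ball X].
Proof.
rewrite compact_ultra => F FU _.
have lx x : exists l : K, (fun f : weak_star_ball X => weak_star_val f x) @ F --> l.
  have [C cC HC] := @scalar_bounded_compact R k (rnorm x).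
  have [] := cC ((fun f : weak_star_ball X => weak_star_val f x : K) @ F) _.
    apply: (@filterS _ F _ setT); last exact: filterT.
    move=> f _ /=; apply: HC; exact: weak_star_ball_le.
  move=> l [_ Fl]; exists l => A nA.
  have [//|FA] := in_ultra_setVsetC ((fun f => weak_star_val f x) @^-1` A) FU.
  by have [y []] := Fl (~` A) A FA nA.
have /choice[l ll] := lx.
have FP : ProperFilter F by exact _.
have linl : linear (l : X -> K).
  move=> a x y; apply: (@cvg_unique _ (@norm_hausdorff K K) _ _ _ _ (ll (a *: x + y))).
  have -> : (fun f : weak_star_ball X => weak_star_val f (a *: x + y)) =
     (fun f : weak_star_ball X => a *: (weak_star_val f x : K) + weak_star_val f y).
    by apply/funext => f; have [lf _] := op_memP (weak_star_val f); rewrite lf.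
  by apply: cvgD; [apply: cvgZr; exact: ll|exact: ll].
have lM x : rnorm (l x) <= 1 * rnorm x.
  rewrite mul1r; apply/ler_addgt0Pr => e e0.
  have [f /= lf] := @filter_ex _ F _ _ (ll x _ (rnorm_nbhs (l x) e0)).
  rewrite -[l x](subrK (weak_star_val f x)).
  apply: le_trans (rnormD _ _) _; rewrite addrC; apply: lerD; last exact: ltW.
  exact: weak_star_ball_le.
have lcl : continuous_linear (l : X -> K).
  by split => //; exact: linear_rnorm_continuous linl lM.
pose lo : dual X := Op (lcl : opmem (linear_class X K) _).
have [|p pE] := @weak_star_ball_exists lo.
  by apply: opnorm_le => x x1; apply: le_trans (lM x) _; rewrite mul1r.
exists p; split => //; apply: weak_star_ball_cvg => x.
by rewrite pE; exact: ll.
Qed.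

End BanachAlaoglu.

(** * Bounded functions and their functionals *)

Section NormedHahnBanach.
Variables (R : realType) (k : scalar_kind).
Local Notation K := (scalar_field R k).
Variable V : normedModType K.

Lemma hahn_banach_norm (M : R) (D : V -> K -> Prop) : 0 <= M ->
  D 0 0 ->
  (forall c u a v b, D u a -> D v b -> D (c *: u + v) (c * a + b)) ->
  (forall v a, D v a -> rnorm a <= M * rnorm v) ->
  exists2 g : dual V, opnorm g <= M & forall v a, D v a -> g v = a.
Proof.
move=> M0 D0 DD DM.
have [|||||g gl [gM gD]] := @hahn_banach_seminorm R k V (fun v => M * rnorm v) D.
- by move=> u v; rewrite -mulrDr; apply: ler_wpM2l => //; exact: rnormD.
- by move=> a v; rewrite rnormZ mulrCA.
- exact: D0.
- exact: DD.
- exact: DM.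
have lg : linear (g : V -> K) by move=> c u v; exact: gl.
have gcl : continuous_linear (g : V -> K).
  by split => //; exact: linear_rnorm_continuous lg gM.
exists (Op (gcl : opmem (linear_class V K) _)); last exact: gD.
apply: opnorm_le => x x1; apply: le_trans (gM x) _.
by rewrite -[leRHS]mulr1; apply: ler_wpM2l.
Qed.

Lemma norming_functional (v : V) : exists2 f : dual V, opnorm f <= 1 & f v = `|v|.
Proof.
have [|||g g1 gD] := @hahn_banach_norm 1
  (fun u a => exists2 c : K, u = c *: v & a = c * `|v|) ler01.
- by exists 0; rewrite ?scale0r ?mul0r.
- move=> c _ _ _ _ [a -> ->] [b -> ->]; exists (c * a + b).
    by rewrite scalerDl scalerA.
  by rewrite mulrDl mulrA.
- move=> _ _ [c -> ->]; rewrite mul1r rnormM rnormZ.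
  by rewrite [rnorm `|v|]/rnorm normr_id.
by exists g => //; apply: gD; exists 1; rewrite ?scale1r ?mul1r.
Qed.

End NormedHahnBanach.

Section DualSums.
Variables (R : realType) (k : scalar_kind).
Local Notation K := (scalar_field R k).

Lemma op_sumE (T : Type) (F : normedModType K) (C : opclass T F) (I : Type)
    (s : seq I) (P : pred I) (f : I -> opspace C) t :
  (\sum_(i <- s | P i) f i : opspace C) t = \sum_(i <- s | P i) f i t.
Proof.
elim: s => [|i s IH]; first by rewrite !big_nil.
by rewrite !big_cons; case: (P i) => //; rewrite -IH.
Qed.

Variables V W : normedModType K.

Lemma lin_opD (f : lin_op V W) u v : f (u + v) = f u + f v.
Proof. by have [lf _] := op_memP f; have := lf 1 u v; rewrite !scale1r. Qed.

Lemma lin_op0 (f : lin_op V W) : f 0 = 0.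
Proof.
have := lin_opD f 0 0; rewrite addr0 => /(congr1 (fun w => w - f 0)).
by rewrite subrr addrK.
Qed.

Lemma lin_opZ (f : lin_op V W) a v : f (a *: v) = a *: f v.
Proof. by have [lf _] := op_memP f; have := lf a v 0; rewrite !addr0 lin_op0 addr0. Qed.

Lemma lin_opN (f : lin_op V W) v : f (- v) = - f v.
Proof. by rewrite -scaleN1r lin_opZ scaleN1r. Qed.

Lemma lin_op_sum (f : lin_op V W) (I : Type) (s : seq I) (P : pred I) (v : I -> V) :
  f (\sum_(i <- s | P i) v i) = \sum_(i <- s | P i) f (v i).
Proof.
elim: s => [|i s IH]; first by rewrite !big_nil lin_op0.
by rewrite !big_cons; case: (P i) => //; rewrite lin_opD IH.
Qed.

Lemma rnorm_sum (I : Type) (s : seq I) (P : pred I) (v : I -> V) :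
  rnorm (\sum_(i <- s | P i) v i) <= \sum_(i <- s | P i) rnorm (v i).
Proof.
elim: s => [|i s IH]; first by rewrite !big_nil rnorm0.
rewrite !big_cons; case: (P i) => //.
by apply: le_trans (rnormD _ _) _; rewrite lerD2l.
Qed.

Lemma bidual_cl (v : V) : continuous_linear (fun f : dual V => f v : K).
Proof.
have l : linear (fun f : dual V => f v : K) by [].
split => //; apply: (linear_rnorm_continuous (M := rnorm v) l) => f.
by rewrite rnorm_opE mulrC; exact: lin_op_rnorm_le.
Qed.

Definition bidual (v : V) : dual (dual V) :=
  Op (bidual_cl v : opmem (linear_class (dual V) K) _).

Lemma bidual_le (v : V) : opnorm (bidual v) <= rnorm v.
Proof.
apply: opnorm_le => f f1; apply: le_trans (lin_op_rnorm_le f v) _.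
by apply: ler_piMl; [exact: rnorm_ge0|rewrite -rnorm_opE].
Qed.

Lemma sum_opnorm_le (I : finType) (m : I -> lin_op V W) (C : R) :
  (forall y : I -> V, (forall i, rnorm (y i) <= 1) -> \sum_i rnorm (m i (y i)) <= C) ->
  \sum_i opnorm (m i) <= C.
Proof.
move=> H; apply/ler_addgt0Pr => e e0.
pose e' := e / (#|I|%:R + 1).
have e'0 : 0 < e' by rewrite divr_gt0// ltr_wpDl.
have /choice[y yP] : forall i, exists y, rnorm y <= 1 /\ opnorm (m i) <= rnorm (m i y) + e'.
  move=> i; have [_ [y /= y1 <-] lt] := sup_adherent e'0 (opnorm_has_sup (m i)).
  by exists y; split => //; rewrite -lerBlDr ltW.
apply: (@le_trans _ _ (\sum_i (rnorm (m i (y i)) + e'))).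
  by apply: ler_sum => i _; have [] := yP i.
rewrite big_split /=; apply: lerD; first by apply: H => i; have [] := yP i.
rewrite sumr_const -mulr_natl /e' mulrCA -[leRHS]mulr1; apply: ler_wpM2l; first exact: ltW.
by rewrite ler_pdivrMr ?ltr_wpDl// mul1r lerDl.
Qed.

End DualSums.

Section BoundedFunctions.
Variables (R : realType) (k : scalar_kind).
Local Notation K := (scalar_field R k).
Variables (T : pointedType) (F : normedModType K).

Definition bounded_functions : set (T -> F) :=
  [set f | exists M : R, forall t, rnorm (f t) <= M].

Let bf0 : bounded_functions (fun=> 0).
Proof. by exists 0 => t; rewrite rnorm0. Qed.

Let bfD f g : bounded_functions f -> bounded_functions g ->
  bounded_functions (fun t => f t + g t).
Proof.
move=> [M fM] [N gN]; exists (M + N) => t.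
by apply: le_trans (rnormD _ _) _; exact: lerD.
Qed.

Let bfZ (a : K) f : bounded_functions f -> bounded_functions (fun t => a *: f t).
Proof.
move=> [M fM]; exists (rnorm a * M) => t.
by rewrite rnormZ; apply: ler_wpM2l => //; exact: rnorm_ge0.
Qed.

Let bfb f : bounded_functions f ->
  exists M : R, forall t, [set: T] t -> rnorm (f t) <= M.
Proof. by move=> [M fM]; exists M. Qed.

Let bfs f : bounded_functions f -> (forall t, [set: T] t -> f t = 0) ->
  forall t, f t = 0.
Proof. by move=> _ f0 t; exact: f0. Qed.

Let bfn : [set: T] !=set0.
Proof. by exists point. Qed.

Definition bounded_class : opclass T F := OpClass bfn bf0 bfD bfZ bfb bfs.

(* A finite partition of T is given by a code c : T -> I. *)
Lemma step_bounded (I : finType) (c : T -> I) (y : I -> F) :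
  bounded_functions (fun t => y (c t)).
Proof.
exists (\sum_i rnorm (y i)) => t; rewrite (bigD1 (c t))//= lerDl.
by apply: sumr_ge0 => i _; exact: rnorm_ge0.
Qed.

Definition step (I : finType) (c : T -> I) (y : I -> F) : opspace bounded_class :=
  Op (step_bounded c y : opmem bounded_class _).

Definition bump (I : finType) (c : T -> I) (i : I) (y : F) : opspace bounded_class :=
  step c (fun j => if j == i then y else 0).

Lemma step_sum (I : finType) (c : T -> I) (y : I -> F) :
  step c y = \sum_i bump c i (y i).
Proof.
apply: op_eq => t; rewrite op_sumE /= (bigD1 (c t))//= eqxx big1 ?addr0// => i.
by rewrite eq_sym => /negbTE ->.
Qed.

Variable Psi : dual (opspace bounded_class).

Lemma bump_cl (I : finType) (c : T -> I) (i : I) :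
  continuous_linear (fun y : F => Psi (bump c i y) : K).
Proof.
have l : linear (fun y : F => Psi (bump c i y) : K).
  move=> a y z; rewrite -lin_opZ -lin_opD; congr (Psi _); apply: op_eq => t /=.
  by case: eqP => // _; rewrite scaler0 addr0.
split => //; apply: (linear_rnorm_continuous (M := opnorm Psi) l) => y.
apply: le_trans (lin_op_rnorm_le _ _) _; apply: ler_wpM2l; first exact: opnorm_ge0.
rewrite rnorm_opE; apply: opnorm_le => t _ /=.
by case: eqP => // _; rewrite rnorm0 rnorm_ge0.
Qed.

(** The value, at the cell where c = i, of the finitely additive vector measure associated with
    [Psi]. *)
Definition vmeasure (I : finType) (c : T -> I) (i : I) : dual F :=
  Op (bump_cl c i : opmem (linear_class F K) _).

Lemma vmeasure_step (I : finType) (c : T -> I) (y : I -> F) :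
  Psi (step c y) = \sum_i vmeasure c i (y i).
Proof. by rewrite step_sum lin_op_sum. Qed.

(** Rotating the test vectors by unimodular scalars turns the sum of moduli into one value of [Psi],
    at a step function of norm at most 1. *)
Lemma vmeasure_variation (I : finType) (c : T -> I) :
  \sum_i opnorm (vmeasure c i) <= opnorm Psi.
Proof.
apply: sum_opnorm_le => y y1.
have /choice[a aP] : forall i, exists a : K,
    rnorm a = 1 /\ a * vmeasure c i (y i) = `|vmeasure c i (y i)|.
  by move=> i; have [a a1 aE] := unimodular (vmeasure c i (y i) : K); exists a.
have E : Psi (step c (fun i => a i *: y i)) = ofreal k (\sum_i rnorm (vmeasure c i (y i))).
  rewrite vmeasure_step.
  have -> : ofreal k (\sum_i rnorm (vmeasure c i (y i))) =
      \sum_i ofreal k (rnorm (vmeasure c i (y i))) :> K.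
    elim/big_ind2: _ => [|x1 x2 y1' y2 <- <-|//]; first by rewrite ofreal0.
    by rewrite ofrealD.
  by apply: eq_bigr => i _; rewrite rnormE -(aP i).2 lin_opZ.
have S0 : 0 <= \sum_i rnorm (vmeasure c i (y i)).
  by apply: sumr_ge0 => i _; exact: rnorm_ge0.
have := lin_op_rnorm_le Psi (step c (fun i => a i *: y i)).
rewrite E rnorm_ofreal// => /le_trans; apply.
rewrite -[leRHS]mulr1; apply: ler_wpM2l; first exact: opnorm_ge0.
rewrite rnorm_opE; apply: opnorm_le => t _ /=.
by rewrite rnormZ (aP _).1 mul1r.
Qed.

End BoundedFunctions.

(** * Representing measures of hyper-Borel transforms *)

Section Box.
Variables (R : realType) (k : scalar_kind) (n : nat).
Local Notation K := (scalar_field R k).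
Variable E : 'I_n -> normedModType K.

(** A type of its own, because n-linear operators are bounded only on the product of balls while
    [bounded_class] wants bounds on the whole domain. *)
Definition box : Type := {x : forall i, E i | Defs.prod_ball x}.

Let box0 : Defs.prod_ball (fun i : 'I_n => (0 : E i)).
Proof. by move=> i; rewrite /unit_ball /= rnorm0. Qed.

HB.instance Definition _ := gen_eqMixin box.
HB.instance Definition _ := gen_choiceMixin box.
HB.instance Definition _ := isPointed.Build box (exist _ _ box0).

Lemma box_bounded (F : normedModType K) (C : opclass (forall i, E i) F)
    (f : opspace C) : @Defs.prod_ball R k n E `<=` opball C ->
  bounded_functions (fun x : box => f (sval x)).
Proof.
move=> hC; exists (opnorm f) => x; apply: opnorm_ub; apply: hC; exact: svalP x.
Qed.

(** Restriction to [box] is isometric, so phi lives on a subspace of the bounded functions and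
    extends. The class is left general because the lemma is used for compact operators and for
    scalar forms. *)
Lemma extend_to_bounded (F : normedModType K) (C : opclass (forall i, E i) F)
    (phi : dual (opspace C)) : opball C = @Defs.prod_ball R k n E ->
  exists2 Psi : dual (opspace (bounded_class box F)), opnorm Psi <= opnorm phi &
    forall (f : opspace C) (h : opspace (bounded_class box F)),
      (forall x, h x = f (sval x)) -> Psi h = phi f.
Proof.
move=> hC.
have [|||Psi PM PD] := @hahn_banach_norm R k (opspace (bounded_class box F)) (opnorm phi)
  (fun h a => exists2 f : opspace C, (forall x, h x = f (sval x)) & a = phi f) (opnorm_ge0 phi).
- by exists 0 => //; rewrite lin_op0.
- move=> c u _ v _ [f fu ->] [g gv ->]; exists (c *: f + g) => [x /=|].
    by rewrite fu gv.
  by rewrite lin_opD lin_opZ.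
- move=> v _ [f fv ->]; apply: le_trans (lin_op_rnorm_le _ _) _.
  apply: ler_wpM2l; first exact: opnorm_ge0.
  rewrite !rnorm_opE; apply: opnorm_le => t Ct.
  have Bt : Defs.prod_ball t by rewrite -hC.
  by rewrite -(fv (exist _ t Bt)); apply: opnorm_ub.
by exists Psi => // f h hf; apply: PD; exists f.
Qed.

Lemma box_eval (x : box) :
  exists p : weak_star_ball (mult_form E), forall A, weak_star_val p A = A (sval x).
Proof.
have l : linear (fun A : mult_form E => A (sval x) : K) by [].
have lM (A : mult_form E) : rnorm (A (sval x) : K) <= 1 * rnorm A.
  by rewrite mul1r rnorm_opE; apply: opnorm_ub; exact: svalP x.
have cl : continuous_linear (fun A : mult_form E => A (sval x) : K).
  by split => //; exact: linear_rnorm_continuous l lM.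
have [|p pE] := @weak_star_ball_exists _ _ _ (Op (cl : opmem (linear_class (mult_form E) K) _)).
  by apply: opnorm_le => A A1; apply: le_trans (lM A) _; rewrite mul1r.
by exists p => A; rewrite pE.
Qed.

End Box.

Lemma seq_code (R : realType) (k : scalar_kind) (Z : eqType) (T : Type) (s : seq Z)
    (F : Z -> T -> scalar_field R k) (e : R) : 0 < e ->
  (forall z, exists M : R, forall t, rnorm (F z t) <= M) ->
  exists (I : finType) (c : T -> I), forall z, z \in s ->
    forall t t', c t = c t' -> rnorm (F z t - F z t') <= e.
Proof.
move=> e0 FM; elim: s => [|z s [I [c cP]]]; first by exists unit, (fun=> tt).
have [M zM] := FM z.
have [J [d [dP _]]] := @scalar_code R k M e e0.
exists (I * J)%type, (fun t => (c t, d (F z t))) => w.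
rewrite inE => /orP[/eqP ->|ws] t t' [ct dt]; last exact: cP.
exact: dP.
Qed.

Section Representation.
Variables (R : realType) (k : scalar_kind) (n : nat).
Local Notation K := (scalar_field R k).
Variables (E : 'I_n -> normedModType K) (F : normedModType K).
Variable phi : dual (compact_op E F).

(* Local-reflexivity step: on finitely many forms, [hyper_borel phi] agrees up to epsilon
   with [A |-> sum_i A(x_i) m_i], where the total norm of the m_i is at most |phi|. *)
Lemma hyper_borel_approx (s : seq (mult_form E)) (e : R) : 0 < e ->
  exists (I : finType) (x : I -> box E) (m : I -> dual F),
    \sum_i opnorm (m i) <= opnorm phi /\
    forall A, A \in s ->
      opnorm (hyper_borel E F phi A - \sum_i (A (sval (x i)) : K) *: m i) <= opnorm phi * e.
Proof.
move=> e0.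
have [Psi PM PE] := @extend_to_bounded R k n E F _ phi erefl.
have [|I [c cP]] := @seq_code R k _ (box E) s (fun A x => A (sval x)) e e0.
  move=> A; exists (opnorm A) => x; apply: opnorm_ub; exact: svalP x.
(* A representative of each cell. The default for an empty cell is harmless, as its functional
   [vmeasure Psi c i] is 0. *)
pose r i : box E := if pselect (exists x, c x = i) is left ex then projT1 (cid ex) else point.
have rP x : c (r (c x)) = c x.
  rewrite /r; case: pselect => [ex|[]]; last by exists x.
  by case: cid.
exists I, r, (fun i => vmeasure Psi c i); split.
  by apply: le_trans PM; exact: vmeasure_variation.
move=> A As; apply: opnorm_le => y y1 /=.
have bt : bounded_functions (fun x : box E => tensor A y (sval x)).
  exact: box_bounded.
pose h : opspace (bounded_class (box E) F) := Op (bt : opmem (bounded_class (box E) F) _).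
pose st := step c (fun i => (A (sval (r i)) : K) *: y).
have -> : hyper_borel_form phi A y +
    (- (\sum_i (A (sval (r i)) : K) *: vmeasure Psi c i : dual F)) y = Psi (h - st).
  rewrite lin_opD lin_opN (PE (tensor A y))//; congr (_ + _).
  rewrite /st vmeasure_step.
  rewrite -[LHS]/(- ((\sum_i (A (sval (r i)) : K) *: vmeasure Psi c i : dual F) y)).
  by congr (- _); rewrite op_sumE; apply: eq_bigr => i _; rewrite lin_opZ.
apply: le_trans (lin_op_rnorm_le _ _) _.
apply: ler_pM => //; [exact: opnorm_ge0|exact: rnorm_ge0|].
rewrite rnorm_opE; apply: opnorm_le => x _ /=.
rewrite -scalerBl rnormZ -[leRHS]mulr1; apply: ler_pM => //; try exact: rnorm_ge0.
by apply: cP => //; rewrite rP.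
Qed.

(** In the discretization, the cell i contributes |m_i| times the value of the tensor at one point
    of the ball product, namely evaluation at x_i paired with m_i/|m_i| seen in the bidual of
    [dual F]. Each is at most |m_i| N, and the |m_i| sum to at most |phi|. *)
Lemma hyper_borel_tensor_le (s : seq (mult_form E * dual (dual F))) (N : R) :
  (forall (p : weak_star_ball (mult_form E)) (q : weak_star_ball (dual (dual F))),
    rpart (\sum_(z <- s) weak_star_val p z.1 * weak_star_val q z.2 : K) <= N) ->
  rpart (\sum_(z <- s) (z.2 (hyper_borel E F phi z.1)) : K) <= opnorm phi * N.
Proof.
move=> H.
(* The zero functionals lie in both balls and give the value 0. *)
have N0 : 0 <= N.
  have [|p pE] := @weak_star_ball_exists R k (mult_form E) 0; first by rewrite -rnorm_opE rnorm0.
  have [|q qE] := @weak_star_ball_exists R k (dual (dual F)) 0; first by rewrite -rnorm_opE rnorm0.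
  apply: le_trans (H p q); rewrite pE qE big1 ?rpart0// => z _ /=.
  by rewrite mul0r.
apply/ler_addgt0Pr => e e0.
pose S := \sum_(z <- s) opnorm z.2.
have S0 : 0 <= S by apply: sumr_ge0 => z _; exact: opnorm_ge0.
pose e' := e / (opnorm phi * S + 1).
have pS0 : 0 <= opnorm phi * S by rewrite mulr_ge0// opnorm_ge0.
have e'0 : 0 < e' by rewrite divr_gt0// ltr_wpDl.
have [I [x [m [mphi mA]]]] := @hyper_borel_approx [seq z.1 | z <- s] e' e'0.
pose h (A : mult_form E) : dual F :=
  hyper_borel E F phi A - \sum_i (A (sval (x i)) : K) *: m i.
have -> : \sum_(z <- s) (z.2 (hyper_borel E F phi z.1) : K) =
    \sum_i \sum_(z <- s) (z.1 (sval (x i)) : K) * (z.2 (m i) : K) +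
    \sum_(z <- s) (z.2 (h z.1) : K).
  rewrite exchange_big -big_split /=; apply: eq_bigr => z _.
  rewrite /h lin_opD lin_opN lin_op_sum addrC -addrA.
  have -> : \sum_i z.2 ((z.1 (sval (x i)) : K) *: m i) =
    \sum_i (z.1 (sval (x i)) : K) * z.2 (m i) :> K.
    by apply: eq_bigr => i _; rewrite lin_opZ.
  by rewrite addNr addr0.
rewrite rpartD; apply: lerD.
  rewrite rpart_sum; apply: (@le_trans _ _ (\sum_i opnorm (m i) * N)); last first.
    by rewrite -mulr_suml; apply: ler_wpM2r.
  apply: ler_sum => i _.
  (* Only a nonzero m_i can be normalized to a point of the second ball. *)
  have [m0|m0] := eqVneq (opnorm (m i)) 0.
    have mi0 : m i = 0 by apply: rnorm_eq0; rewrite rnorm_opE.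
    rewrite mi0 big1 ?rpart0; first by rewrite -rnorm_opE rnorm0 mul0r.
    by move=> z _; rewrite lin_op0 mulr0.
  have mgt0 : 0 < opnorm (m i) by rewrite lt_neqAle eq_sym m0 opnorm_ge0.
  have [p pE] := box_eval (x i).
  have [|q qE] := @weak_star_ball_exists R k (dual (dual F))
      (ofreal k (opnorm (m i))^-1 *: bidual (m i)).
    rewrite -rnorm_opE rnormZ rnorm_ofreal ?invr_ge0 ?opnorm_ge0// rnorm_opE.
    rewrite mulrC ler_pdivrMr// mul1r -[leRHS]rnorm_opE; exact: bidual_le.
  have mH := H p q; rewrite -(ler_pM2l mgt0) in mH; apply: le_trans mH.
  rewrite le_eqVlt; apply/orP; left; apply/eqP.
  rewrite -rpartZ mulr_sumr; congr rpart; apply: eq_bigr => z _.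
  rewrite pE qE /= mulrCA; congr (_ * _).
  by rewrite [RHS]mulrA -ofrealM mulfV// ofreal1 mul1r.
apply: le_trans (rpart_le_rnorm _) _; apply: le_trans (rnorm_sum _ _ _) _.
apply: (@le_trans _ _ (\sum_(z <- s) opnorm z.2 * (opnorm phi * e'))).
  rewrite big_seq [leRHS]big_seq; apply: ler_sum => z zs.
  apply: le_trans (lin_op_rnorm_le _ _) _; apply: ler_wpM2l; first exact: opnorm_ge0.
  by rewrite rnorm_opE; apply: mA; apply: map_f.
rewrite -mulr_suml -/S mulrA [S * _]mulrC /e' mulrCA -[leRHS]mulr1.
apply: ler_wpM2l; first exact: ltW.
by rewrite ler_pdivrMr ?ltr_wpDl// mul1r lerDl.
Qed.

End Representation.

Section BallProduct.
Variables (R : realType) (k : scalar_kind).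
Local Notation K := (scalar_field R k).

Lemma rpart_continuous : continuous (@rpart R k : K -> R).
Proof.
move=> z U /nbhs_ballP[e /= e0 eU].
apply: (@filterS _ _ (nbhs_filter z) _ _ _ (@rnorm_nbhs R k K z e e0)) => w /= zw.
apply: eU; rewrite /ball /=; apply: le_lt_trans zw.
have -> : rpart z - rpart w = rpart (z - w).
  by apply/eqP; rewrite subr_eq -rpartD subrK.
exact: rpart_norm_le.
Qed.

Lemma ipart_continuous : continuous (@ipart R k : K -> R).
Proof.
move=> z U /nbhs_ballP[e /= e0 eU].
apply: (@filterS _ _ (nbhs_filter z) _ _ _ (@rnorm_nbhs R k K z e e0)) => w /= zw.
apply: eU; rewrite /ball /=; apply: le_lt_trans zw.
have -> : ipart z - ipart w = ipart (z - w).
  by apply/eqP; rewrite subr_eq -ipartD subrK.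
exact: ipart_norm_le.
Qed.

Variables X Y : normedModType K.
Local Notation BP := (ball_product X Y).

Lemma ball_product_compact : compact [set: BP].
Proof.
rewrite -[[set: BP]]/([set: weak_star_ball X * weak_star_ball (dual Y)]) -setXTT.
apply: compact_setX; exact: weak_star_ball_compact.
Qed.

Lemma ball_product_hausdorff : hausdorff_space BP.
Proof.
move=> p q pq; rewrite (surjective_pairing p) (surjective_pairing q); congr pair.
  apply: (@weak_star_ball_hausdorff R k X) => A B nA nB.
  have pA : nbhs p ((fun z : BP => z.1) @^-1` A) by exact: cvg_fst nA.
  have qB : nbhs q ((fun z : BP => z.1) @^-1` B) by exact: cvg_fst nB.
  by have [z [Az Bz]] := pq _ _ pA qB; exists z.1.
apply: (@weak_star_ball_hausdorff R k (dual Y)) => A B nA nB.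
have pA : nbhs p ((fun z : BP => z.2) @^-1` A) by exact: cvg_snd nA.
have qB : nbhs q ((fun z : BP => z.2) @^-1` B) by exact: cvg_snd nB.
by have [z [Az Bz]] := pq _ _ pA qB; exists z.2.
Qed.

Lemma pairing_continuous (x : X) (y : dual Y) :
  continuous (fun p : BP => weak_star_val p.1 x * weak_star_val p.2 y : K).
Proof.
move=> p; apply: (@cvgM K BP (nbhs p)).
  apply: (@cvg_comp _ _ _ (fun p : BP => p.1)
    (fun f : weak_star_ball X => weak_star_val f x : K) (nbhs p) (nbhs p.1)).
    exact: cvg_fst.
  exact: weak_star_eval_continuous.
apply: (@cvg_comp _ _ _ (fun p : BP => p.2)
  (fun f : weak_star_ball (dual Y) => weak_star_val f y : K) (nbhs p) (nbhs p.2)).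
  exact: cvg_snd.
exact: weak_star_eval_continuous.
Qed.

Lemma pairing_bounded_measurable (x : X) (y : dual Y) :
  bounded_measurable (fun p : borel BP => weak_star_val p.1 x * weak_star_val p.2 y : K).
Proof.
split.
- apply: continuous_borel_measurable => p.
  exact: (cvg_comp _ _ (@pairing_continuous x y p) (@rpart_continuous _)).
- apply: continuous_borel_measurable => p.
  exact: (cvg_comp _ _ (@pairing_continuous x y p) (@ipart_continuous _)).
- exists (rnorm x * rnorm y) => p.
  rewrite rnormM; apply: ler_pM; try exact: rnorm_ge0; exact: weak_star_ball_le.
Qed.

End BallProduct.

Section RepresentingMeasure.
Variables (R : realType) (k : scalar_kind) (n : nat).
Local Notation K := (scalar_field R k).
Variables (E : 'I_n -> normedModType K) (F : normedModType K).
Variable phi : dual (compact_op E F).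
Local Notation BP := (ball_product (mult_form E) (dual F)).
Local Notation KR := (scalar_field R RealScalars).
Local Notation V := (opspace (bounded_class BP KR)).

Let pair_sum (s : seq (mult_form E * dual (dual F))) (p : BP) : K :=
  \sum_(z <- s) weak_star_val p.1 z.1 * weak_star_val p.2 z.2.

Let phi_sum (s : seq (mult_form E * dual (dual F))) : K :=
  \sum_(z <- s) (z.2 (hyper_borel E F phi z.1) : K).

Let ssup (h : V) : R := sup [set (h x : R) | x in [set: BP]].

Let ssup_has (h : V) : has_sup [set (h x : R) | x in [set: BP]].
Proof.
split; first by exists (h point), point.
exists (opnorm h) => _ [x _ <-].
by apply: le_trans (opnorm_ub h (t := x) _) => //; exact: ler_norm.
Qed.

Let ssup_ub (h : V) x : (h x : R) <= ssup h.
Proof. by apply: (sup_upper_bound (ssup_has h)); exists x. Qed.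

Let ssup_le (h : V) (M : R) : (forall x, (h x : R) <= M) -> ssup h <= M.
Proof.
by move=> H; apply: ge_sup; [exact: (ssup_has h).1|move=> _ [x _ <-]; exact: H].
Qed.

(** Functions are real-valued here even for complex K: the graph consists of real parts of tensors,
    and [hyper_borel_tensor_le] says exactly that it is dominated by |phi| times the one-sided
    supremum [ssup]. *)
Let tensor_functional : exists2 g : V -> R, real_linear g &
  (forall h, g h <= opnorm phi * ssup h) /\
  (forall (h : V) s, (forall x, h x = rpart (pair_sum s x)) -> g h = rpart (phi_sum s)).
Proof.
have phi0 : 0 <= opnorm phi by exact: opnorm_ge0.
pose D (h : V) (r : R) := exists2 s, (forall x, h x = rpart (pair_sum s x)) &
  r = rpart (phi_sum s).
have DZ (r : R) (h : V) (a : R) : D h a -> D (ofreal RealScalars r *: h) (r * a).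
  move=> [s hs ->]; exists [seq (ofreal k r *: z.1, z.2) | z <- s].
    move=> x /=; rewrite hs -[LHS]/(r * rpart (pair_sum s x)) -rpartZ /pair_sum mulr_sumr big_map.
    congr rpart; apply: eq_bigr => z _ /=.
    by rewrite lin_opZ mulrA.
  rewrite -rpartZ /phi_sum mulr_sumr big_map; congr rpart; apply: eq_bigr => z _ /=.
  rewrite -[RHS]/((z.2 : dual (dual F)) (hyper_borel_form phi (ofreal k r *: z.1))).
  have -> : hyper_borel_form phi (ofreal k r *: z.1) = ofreal k r *: hyper_borel_form phi z.1.
    by have := lin_opZ (hyper_borel E F phi) (ofreal k r) z.1.
  by rewrite lin_opZ.
have [|||||g gl [gp gD]] := @hahn_banach_cone R RealScalars V (fun h => opnorm phi * ssup h) D.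
- split=> [u v|r v r0].
    rewrite -mulrDr; apply: ler_wpM2l => //; apply: ssup_le => x.
    by apply: lerD; exact: ssup_ub.
  rewrite mulrCA; apply: ler_wpM2l => //; apply: ssup_le => x.
  by apply: ler_wpM2l; [exact: ltW|exact: ssup_ub].
- by exists [::] => [x|]; rewrite /pair_sum /phi_sum big_nil rpart0.
- move=> u _ v _ [s us ->] [t vt ->]; exists (s ++ t) => [x|].
    by rewrite /pair_sum big_cat /= rpartD -us -vt.
  by rewrite /phi_sum big_cat /= rpartD.
- by move=> r v a _; exact: DZ.
- move=> h _ [s hs ->]; apply: hyper_borel_tensor_le => p q.
  by rewrite -[X in X <= _](hs (p, q)); exact: ssup_ub.
exists g => //; split => // h s hs.
have Dh : D h (rpart (phi_sum s)) by exists s.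
(* The graph is stable under multiplication by -1, so the lower bound at -h turns [gD] into an
   equality. *)
apply/eqP; rewrite eq_le (gD _ _ Dh) andbT.
have := gD _ _ (DZ (-1) _ _ Dh).
by rewrite gl.2 !mulN1r lerN2.
Qed.

Lemma hyper_borel_measure : exists nu : {charge set (borel BP) -> \bar K},
  [/\ regular nu, represents nu (hyper_borel E F phi) &
      (Defs.total_variation nu setT <= (opnorm phi)%:E)%E].
Proof.
have phi0 : 0 <= opnorm phi by exact: opnorm_ge0.
have [g [gD gZ] [gp gE]] := tensor_functional.
pose mk (f : BP -> R) (b : fbounded f) : V :=
  Op ((b : bounded_functions (f : BP -> KR)) : opmem (bounded_class BP KR) _).
(* [Lam] has to be total; it is 0 off the bounded functions, where the Riesz theorem requires
   nothing. *)
pose Lam (f : BP -> R) : R :=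
  if pselect (fbounded f) is left b then g (mk f b) else 0.
have LamE f (b : fbounded f) : Lam f = g (mk f b).
  rewrite /Lam; case: pselect => [b'|/(_ b)//].
  by congr g; apply: op_eq.
have bD (f h : BP -> R) : fbounded f -> fbounded h -> fbounded (fun x : BP => f x + h x).
  move=> [M fM] [N hN]; exists (M + N) => x.
  by apply: le_trans (ler_normD _ _) _; apply: lerD.
have bZ r (f : BP -> R) : fbounded f -> fbounded (fun x : BP => r * f x).
  by move=> [M fM]; exists (`|r| * M) => x; rewrite normrM ler_wpM2l.
have b1 : fbounded (fun _ : BP => 1 : R) by exists `|1|.
have [|||mu [muT mureg muE]] := @riesz_representation R BP (@ball_product_hausdorff R k _ _)
    (@ball_product_compact R k _ _) Lam.
- move=> f h bf bh; rewrite (LamE _ (bD _ _ bf bh)) (LamE _ bf) (LamE _ bh) -gD.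
  by congr g; apply: op_eq.
- move=> r f bf; rewrite (LamE _ (bZ r _ bf)) (LamE _ bf) -gZ.
  by congr g; apply: op_eq.
(* Positivity comes from the one-sided supremum, which is at most 0 at -f; a bound by the sup norm
   would not suffice. *)
- move=> f bf f0; rewrite (LamE _ bf) -oppr_le0 -mulN1r -gZ.
  apply: le_trans (gp _) _; apply: mulr_ge0_le0 => //; apply: ssup_le => x.
  by rewrite -[leLHS]/(-1 * f x) mulN1r oppr_le0.
have mule : (mu setT <= (opnorm phi)%:E)%E.
  rewrite muT lee_fin (LamE _ b1) -[leRHS]mulr1; apply: le_trans (gp _) _.
  by apply: ler_wpM2l => //; apply: ssup_le.
have finmu : (mu setT < +oo)%E by rewrite muT ltry.
have [nu nuE] := @charge_of_measure R k _ _ mu finmu.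
exists nu; split.
- move=> A mA e e0; have [C [U [cC oU CA AU lt]]] := mureg A mA e e0.
  exists C, U; split => //; apply: le_lt_trans lt.
  apply: total_variation_measure => //; apply: measurableD.
    exact: sub_sigma_algebra.
  rewrite -[C]setCK; apply: measurableC; apply: sub_sigma_algebra.
  apply: closed_openC; apply: compact_closed => //; exact: ball_product_hausdorff.
- move=> A y'; rewrite (scalar_integral_measure _ finmu nuE).
  (* A factor a is absorbed into the form. Then a = 1 gives the real part and a = -i the imaginary
     part, as Im z = Re(-iz); over the reals [mkscalar k 0 (-1)] is 0, and so is [ipart]. *)
  have E1 (a : K) : \int[mu]_p rpart (a * (weak_star_val p.1 A * weak_star_val p.2 y'))
      = rpart (a * y' (hyper_borel E F phi A)).
    have c : continuous (fun p : BP => rpart (a * (weak_star_val p.1 A * weak_star_val p.2 y'))).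
      have -> : (fun p : BP => rpart (a * (weak_star_val p.1 A * weak_star_val p.2 y'))) =
        (fun p : BP => rpart (weak_star_val p.1 (a *: A) * weak_star_val p.2 y')).
        by apply/funext => p; rewrite lin_opZ mulrA.
      move=> p; exact: (cvg_comp _ _
        (@pairing_continuous _ _ _ _ (a *: A) y' p) (@rpart_continuous _ _ _)).
    have b := continuous_fbounded (@ball_product_compact R k _ _) c.
    rewrite (muE _ c) (LamE _ b) (gE _ [:: (a *: A, y')]) /phi_sum /pair_sum.
      rewrite big_seq1 /=; congr rpart.
      by rewrite -[LHS]/(y' (hyper_borel E F phi (a *: A))) !lin_opZ.
    by move=> x; rewrite big_seq1 /= lin_opZ mulrA.
  have ipE (z : K) : ipart z = rpart (mkscalar k 0 (-1) * z).
    by case: {+}k z => [z|[a b]] /=; rewrite ?mul0r// mulN1r opprK add0r.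
  rewrite -[LHS]mkscalarE; congr (mkscalar k).
    rewrite -[in LHS](mul1r (y' _)) -E1; apply: eq_Rintegral => p _.
    by rewrite mul1r.
  by rewrite ipE -E1; apply: eq_Rintegral => p _; rewrite -ipE.
- apply: le_trans mule; exact: total_variation_measure.
Qed.

End RepresentingMeasure.

(** * Extension of integral operators to compact operators *)

Section IntegralExtension.
Variables (R : realType) (k : scalar_kind) (n : nat).
Local Notation K := (scalar_field R k).
Variables (E : 'I_n -> normedModType K) (F : normedModType K).
Local Notation BP := (ball_product (mult_form E) (dual F)).

(** The operator norm of a tensor dominates its supremum over the ball product: the first functional
    is applied to a form obtained with the second, and the value of that form at x is the second
    functional at the bidual image of the operator's value at x. *)
Lemma tensor_pairing_le (s : seq (mult_form E * F)) (p : BP) :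
  rnorm (\sum_(z <- s) weak_star_val p.1 z.1 * weak_star_val p.2 (bidual z.2) : K) <=
  opnorm (\sum_(z <- s) tensor z.1 z.2).
Proof.
have -> : \sum_(z <- s) weak_star_val p.1 z.1 * weak_star_val p.2 (bidual z.2) =
    weak_star_val p.1 (\sum_(z <- s) (weak_star_val p.2 (bidual z.2) : K) *: z.1) :> K.
  by rewrite lin_op_sum; apply: eq_bigr => z _; rewrite lin_opZ mulrC.
apply: le_trans (weak_star_ball_le _ _) _; rewrite rnorm_opE.
apply: opnorm_le => x Bx.
have -> : (\sum_(z <- s) (weak_star_val p.2 (bidual z.2) : K) *: z.1 : mult_form E) x =
    weak_star_val p.2 (bidual ((\sum_(z <- s) tensor z.1 z.2 : compact_op E F) x)) :> K.
  rewrite !op_sumE /=.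
  have -> : bidual (\sum_(z <- s) (z.1 x : K) *: z.2) = \sum_(z <- s) (z.1 x : K) *: bidual z.2.
    apply: op_eq => f; rewrite op_sumE /= lin_op_sum; apply: eq_bigr => z _.
    by rewrite lin_opZ.
  rewrite lin_op_sum; apply: eq_bigr => z _.
  by rewrite lin_opZ; exact: mulrC.
apply: le_trans (weak_star_ball_le _ _) _; rewrite rnorm_opE.
by apply: le_trans (bidual_le _) _; exact: opnorm_ub.
Qed.

(** The functional is prescribed on sums of tensors, where it is an integral against [nu], and
    extended. [V] is any constant controlling such integrals: the total variation for the isometry,
    the crude one for surjectivity. *)
Lemma integral_extension (u : lin_op (mult_form E) (dual F))
    (nu : {charge set (borel BP) -> \bar K}) (V : R) : 0 <= V ->
  represents nu u ->
  (forall (h : borel BP -> K) (M : R), bounded_measurable h ->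
    (forall x, rnorm (h x) <= M) -> rnorm (scalar_integral nu h) <= V * M) ->
  exists2 phi : dual (compact_op E F), opnorm phi <= V & hyper_borel E F phi = u.
Proof.
move=> V0 nuu nuV.
have [|||phi phiV phiE] := @hahn_banach_norm R k (compact_op E F) V
  (fun f a => exists2 s : seq (mult_form E * F), f = \sum_(z <- s) tensor z.1 z.2 &
    a = \sum_(z <- s) (u z.1 z.2 : K)) V0.
- by exists [::]; rewrite big_nil.
- move=> c _ _ _ _ [s -> ->] [t -> ->].
  exists ([seq (c *: z.1, z.2) | z <- s] ++ t).
    rewrite big_cat big_map /= scaler_sumr; congr (_ + _); apply: eq_bigr => z _.
    by apply: op_eq => x /=; rewrite scalerA.
  rewrite big_cat big_map /= mulr_sumr; congr (_ + _); apply: eq_bigr => z _.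
  by rewrite lin_opZ.
- move=> _ _ [s -> ->]; rewrite rnorm_opE.
  have [bs sE] := @bounded_measurable_sum R k _ (borel BP) nu _ s
    (fun z p => weak_star_val p.1 z.1 * weak_star_val p.2 (bidual z.2))
    (fun z => pairing_bounded_measurable z.1 (bidual z.2)).
  have -> : \sum_(z <- s) (u z.1 z.2 : K) =
      scalar_integral nu (fun p : borel BP =>
        \sum_(z <- s) weak_star_val p.1 z.1 * weak_star_val p.2 (bidual z.2)).
    by rewrite sE; apply: eq_bigr => z _; rewrite -nuu.
  by apply: nuV => // p; exact: tensor_pairing_le.
exists phi => //; apply: op_eq => A; apply: op_eq => y.
rewrite -[LHS]/(phi (tensor A y)); apply: phiE.
by exists [:: (A, y)]; rewrite big_seq1.
Qed.

End IntegralExtension.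

(** * Finite-rank operators as tensors, and step approximation of compact operators *)

Section FiniteRank.
Variables (R : realType) (k : scalar_kind).
Local Notation K := (scalar_field R k).

Lemma lin_op_exists (X Y : normedModType K) (f : X -> Y) (M : R) : linear f ->
  (forall x, rnorm (f x) <= M * rnorm x) -> exists g : lin_op X Y, forall x, g x = f x.
Proof.
move=> lf fM; have cf : continuous_linear f.
  by split => //; exact: linear_rnorm_continuous lf fM.
by exists (Op (cf : opmem (linear_class X Y) _)).
Qed.

Lemma lin_op_comp (X Y Z : normedModType K) (f : lin_op Y Z) (g : lin_op X Y) :
  exists h : lin_op X Z, forall x, h x = f (g x).
Proof.
apply: (@lin_op_exists _ _ _ (opnorm f * opnorm g)).
  by move=> a x y; rewrite !lin_opD !lin_opZ.
move=> x; apply: le_trans (lin_op_rnorm_le _ _) _; rewrite -mulrA.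
by apply: ler_wpM2l; [exact: opnorm_ge0|exact: lin_op_rnorm_le].
Qed.

Lemma lin_op_rank1 (X Y : normedModType K) (f : dual X) (y : Y) :
  exists h : lin_op X Y, forall x, h x = (f x : K) *: y.
Proof.
apply: (@lin_op_exists _ _ _ (opnorm f * rnorm y)).
  by move=> a u v; rewrite lin_opD lin_opZ scalerDl scalerA.
move=> x; rewrite rnormZ mulrAC; apply: ler_wpM2r; first exact: rnorm_ge0.
exact: lin_op_rnorm_le.
Qed.

Variables X Y : normedModType K.

(** [finite_rank] gives spanning vectors, with neither independence nor continuous coefficients. A
    functional l with l(b) b = b, b the last vector, splits off the continuous rank-one part (l o T)
    (x) b; the rest takes values in the span of the m vectors b_i - l(b_i) b. *)
Lemma finite_rank_expand (T : lin_op X Y) : finite_rank T ->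
  exists s : seq (dual X * Y), forall x, T x = \sum_(z <- s) (z.1 x : K) *: z.2.
Proof.
move=> [m]; elim: m T => [|m IH] T [b Tb].
  by exists [::] => x; have [c ->] := Tb x; rewrite big_ord0 big_nil.
have [l0 _ l0E] := norming_functional (b ord_max).
pose l : dual Y := `|b ord_max|^-1 *: l0.
have lb : (l (b ord_max) : K) *: b ord_max = b ord_max.
  rewrite -[l _]/(`|b ord_max|^-1 * (l0 (b ord_max) : K)) l0E.
  have [->|b0] := eqVneq (b ord_max) 0; first by rewrite scaler0.
  by rewrite mulVf ?scale1r// normr_eq0.
clearbody l.
have [lT lTE] := lin_op_comp l T.
have [S SE] := lin_op_rank1 lT (b ord_max).
have [|s sE] := IH (T - S).
  exists (fun i => b (widen_ord (leqnSn m) i) -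
    (l (b (widen_ord (leqnSn m) i)) : K) *: b ord_max) => x.
  have [c cE] := Tb x; exists (fun i => c (widen_ord (leqnSn m) i)).
  have lTx : l (T x) =
      \sum_(i < m) c (widen_ord (leqnSn m) i) * (l (b (widen_ord (leqnSn m) i)) : K) + c ord_max * (l (b ord_max) : K) :> K.
    rewrite cE lin_op_sum big_ord_recr /=.
    by congr (_ + _); [apply: eq_bigr => i _|]; rewrite lin_opZ.
  rewrite -[LHS]/(T x - S x) SE lTE lTx scalerDl -scalerA lb cE big_ord_recr /=.
  rewrite opprD addrACA subrr addr0 scaler_suml -sumrB; apply: eq_bigr => i _.
  by rewrite scalerBr scalerA.
exists ((lT, b ord_max) :: s) => x.
by rewrite big_cons /= -SE -sE -[T x](subrK (S x)) addrC.
Qed.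

End FiniteRank.

Section CompactCode.
Variables (R : realType) (k : scalar_kind) (n : nat).
Local Notation K := (scalar_field R k).
Variables (E : 'I_n -> normedModType K) (F : normedModType K).

(** A finite d-net of the range: a point is coded by the first centre within d of its value. *)
Lemma compact_op_code (f : compact_op E F) (d : R) : 0 < d ->
  exists (I : finType) (c : box E -> I) (t : I -> F),
    forall x, rnorm (f (sval x) - t (c x)) <= d.
Proof.
move=> d0; have [_ [C CA [cC _]]] := op_memP f.
have := cC; rewrite compact_cover => /(_ F setT (fun y => [set z | rnorm (y - z) < d])).
move=> [y _|z _|D' _ CD'].
- rewrite openE => z /= yz; have d1 : 0 < d - rnorm (y - z) by rewrite subr_gt0.
  apply: filterS (rnorm_nbhs z d1) => w /= zw.
  have -> : y - w = (y - z) + (z - w) by rewrite addrA subrK.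
  by apply: le_lt_trans (rnormD _ _) _; rewrite addrC -ltrBrDr.
- by exists z => //=; rewrite subrr rnorm0.
pose s : seq F := enum_fset D'.
pose ix (x : box E) := find (fun y => rnorm (y - f (sval x)) < d) s.
(* The extra index is the value of [find] on failure, which the covering rules out. *)
exists 'I_(size s).+1, (fun x => inord (ix x)), (fun i : 'I_(size s).+1 => nth 0 s (val i)) => x.
have [y /= yD yx] : cover [set` D'] (fun y => [set z | rnorm (y - z) < d]) (f (sval x)).
  by apply: CD'; apply: CA; exists (sval x) => //; exact: svalP x.
have hs : has (fun y => rnorm (y - f (sval x)) < d) s by apply/hasP; exists y.
rewrite inordK; last by rewrite ltnS find_size.
by rewrite rnorm_distC ltW//; exact: (nth_find 0 hs).
Qed.

End CompactCode.

(** * Injectivity under the approximation property *)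

Section CompForm.
Variables (R : realType) (k : scalar_kind) (n : nat).
Local Notation K := (scalar_field R k).
Variables (E : 'I_n -> normedModType K) (F : normedModType K).

Lemma comp_form_cm (q : dual F) (f : compact_op E F) :
  continuous_multilinear (fun x => q (f x) : K).
Proof.
have [[mf cf] _] := op_memP f; have [lq cq] := op_memP q; split.
  by move=> i x a s t; rewrite mf lq.
move=> x; apply: (continuous_comp (f := (f : prod_topology E -> F)) (g := (q : F -> K))).
  exact: cf.
exact: cq.
Qed.

Definition comp_form (q : dual F) (f : compact_op E F) : mult_form E :=
  Op (comp_form_cm q f : opmem (multilinear_class E K) _).

(** Weak-star to norm continuity of the adjoint of f on the dual ball: closeness at the finitely
    many points of a net of the range is a weak-star condition, and it spreads to the whole range
    since functionals in the ball are contractions. *)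
Lemma comp_form_weak_star_continuous (f : compact_op E F) :
  continuous (fun q : weak_star_ball F => comp_form (weak_star_val q) f).
Proof.
move=> q; apply: rnorm_cvg; first by apply: fmap_filter; exact: nbhs_filter.
move=> e e0; have d0 : 0 < e / 4 by rewrite divr_gt0.
have [I [c [t ft]]] := compact_op_code f d0.
have near_t : nbhs q [set p : weak_star_ball F | forall i : I,
    rnorm (weak_star_val q (t i) - weak_star_val p (t i) : K) < e / 4].
  apply: (@filter_forall _ I
    (fun i p => rnorm (weak_star_val q (t i) - weak_star_val p (t i) : K) < e / 4)
    _ (nbhs_filter q)).
  move=> i; exact: (weak_star_eval_continuous (@rnorm_nbhs R k K (weak_star_val q (t i)) _ d0)).
apply: (@filterS _ _ (nbhs_filter q) _ _ _ near_t) => p /= qp.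
rewrite rnorm_opE; apply: (@le_lt_trans _ _ (e / 4 + e / 4 + e / 4)); last by lra.
apply: opnorm_le => x Bx.
pose x' : box E := exist _ x Bx.
rewrite -[X in rnorm X]/((weak_star_val q (f x) : K) - weak_star_val p (f x)).
have -> : (weak_star_val q (f x) : K) - weak_star_val p (f x) =
    weak_star_val q (f x - t (c x')) + (weak_star_val q (t (c x')) - weak_star_val p (t (c x')))
    + weak_star_val p (t (c x') - f x).
  rewrite !lin_opD !lin_opN.
  set a := weak_star_val q _; set b := weak_star_val q _.
  by rewrite [a - b + _]addrA subrK [a - _ + _]addrA subrK.
have tx := ft x'.
apply: le_trans (rnormD _ _) _; apply: lerD.
  apply: le_trans (rnormD _ _) _; apply: lerD; last exact: ltW.
  by apply: le_trans (weak_star_ball_le _ _) _; exact: tx.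
by apply: le_trans (weak_star_ball_le _ _) _; rewrite rnorm_distC; exact: tx.
Qed.

End CompForm.

Section InjectivityForms.
Variables (R : realType) (k : scalar_kind) (n : nat).
Local Notation K := (scalar_field R k).
Variables (E : 'I_n -> normedModType K) (F : normedModType K).
Hypothesis AP : approximation_property (mult_form E).

(** The approximation property is applied to the compact image of the dual ball under q |-> q o f. A
    finite-rank S, sum of g (x) A, close to the identity there suggests the tensors A (x) y with
    q(y) close to g(q o f); a norming functional q reduces the error at x to this comparison. *)
Lemma tensor_dense_forms (f : compact_op E F) (e : R) : 0 < e ->
  exists s : seq (mult_form E * F), opnorm (f - \sum_(z <- s) tensor z.1 z.2) <= e.
Proof.
move=> e0; have e2 : 0 < e / 2 by rewrite divr_gt0.
pose j (q : weak_star_ball F) : mult_form E := comp_form (weak_star_val q) f.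
have cj : compact (j @` [set: weak_star_ball F]).
  apply: continuous_compact; last exact: weak_star_ball_compact.
  by apply: continuous_subspaceT => q; exact: comp_form_weak_star_continuous.
have [S [rS SC]] := AP cj e2.
have [s sE] := finite_rank_expand rS.
pose N := \sum_(z <- s) opnorm z.1 * opnorm z.2.
have N0 : 0 <= N by apply: sumr_ge0 => z _; apply: mulr_ge0; exact: opnorm_ge0.
pose d := e / 2 / (N + 1).
have d0 : 0 < d by rewrite divr_gt0// ltr_wpDl.
have [I [c [t ft]]] := compact_op_code f d0.
have /choice[ext extP] : forall g : dual (mult_form E),
    exists h : dual (opspace (bounded_class (box E) K)), opnorm h <= opnorm g /\
    forall (A : mult_form E) (b : opspace (bounded_class (box E) K)),
      (forall x, b x = A (sval x)) -> h b = g A.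
  by move=> g; have [h hg hE] := extend_to_bounded g erefl; exists h.
(* In general q |-> g(q o f) lies only in the bidual of [F]. Replacing f by the step function t o c
   brings it into [F]: the extension of g to bounded functions takes q o t o c to q(y g). *)
pose y (g : dual (mult_form E)) : F := \sum_i (vmeasure (ext g) c i 1 : K) *: t i.
exists [seq (z.2, y z.1) | z <- s].
apply: opnorm_le => x Bx; pose x' : box E := exist _ x Bx.
set w := (_ - _ : compact_op E F) x.
have [q q1 qw] := norming_functional w.
have [p pE] := weak_star_ball_exists q1.
suff : rnorm (q w : K) <= e by rewrite qw /rnorm normr_id.
have wE : w = f x - \sum_(z <- s) (z.2 x : K) *: y z.1.
  rewrite /w big_map -[LHS]/(f x - (\sum_(z <- s) tensor z.2 (y z.1) : compact_op E F) x).
  by rewrite op_sumE.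
have vZ (h : dual K) (a : K) : h a = a * (h 1 : K).
  by rewrite -[in LHS](mulr1 a) -[RHS]/(a *: (h 1 : K)) -lin_opZ.
have qy (g : dual (mult_form E)) : q (y g) = ext g (step c (fun i => q (t i) : K)).
  rewrite vmeasure_step lin_op_sum; apply: eq_bigr => i _.
  by rewrite lin_opZ (vZ (vmeasure (ext g) c i) (q (t i))); exact: mulrC.
have bq : bounded_functions (fun x : box E => j p (sval x) : K).
  exact: box_bounded.
pose b : opspace (bounded_class (box E) K) := Op (bq : opmem (bounded_class (box E) K) _).
have extb g : ext g b = g (j p) by exact: (extP g).2.
have qwE : q w = (j p - S (j p)) x +
    \sum_(z <- s) ext z.1 (b - step c (fun i => q (t i) : K)) * (z.2 x : K) :> K.
  rewrite wE lin_opD lin_opN lin_op_sum.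
  rewrite -[X in _ = X + _]/((j p x : K) - S (j p) x) sE op_sumE -addrA -pE; congr (_ + _).
  rewrite -sumrN -sumrN -big_split /=; apply: eq_bigr => z _.
  rewrite lin_opZ lin_opD lin_opN extb pE qy mulrBl addrA.
  rewrite -[X in _ = - X + _ - _]/((z.1 (j p) : K) * z.2 x) addNr sub0r.
  by congr (- _); exact: mulrC.
rewrite qwE (splitr e); apply: le_trans (rnormD _ _) _; apply: lerD.
  have Cp : (j @` [set: weak_star_ball F]) (j p) by exists p.
  have := SC _ Cp.
  rewrite rnorm_distC rnorm_opE; apply: le_trans; exact: opnorm_ub.
apply: le_trans (rnorm_sum _ _ _) _.
apply: (@le_trans _ _ (\sum_(z <- s) (opnorm z.1 * opnorm z.2) * d)); last first.
  rewrite -mulr_suml -/N /d mulrCA -[leRHS]mulr1; apply: ler_wpM2l; first exact: ltW.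
  by rewrite ler_pdivrMr ?ltr_wpDl// mul1r lerDl.
apply: ler_sum => z _; rewrite rnormM mulrAC.
apply: ler_pM; try exact: rnorm_ge0; last exact: opnorm_ub.
apply: le_trans (lin_op_rnorm_le _ _) _; apply: ler_pM.
- exact: opnorm_ge0.
- exact: rnorm_ge0.
- exact: (extP z.1).1.
rewrite rnorm_opE; apply: opnorm_le => v _.
rewrite -[X in rnorm X]/((weak_star_val p (f (sval v)) : K) - q (t (c v))) pE.
rewrite -lin_opN -lin_opD; apply: le_trans (lin_op_rnorm_le _ _) _.
rewrite -[leRHS]mul1r; apply: ler_pM => //; [exact: opnorm_ge0|exact: rnorm_ge0].
Qed.

Lemma hyper_borel_injective_forms (phi : dual (compact_op E F)) :
  (forall A y, phi (tensor A y) = 0) -> forall f, phi f = 0.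
Proof.
move=> phi0 f; apply: rnorm_eq0; apply/eqP; rewrite eq_le rnorm_ge0 andbT.
apply/ler_addgt0Pr => e e0; rewrite add0r.
have p0 : 0 <= opnorm phi := opnorm_ge0 phi.
have d0 : 0 < e / (opnorm phi + 1) by rewrite divr_gt0// ltr_wpDl.
have [s sE] := tensor_dense_forms f d0.
have -> : phi f = phi (f - \sum_(z <- s) tensor z.1 z.2).
  by rewrite lin_opD lin_opN lin_op_sum big1 ?subr0// => z _; rewrite phi0.
apply: le_trans (lin_op_rnorm_le _ _) _; rewrite rnorm_opE.
apply: le_trans (ler_wpM2l p0 sE) _.
rewrite mulrCA -[leRHS]mulr1; apply: ler_wpM2l; first exact: ltW.
by rewrite ler_pdivrMr ?ltr_wpDl// mul1r lerDl.
Qed.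

End InjectivityForms.

(** * Null families and the tensors carried by step functions *)

Lemma expr2V_small (R : realType) (r : R) : 0 < r ->
  exists N : nat, forall m : nat, (N <= m)%N -> 2 ^- m < r.
Proof.
move=> r_gt0; exists (Num.truncn r^-1).+1 => m Nm.
rewrite invf_plt ?posrE ?exprn_gt0//; apply: lt_le_trans (truncnS_gt _) _.
apply: (@le_trans _ _ m%:R); first by rewrite ler_nat.
by rewrite -natrX ler_nat ltnW// ltn_expl.
Qed.

(** Every ball around 0 contains all but finitely many members, so a filter on the set that does not
    cluster at 0 lives on a finite subset. *)
Lemma null_family_compact (R : realType) (k : scalar_kind)
    (V : normedModType (scalar_field R k)) (s : nat -> seq V) :
  (forall m v, v \in s m -> rnorm v <= 2 ^- m) ->
  compact [set v | v = 0 \/ exists m, v \in s m].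
Proof.
move=> sle F FF FC.
have [F0|] := pselect (cluster F 0); first by exists 0; split => //; left.
move=> /existsNP[A /existsNP[B /not_implyP[FA /not_implyP[B0 /set0P/negP]]]].
rewrite negbK => /eqP AB0.
move: B0 => /nbhs_normP[r0 /ofreal_gt0P[r r_gt0 ->] rB].
have [N Nr] := expr2V_small r_gt0.
pose D : set V := [set v | exists2 m, (m < N)%N & v \in s m].
have fD : compact D.
  have -> : D = [set` flatten [seq s m | m <- iota 0 N]].
    apply/seteqP; split=> v /=.
      move=> [m mN vs]; apply/flattenP; exists (s m) => //.
      by apply: map_f; rewrite mem_iota.
    move=> /flattenP[_ /mapP[m + ->] vs]; rewrite mem_iota /= => mN.
    by exists m.
  by apply: finite_compact; exact: finite_seq.
have FD : F D.
  apply: filterS (filterI FA FC) => v [Av [v0|[m vm]]].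
    have : (A `&` B) v; last by rewrite AB0.
    by split => //; apply: rB; rewrite /= v0 subrr normr0 -(ofreal0 R k) ofreal_lt.
  exists m => //; rewrite ltnNge; apply/negP => Nm.
  have : (A `&` B) v; last by rewrite AB0.
  split => //; apply: rB; rewrite /= sub0r normrN -rnormE ofreal_lt.
  by apply: le_lt_trans (Nr _ Nm); exact: sle vm.
have [v [[m _ vm] Fv]] := fD F FF FD.
by exists v; split => //; right; exists m.
Qed.

Section VectorMeasureFunctional.
Variables (R : realType) (k : scalar_kind).
Local Notation K := (scalar_field R k).
Variables (T : pointedType) (F : normedModType K).
Local Notation BF := (opspace (bounded_class T F)).
Variable Psi : dual BF.

Definition simple (h : BF) :=
  exists (I : finType) (c : T -> I), forall x y, c x = c y -> h x = h y.

Lemma simpleB h1 h2 : simple h1 -> simple h2 -> simple (h1 - h2).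
Proof.
move=> [I [c ch]] [J [d dh]]; exists (I * J)%type, (fun x => (c x, d x)).
move=> x y [cxy dxy]; rewrite -[LHS]/(h1 x - h2 x) -[RHS]/(h1 y - h2 y).
by rewrite (ch x y)// (dh x y).
Qed.

Lemma weighted_bounded (q : dual F) (h : BF) (v : F) :
  bounded_functions (fun x => (q (h x) : K) *: v).
Proof.
exists (opnorm q * opnorm h * rnorm v) => x; rewrite rnormZ.
apply: ler_wpM2r; first exact: rnorm_ge0.
apply: le_trans (lin_op_rnorm_le _ _) _; apply: ler_wpM2l; first exact: opnorm_ge0.
exact: opnorm_ub.
Qed.

(** The rank-one operator q (x) v composed with h; [Psi] at it is a matrix entry of the operator
    attached to h. *)
Definition weighted (q : dual F) (h : BF) (v : F) : BF :=
  Op (weighted_bounded q h v : opmem (bounded_class T F) _).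

Lemma weighted_le q h v : opnorm (weighted q h v) <= opnorm q * opnorm h * rnorm v.
Proof.
apply: opnorm_le => x _; rewrite /= rnormZ.
apply: ler_wpM2r; first exact: rnorm_ge0.
apply: le_trans (lin_op_rnorm_le _ _) _; apply: ler_wpM2l; first exact: opnorm_ge0.
exact: opnorm_ub.
Qed.

(* [theta q h] is the weak-star integral of the scalar function [q \o h] against the
   F*-valued measure of [Psi]. *)
Lemma theta_exists : exists theta : dual F -> BF -> dual F,
  forall q h v, theta q h v = Psi (weighted q h v).
Proof.
have H (z : dual F * BF) : exists t : dual F, forall v, t v = Psi (weighted z.1 z.2 v).
  apply: (@lin_op_exists _ _ _ _ _ (opnorm Psi * (opnorm z.1 * opnorm z.2))).
    move=> a u v; rewrite -lin_opZ -lin_opD; congr (Psi _); apply: op_eq => x /=.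
    by rewrite scalerDr !scalerA mulrC.
  move=> v; apply: le_trans (lin_op_rnorm_le _ _) _; rewrite -mulrA.
  apply: ler_wpM2l; first exact: opnorm_ge0.
  by rewrite rnorm_opE; exact: weighted_le.
have /choice[t tE] := H.
by exists (fun q h => t (q, h)) => q h v; rewrite tE.
Qed.

(** The list stands for the tensor sum of z.1 (x) z.2. The third clause is its trace and the fourth
    the operator q |-> sum of q(z.2) z.1 on [dual F], while the first two bound its projective norm
    by |Psi| |h|. *)
Lemma simple_expand (h : BF) : simple h -> exists s : seq (dual F * F),
  [/\ \sum_(z <- s) opnorm z.1 <= opnorm Psi,
      forall z, z \in s -> rnorm z.2 <= opnorm h,
      Psi h = \sum_(z <- s) (z.1 z.2 : K) &
      forall q v, Psi (weighted q h v) = \sum_(z <- s) (q z.2 : K) * (z.1 v : K)].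
Proof.
move=> [I [c ch]].
pose r i : T := if pselect (exists x, c x = i) is left ex then projT1 (cid ex) else point.
have rP x : c (r (c x)) = c x.
  rewrite /r; case: pselect => [ex|[]]; last by exists x.
  by case: cid.
have hr x : h (r (c x)) = h x by exact: ch.
exists [seq (vmeasure Psi c i, h (r i)) | i <- enum I]; split.
- by rewrite big_map big_enum; exact: vmeasure_variation.
- by move=> _ /mapP[i _ ->]; exact: opnorm_ub.
- rewrite big_map big_enum -vmeasure_step; congr (Psi _); apply: op_eq => x /=.
  by rewrite hr.
- move=> q v; rewrite big_map big_enum /=.
  transitivity (Psi (step c (fun i => (q (h (r i)) : K) *: v))).
    by congr (Psi _); apply: op_eq => x /=; rewrite hr.
  by rewrite vmeasure_step; apply: eq_bigr => i _; rewrite lin_opZ.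
Qed.

End VectorMeasureFunctional.

Section InjectivityDual.
Variables (R : realType) (k : scalar_kind) (n : nat).
Local Notation K := (scalar_field R k).
Variables (E : 'I_n -> normedModType K) (F : normedModType K).
Hypothesis AP : approximation_property (dual F).
Local Notation BF := (opspace (bounded_class (box E) F)).

(* phi(f) is the trace of the nuclear operator sum_m sum_(z in s m) z.1 (x) z.2 on F*;
   vanishing on tensors makes that operator zero, and the approximation property then
   makes its trace zero. *)
Lemma hyper_borel_injective_dual (phi : dual (compact_op E F)) :
  (forall A y, phi (tensor A y) = 0) -> forall f, phi f = 0.
Proof.
move=> phi0 f.
have [Psi _ PE] := @extend_to_bounded R k n E F _ phi erefl.
have [theta thetaE] := theta_exists Psi.
have P0 : 0 <= opnorm Psi by exact: opnorm_ge0.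
have bf : bounded_functions (fun x : box E => f (sval x)) by exact: box_bounded.
pose h : BF := Op (bf : opmem (bounded_class (box E) F) _).
have Ph : Psi h = phi f by exact: PE.
pose B := opnorm h + 1.
have B0 : 0 < B by rewrite ltr_wpDl// opnorm_ge0.
(* The rate is 4^-m because half of the decay will pay for normalizing the functionals of step m to
   norm 2^-m. Having B at least |h| permits T 0 = 0, so that the differences D m telescope to T
   N. *)
have /choice[T TP] : forall m : nat, exists t : BF,
    [/\ simple t, opnorm (h - t) <= B * 4 ^- m & (m = 0%N -> t = 0)].
  case=> [|m].
    exists 0; split => //; first by exists unit, (fun=> tt).
    by rewrite expr0 invr1 mulr1 subr0 lerDl.
  have d0 : 0 < B * 4 ^- m.+1 by rewrite mulr_gt0// invr_gt0 exprn_gt0.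
  have [I [c [t ct]]] := compact_op_code f d0.
  exists (step c t); split => //; first by exists I, c => x y /= ->.
  by apply: opnorm_le => x _; exact: ct.
have Ts m : simple (T m) by have [] := TP m.
have Th m : opnorm (h - T m) <= B * 4 ^- m by have [] := TP m.
have T0 : T 0%N = 0 by have [_ _ ->] := TP 0%N.
pose D m : BF := T m.+1 - T m.
have Dle m : opnorm (D m) <= 2 * B * 4 ^- m.
  have -> : D m = (h - T m) - (h - T m.+1).
    by rewrite /D opprB [RHS]addrC addrA subrK.
  rewrite -rnorm_opE; apply: le_trans (rnormD _ _) _; rewrite rnormN !rnorm_opE.
  rewrite -mulrA mulr_natl mulr2n; apply: lerD; first exact: Th.
  apply: le_trans (Th _) _; apply: ler_wpM2l; first exact: ltW.
  rewrite lef_pV2 ?posrE ?exprn_gt0// exprS ler_peMl ?exprn_ge0//.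
  by rewrite ler1n.
have sumD N : \sum_(m < N) D m = T N.
  by rewrite -(big_mkord xpredT D) telescope_sumr// T0 subr0.
have /choice[s sP] := fun m => simple_expand Psi (simpleB (Ts m.+1) (Ts m)).
(* Rescaling to norm 2^-m (0 if g = 0) makes the functionals of all steps one null family, to which
   the approximation property applies. *)
pose unit_of m (g : dual F) : dual F := ofreal k (2 ^- m / opnorm g) *: g.
pose C : set (dual F) := [set g | g = 0 \/ exists m, g \in [seq unit_of m z.1 | z <- s m]].
have cC : compact C.
  apply: null_family_compact => m _ /mapP[z _ ->].
  rewrite rnormZ rnorm_ofreal; last by rewrite divr_ge0// ?opnorm_ge0// invr_ge0 exprn_ge0.
  rewrite rnorm_opE; have [->|z0] := eqVneq (opnorm z.1) 0.
    by rewrite mulr0 invr_ge0 exprn_ge0.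
  by rewrite divfK.
(* [weighted q h v] is the restriction of the tensor of q o f and v, on which phi vanishes. *)
have theta0 q : theta q h = 0.
  apply: op_eq => v; rewrite thetaE -[RHS](phi0 (comp_form q f) v).
  exact: PE.
have thetaD q h1 h2 : theta q (h1 + h2) = theta q h1 + theta q h2.
  apply: op_eq => v; rewrite -[RHS]/((theta q h1 v : K) + theta q h2 v) !thetaE -lin_opD.
  by congr (Psi _); apply: op_eq => x /=; rewrite lin_opD scalerDl.
have theta_le q h1 : opnorm (theta q h1) <= opnorm Psi * (opnorm q * opnorm h1).
  apply: opnorm_le => v v1; rewrite thetaE; apply: le_trans (lin_op_rnorm_le _ _) _.
  apply: ler_wpM2l => //; rewrite rnorm_opE; apply: le_trans (weighted_le _ _ _) _.
  rewrite -[leRHS]mulr1; apply: ler_wpM2l => //.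
  by apply: mulr_ge0; exact: opnorm_ge0.
have thetaTN q N : theta q (T N) = \sum_(m < N) theta q (D m).
  elim: N => [|N IH].
    rewrite big_ord0 T0; apply: rnorm_eq0; apply/eqP; rewrite eq_le rnorm_ge0 andbT.
    rewrite rnorm_opE; apply: le_trans (theta_le _ _) _.
    by rewrite -[opnorm 0]rnorm_opE rnorm0 !mulr0.
  by rewrite big_ord_recr /= -IH -thetaD /D [T N + _]addrC subrK.
have thetaT_le q N : opnorm (theta q (T N)) <= opnorm Psi * (opnorm q * (B * 4 ^- N)).
  have -> : theta q (T N) = theta q (T N - h).
    by rewrite -[RHS]addr0 -(theta0 q) -thetaD subrK.
  apply: le_trans (theta_le _ _) _; apply: ler_wpM2l => //.
  apply: ler_wpM2l; first exact: opnorm_ge0.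
  by rewrite -rnorm_opE rnorm_distC rnorm_opE.
have thetaE' q m : theta q (D m) = \sum_(z <- s m) (q z.2 : K) *: z.1.
  apply: op_eq => v; have [_ _ _ E4] := sP m.
  by rewrite thetaE E4 op_sumE.
have geo N : \sum_(m < N) 2 ^- m <= 2 - 2 * 2 ^- N :> R.
  elim: N => [|N IH]; first by rewrite big_ord0 expr0 invr1 mulr1 subrr.
  rewrite big_ord_recr /=; have -> : 2 ^- N.+1 = 2 ^- N / 2 :> R.
    by rewrite exprS invfM mulrC.
  by have := IH; lra.
apply: rnorm_eq0; apply/eqP; rewrite eq_le rnorm_ge0 andbT.
apply/ler_addgt0Pr => e e0; rewrite add0r.
(* Half of e goes to [A2], bounded by 4 B |Psi| e'. The other half covers [A1] and the tail h - T
   N0, both bounded by multiples of 4^-N0 once S is fixed; hence N0 is chosen after S. *)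
pose e' := e / 2 / (4 * B * opnorm Psi + 1).
have BP0 : 0 <= 4 * B * opnorm Psi by rewrite !mulr_ge0// ltW.
have e'0 : 0 < e' by rewrite !divr_gt0// ltr_wpDl.
have [S [rS SC]] := AP cC e'0.
have [W SW] := finite_rank_expand rS.
pose cW := \sum_(w <- W) opnorm w.1 * (opnorm Psi * (opnorm w.2 * B)).
have cW0 : 0 <= cW.
  apply: sumr_ge0 => w _; rewrite !mulr_ge0// ?opnorm_ge0//; exact: ltW.
pose c := opnorm Psi * B + cW.
have c0 : 0 <= c by rewrite addr_ge0// mulr_ge0// ltW.
have r0 : 0 < e / 2 / (c + 1) by rewrite !divr_gt0// ltr_wpDl.
have [N0 Nr] := expr2V_small r0.
have {Nr}Nr : 4 ^- N0 < e / 2 / (c + 1).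
  apply: le_lt_trans (Nr N0 (leqnn _)).
  rewrite lef_pV2 ?posrE ?exprn_gt0//; apply: lerXn2r; rewrite ?nnegrE//.
  by rewrite ler_nat.
have Sz m z : z \in s m -> opnorm (S z.1 - z.1) <= e' * 2 ^+ m * opnorm z.1.
  move=> zs; have [z0|z0] := eqVneq (opnorm z.1) 0.
    have -> : z.1 = 0 by apply: rnorm_eq0; rewrite rnorm_opE.
    by rewrite lin_op0 subr0 -[opnorm 0]rnorm_opE rnorm0 mulr0.
  have zgt0 : 0 < opnorm z.1 by rewrite lt_neqAle eq_sym z0 opnorm_ge0.
  have Cu : C (unit_of m z.1) by right; exists m; apply/mapP; exists z.
  have zE : z.1 = ofreal k (2 ^+ m * opnorm z.1) *: unit_of m z.1.
    rewrite /unit_of scalerA -ofrealM -{1}[z.1]scale1r -(ofreal1 R k).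
    congr (ofreal k _ *: _); rewrite mulrACA mulfV ?expf_neq0//.
    by rewrite mulfV// mulr1.
  have -> : S z.1 - z.1 = ofreal k (2 ^+ m * opnorm z.1) *: (S (unit_of m z.1) - unit_of m z.1).
    by rewrite scalerBr -zE -lin_opZ -zE.
  rewrite -rnorm_opE rnormZ rnorm_ofreal; last by rewrite mulr_ge0// ?exprn_ge0// ltW.
  have -> : e' * 2 ^+ m * opnorm z.1 = 2 ^+ m * opnorm z.1 * e' by ring.
  apply: ler_wpM2l; last exact: SC.
  by rewrite mulr_ge0// ?exprn_ge0// ltW.
(* The trace of the truncated operator is its trace after composition with S ([A1]) minus that after
   composition with S - id ([A2]). *)
pose A1 : K := \sum_(m < N0) \sum_(z <- s m) (S z.1 z.2 : K).
pose A2 : K := \sum_(m < N0) \sum_(z <- s m) ((S z.1 - z.1) z.2 : K).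
have PT : Psi (T N0) = A1 - A2.
  rewrite -sumD lin_op_sum /A1 /A2 -sumrB; apply: eq_bigr => m _.
  have [_ _ -> _] := sP m; rewrite -sumrB; apply: eq_bigr => z _.
  by rewrite -[(S z.1 - z.1) z.2]/((S z.1 z.2 : K) - z.1 z.2) opprB addrC subrK.
(* For S the sum of the w.1 (x) w.2, the trace of S after an operator is the sum of w.1 at the image
   of w.2. These images are small because [theta] vanishes at h. *)
have A1E : A1 = \sum_(w <- W) (w.1 (theta w.2 (T N0)) : K).
  rewrite /A1; transitivity (\sum_(w <- W) \sum_(m < N0) (w.1 (theta w.2 (D m)) : K)); last first.
    by apply: eq_bigr => w _; rewrite thetaTN lin_op_sum.
  rewrite exchange_big; apply: eq_bigr => m _ /=.
  transitivity (\sum_(w <- W) \sum_(z <- s m) (w.2 z.2 : K) * (w.1 z.1 : K)); last first.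
    apply: eq_bigr => w _; rewrite thetaE' lin_op_sum; apply: eq_bigr => z _.
    by rewrite lin_opZ.
  rewrite exchange_big; apply: eq_bigr => z _ /=.
  rewrite SW op_sumE; apply: eq_bigr => w _.
  by rewrite mulrC.
have A1le : rnorm A1 <= cW * 4 ^- N0.
  rewrite A1E; apply: le_trans (rnorm_sum _ _ _) _; rewrite /cW mulr_suml.
  apply: ler_sum => w _; apply: le_trans (lin_op_rnorm_le _ _) _; rewrite -mulrA.
  apply: ler_wpM2l; first exact: opnorm_ge0.
  by rewrite rnorm_opE; apply: le_trans (thetaT_le _ _) _; rewrite !mulrA.
have A2le : rnorm A2 <= e' * (4 * B * opnorm Psi).
  apply: le_trans (rnorm_sum _ _ _) _.
  (* Undoing the normalization costs 2^m against the 4^-m of D m, leaving 2^-m; these sum to at most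
     2, and with the 2B of [Dle] this gives 4B. *)
  apply: (@le_trans _ _ (\sum_(m < N0) e' * opnorm Psi * (2 * B) * 2 ^- m)); last first.
    rewrite -mulr_sumr; have := geo N0.
    have : 0 <= 2 ^- N0 :> R by rewrite invr_ge0 exprn_ge0.
    set x := 2 ^- N0; set y := \sum_(_ < _) _ => x0 yx.
    have y2 : y <= 2 by lra.
    have -> : e' * (4 * B * opnorm Psi) = e' * opnorm Psi * (2 * B) * 2 by ring.
    apply: ler_wpM2l => //; apply: mulr_ge0; last by rewrite mulr_ge0// ltW.
    by apply: mulr_ge0 => //; exact: ltW.
  apply: ler_sum => m _; apply: le_trans (rnorm_sum _ _ _) _.
  have [E1 E2 _ _] := sP m.
  apply: (@le_trans _ _ (\sum_(z <- s m) e' * 2 ^+ m * (2 * B * 4 ^- m) * opnorm z.1)).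
    rewrite big_seq [leRHS]big_seq; apply: ler_sum => z zs.
    apply: le_trans (lin_op_rnorm_le _ _) _; rewrite mulrAC.
    apply: ler_pM; [exact: opnorm_ge0|exact: rnorm_ge0|exact: Sz|].
    exact: le_trans (E2 z zs) (Dle m).
  have -> : e' * opnorm Psi * (2 * B) * 2 ^- m = e' * 2 ^+ m * (2 * B * 4 ^- m) * opnorm Psi.
    have -> : 4 ^- m = 2 ^- m * 2 ^- m :> R.
      by rewrite -invfM -exprMn -natrM.
    have m0 : 2 ^+ m != 0 :> R by rewrite expf_neq0.
    by field.
  rewrite -mulr_sumr; apply: ler_wpM2l => //.
  have e'1 := ltW e'0; have B1 := ltW B0.
  have p2 : 0 <= 2 ^+ m :> R by exact: exprn_ge0.
  have p4 : 0 <= 4 ^- m :> R by rewrite invr_ge0 exprn_ge0.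
  by do !apply: mulr_ge0 => //.
rewrite -Ph -[h](subrK (T N0)) lin_opD PT.
apply: le_trans (rnormD _ _) _.
have le1 : rnorm (Psi (h - T N0)) <= opnorm Psi * B * 4 ^- N0.
  apply: le_trans (lin_op_rnorm_le _ _) _; rewrite -mulrA; apply: ler_wpM2l => //.
  by rewrite rnorm_opE.
have le2 : rnorm (A1 - A2) <= cW * 4 ^- N0 + e' * (4 * B * opnorm Psi).
  by apply: le_trans (rnormD _ _) _; rewrite rnormN; apply: lerD.
have le3 : c * 4 ^- N0 <= e / 2.
  apply: le_trans (ler_wpM2l c0 (ltW Nr)) _; rewrite mulrCA -[leRHS]mulr1.
  apply: ler_wpM2l; first by rewrite divr_ge0// ltW.
  by rewrite ler_pdivrMr ?ltr_wpDl// mul1r lerDl.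
have le4 : e' * (4 * B * opnorm Psi) <= e / 2.
  rewrite /e' mulrAC -mulrA -[leRHS]mulr1; apply: ler_wpM2l.
    by rewrite divr_ge0// ltW.
  by rewrite ler_pdivrMr ?ltr_wpDl// mul1r lerDl.
rewrite [e]splitr; apply: le_trans (lerD le1 le2) _.
by rewrite addrA -mulrDl; apply: lerD.
Qed.

End InjectivityDual.

(** * The isometry *)

Section Isometry.
Variables (R : realType) (k : scalar_kind) (n : nat).
Local Notation K := (scalar_field R k).
Variables (E : 'I_n -> normedModType K) (F : normedModType K).

Lemma total_variation_ge0 d (T : measurableType d) (nu : {charge set T -> \bar K}) :
  (0 <= Defs.total_variation nu setT)%E.
Proof.
apply: (@le_trans _ _ (rnorm (fine (nu setT)))%:E); first by rewrite lee_fin rnorm_ge0.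
apply: ereal_sup_ubound; exists 1%N, (fun=> setT); split => //.
- by move=> i j _ _ _; rewrite !ord1.
- by apply/seteqP; split => // x _; exists ord0.
- by rewrite big_ord_recl big_ord0 addr0.
Qed.

Lemma hyper_borel_linear : linear (hyper_borel E F).
Proof. by move=> a phi psi; apply: op_eq => A; apply: op_eq => y. Qed.

Hypothesis AP : approximation_property (mult_form E) \/ approximation_property (dual F).

Lemma hyper_borel_inj (phi psi : dual (compact_op E F)) :
  hyper_borel E F phi = hyper_borel E F psi -> phi = psi.
Proof.
move=> BB; apply/eqP; rewrite -subr_eq0; apply/eqP; apply: op_eq.
have tensor0 A y : (phi - psi) (tensor A y) = 0.
  rewrite -[LHS]/((hyper_borel E F phi A y : K) - psi (tensor A y)) BB.
  exact: subrr.
case: AP => [APG|APF].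
  exact: hyper_borel_injective_forms APG _ tensor0.
exact: hyper_borel_injective_dual APF _ tensor0.
Qed.

Lemma integral_norm_hyper_borel (phi : dual (compact_op E F)) :
  integral_norm (hyper_borel E F phi) = (opnorm phi)%:E.
Proof.
apply/eqP; rewrite eq_le; apply/andP; split.
  have [nu [nureg nurep nuTV]] := hyper_borel_measure phi.
  by apply: le_trans nuTV; apply: ereal_inf_lbound; exists nu.
apply: le_ereal_inf_tmp => _ [nu [nureg nurep] <-].
have := total_variation_ge0 nu.
case TV : (Defs.total_variation nu setT) => [V| |]; rewrite ?leey //.
rewrite lee_fin => V0.
(* psi is built from [nu] and has norm at most V; injectivity, hence the approximation property,
   identifies it with phi. *)
have [|psi psiV psiB] := @integral_extension R k n E F _ nu V V0 nurep.
  move=> h M bh hM; rewrite mulrC; apply: scalar_integral_le => //.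
  by rewrite TV.
by rewrite lee_fin -(hyper_borel_inj psiB).
Qed.

End Isometry.

Theorem theorem3p2 (R : realType) (k : scalar_kind) (n : nat) (hn : (0 < n)%N)
    (E : 'I_n -> completeNormedModType (scalar_field R k))
    (F : completeNormedModType (scalar_field R k))
    (hAP : approximation_property (mult_form E) \/
           approximation_property (dual F)) :
  let B : dual (compact_op E F) -> lin_op (mult_form E) (dual F) :=
    hyper_borel E F in
  [/\ linear B,
      set_bij [set: dual (compact_op E F)]
        (integral_op (mult_form E) (dual F)) B &
      forall phi : dual (compact_op E F),
        integral_norm (B phi) = (opnorm phi)%:E].
Proof.
split; first exact: hyper_borel_linear.
- split.
  + move=> phi _; have [nu [nureg nurep _]] := hyper_borel_measure phi.
    by exists nu.
  + by move=> phi psi _ _; exact: hyper_borel_inj.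
  + move=> u [nu [_ nurep]].
    (* Any finite constant will do for surjectivity, and this one exists for every charge without
       first showing its total variation finite. *)
    have [V V0 nuV] := scalar_integral_cont nu.
    by have [phi _ phiB] := integral_extension V0 nurep nuV; exists phi.
- exact: integral_norm_hyper_borel.
Qed.
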